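(* Let $f(z)$ be an entire solution of the first order algebraic difference equation $$\Omega\big(z,\,f(z),\,\Delta f(z)\big)=0$$ with polynomial coefficients. Then $\sigma(f)>0$.
   Context: Here $\eta$ is a fixed non-zero complex number and $\Delta f(z)=f(z+\eta)-f(z)$. $\Omega(z,u,v)$ is a polynomial in $u$ and $v$, not identically zero, whose coefficients are polynomials in $z$. $\sigma(f)$ denotes the (Nevanlinna) order of growth of $f$, $\sigma(f)=\limsup_{r\to\infty}\log^+ T(r,f)/\log r$, where $T(r,f)$ is the Nevanlinna characteristic; for entire $f$ this equals $\limsup_{r\to\infty}\log^+\log^+ M(r,f)/\log r$ with $M(r,f)=\max_{|z|=r}|f(z)|$.
   Formalization: The solution f is assumed transcendental (entire and not a polynomial); as worded the claim fails for polynomial solutions, e.g. f(z)=z solves Δf−η=0 and has order 0, and every polynomial has order 0. *)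

(* Defs.v *)
From HB Require Import structures.
From mathcomp Require Import all_boot all_order all_algebra.
From mathcomp Require Import all_classical all_reals all_analysis.
From mathcomp Require Import complex.

Set Implicit Arguments.
Unset Strict Implicit.
Unset Printing Implicit Defensive.

Import Order.TTheory GRing.Theory Num.Theory.
Import numFieldNormedType.Exports.

Local Open Scope classical_set_scope.
Local Open Scope ring_scope.
Local Open Scope complex_scope.

Definition entire (R : realType) (f : R[i] -> R[i]) : Prop :=
  forall z : R[i], derivable (f : R[i]^o -> R[i]^o) z 1.

Definition transcendental_entire (R : realType) (f : R[i] -> R[i]) : Prop :=
  entire f /\ ~ (exists p : {poly R[i]}, forall z : R[i], f z = p.[z]).

Definition log_plus (R : realType) (x : R) : R := ln (Num.max 1 x).

(* The point r e^{i t}. *)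
Definition circle_point (R : realType) (r t : R) : R[i] :=
  (r * cos t) +i* (r * sin t).

(* T(r, f) = m(r, f) + N(r, f) for f without poles, hence with N(r, f) = 0. *)
Definition nevanlinna_char (R : realType) (f : R[i] -> R[i]) (r : R) : R :=
  (2 * pi)^-1 *
  \int[@lebesgue_measure R]_(t in `[0, 2 * pi])
     log_plus (complex.Re `|f (circle_point r t)|).

Definition growth_order (R : realType) (f : R[i] -> R[i]) : \bar R :=
  limf_esup
    (fun r : R => (log_plus (nevanlinna_char f r) / ln r)%:E)
    (pinfty_nbhs R).

Definition difference (R : realType) (eta : R[i]) (f : R[i] -> R[i])
  (z : R[i]) : R[i] := f (z + eta) - f z.

(* The outermost variable of Omega is v, the next one u, the innermost z. *)
Definition eval_zuv (R : realType) (Omega : {poly {poly {poly R[i]}}})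
  (z u v : R[i]) : R[i] := Omega.[v%:P%:P].[u%:P].[z].

(* Main.v *)
Require Import Defs.
From HB Require Import structures.
From mathcomp Require Import all_boot all_order all_algebra.
From mathcomp Require Import all_classical all_reals all_analysis.
From mathcomp Require Import complex ring lra.

(* Suppose f is transcendental of order 0, so that T(r, f) <= r^e for every
   e > 0 and all large r.  The sub-mean value property of log^+ |f| on the disc
   of radius 2 |z| gives log^+ |f(z)| <= 3 T(2 |z|, f); hence with r = x^K one
   has log |f| <= x on a large multiple of the disc |z| <= r.  By Cauchy's
   estimates the Taylor terms of index > x are negligible there and the others
   are at most 2 M(r), so on |z| <= r the first two differences of f are at most
   x^5 M(r) / r and x^5 M(r) / r^2, up to constants.  Let z be a point where
   |f(z)| is comparable to M(r) and put w = z (Delta f)(z) / f(z).  Then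
   |w| <= x^6, a small power of |z|, while |f(z)| exceeds every power of |z|, and
   with such separated scales Omega(z, f, w f / z) = 0 has a single dominant
   monomial unless |w| <= L for a constant L.  So near a maximum point a step
   of length |eta| in ANY direction multiplies |f| by at least 1 - O(1/r); going
   inwards for about r / (12 L) steps shows M(r) <= 4 M(kappa r) with a fixed
   kappa < 1.  Hence M grows polynomially and f is a polynomial.

   The Taylor expansion itself comes from Goursat's theorem on rectangles in
   the coordinate w = log z, where circles become vertical segments.  The
   sub-mean value property is first proved for polynomials: for a linear factor
   the product over the images of the N-th roots of unity under a Moebius map
   of the disc is explicit, and N tends to infinity. *)

Set Implicit Arguments.
Unset Strict Implicit.
Unset Printing Implicit Defensive.

Import Order.TTheory GRing.Theory Num.Theory.
Import numFieldNormedType.Exports.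

Local Open Scope classical_set_scope.
Local Open Scope ring_scope.
Local Open Scope complex_scope.

(** The equation controls only the increment along eta, and only where |w| is already known to be a
    small power of |z|. Order zero supplies both missing pieces. With x = r^(1/K) and K as large as
    desired, about x Taylor terms matter, which gives the a priori bound |w| <= x^6. The same count
    makes second differences small against M(r) / r, so f is almost affine at the scale |eta|: a
    step s changes f by about (s / eta) (Delta f), whatever its direction. The walk inwards
    therefore needs only |f| >= M(r) / 4 at each of its points, not a point where the maximum
    modulus is attained. Its length, a fixed fraction of r, is limited by the total loss 3 L M(r) /
    r per step. The growth estimate is stated for log^+ |f| and not for log |f| because log^+ is
    Lipschitz: uniform approximation by polynomials passes to the means, whatever the zeros do. *)

Local Notation normc := ComplexField.Normc.normc.
Local Notation Re := complex.Re.
Local Notation Im := complex.Im.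

(** * Oriented integrals of continuous functions *)

Section OrientedIntegral.
Variable R : realType.
Implicit Types (F G g h : R -> R) (a b c x y : R).
Notation mu := (@lebesgue_measure R).

Definition is_primitive F g := forall x, is_derive x 1 F (g x).

Lemma continuous_integrable_segment g a b : continuous g ->
  mu.-integrable `[a, b] (EFin \o g).
Proof.
move=> cg; apply: continuous_compact_integrable; first exact: segment_compact.
exact: continuous_subspaceT.
Qed.

Lemma is_primitive_derivable F g x : is_primitive F g -> derivable F x 1.
Proof. by move=> /(_ x)[]. Qed.

Lemma is_primitive_continuous F g : is_primitive F g -> continuous F.
Proof.
move=> pF x; apply/differentiable_continuous/derivable1_diffP.
exact: (is_primitive_derivable (g := g)).
Qed.

Lemma primitive_eq F G g a b : is_primitive F g -> is_primitive G g ->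
  F b - F a = G b - G a.
Proof.
move=> pF pG; suff : (F - G) a = (F - G) b.
  by rewrite /= !fctE => h; lra.
apply: is_derive_0_is_cst => x.
by apply: is_derive_eq (is_deriveB (pF x) (pG x)) _; rewrite subrr.
Qed.

Lemma primitive_exists g : continuous g -> exists F, is_primitive F g.
Proof.
move=> cg.
pose H a y := \int[mu]_(t in `[a, y]) g t.
pose F y := if 0 <= y then H 0 y else - H y 0.
have intg a b : mu.-integrable `[a, b] (EFin \o g).
  exact: continuous_integrable_segment.
have chasles a b c : a <= b -> b <= c -> H a c = H a b + H b c.
  move=> ab bc; rewrite /H.
  have := @Rintegral_itvB R g (BLeft a) (BRight c) b (intg a c).
  rewrite !bnd_simp => /(_ ab bc).
  rewrite Rintegral_itv_obnd_cbnd; first by move=> <-; rewrite addrC subrK.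
  by apply: integrableS (intg b c) => //; apply: subset_itvr; rewrite bnd_simp.
exists F => x.
(* Below both x and 0, so that near x the function [F] is [H a] up to the constant [H a 0], and the
   fundamental theorem for integrals starting at [a] applies. *)
pose a := Num.min x 0 - 1.
have ax : a < x by have : Num.min x 0 <= x by [rewrite ge_min lexx]; rewrite /a; lra.
have a0 : a < 0 by have : Num.min x 0 <= 0 by [rewrite ge_min lexx orbT]; rewrite /a; lra.
have FH y : a < y -> F y = H a y - H a 0.
  move=> ay; rewrite /F; case: (leP 0 y) => y0.
    by rewrite (chasles a 0 y (ltW a0) y0); lra.
  by rewrite (chasles a y 0 (ltW ay) (ltW y0)); lra.
have xx1 : x < x + 1 by rewrite ltrDl.
have [dH HE] := @continuous_FTC1_closed R g a x (x + 1) xx1 (intg _ _) ax (cg x).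
have : is_derive x 1 (fun y => H a y - H a 0) (g x).
  have dHx : is_derive x 1 (H a) (g x) by rewrite -HE derive1E; exact: derivableP.
  by apply: is_derive_eq (is_deriveB dHx (is_derive_cst (H a 0) x 1)) _; rewrite subr0.
apply: near_eq_is_derive.
near=> y; rewrite FH//; near: y; exact: lt_nbhsr.
Unshelve. all: by end_near. Qed.

(** Increment of a chosen primitive: additivity and reversal of orientation then hold for all
    endpoints and all [g]. The default 0 is met only when [g] has no primitive. *)
Definition oint g a b : R :=
  let F := xget (fun=> 0) [set F | is_primitive F g] in F b - F a.

Lemma oint_primitive F g a b : is_primitive F g -> oint g a b = F b - F a.
Proof.
move=> pF; rewrite /oint; case: xgetP => [G _ pG|/(_ F)//].
exact: primitive_eq pG pF.
Qed.

Lemma oint_chasles g a b c : oint g a b + oint g b c = oint g a c.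
Proof. by rewrite /oint; lra. Qed.

Lemma oint_sym g a b : oint g b a = - oint g a b.
Proof. by rewrite /oint opprB. Qed.

Lemma ointD g h a b : continuous g -> continuous h ->
  oint (fun x => g x + h x) a b = oint g a b + oint h a b.
Proof.
move=> /primitive_exists[G pG] /primitive_exists[H pH].
rewrite (oint_primitive a b pG) (oint_primitive a b pH).
rewrite (@oint_primitive (G + H)); first by rewrite !fctE; lra.
by move=> x; exact: is_deriveD.
Qed.

Lemma ointZ k g a b : continuous g ->
  oint (fun x => k * g x) a b = k * oint g a b.
Proof.
move=> /primitive_exists[G pG]; rewrite (oint_primitive a b pG).
rewrite (@oint_primitive (k \*: G)); first by rewrite /= mulrBr.
by move=> x; exact: is_deriveZ.
Qed.

Lemma oint_cst k a b : oint (fun=> k) a b = k * (b - a).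
Proof.
rewrite (@oint_primitive (k \*: id)); first by rewrite /= mulrBr.
by move=> x; apply: is_derive_eq (is_deriveZ k (is_derive_id x 1)) _; rewrite scaler1.
Qed.

Lemma ointN g a b : continuous g -> oint (fun x => - g x) a b = - oint g a b.
Proof.
move=> cg; rewrite -mulN1r -ointZ//; congr oint.
by apply/funext => x; rewrite mulN1r.
Qed.

Lemma oint_ge0 g a b : continuous g -> a <= b ->
  (forall x, a <= x <= b -> 0 <= g x) -> 0 <= oint g a b.
Proof.
move=> /primitive_exists[G pG] ab g0; rewrite (oint_primitive a b pG).
have [||x xab ->] := @MVT_segment R G g a b ab.
- by move=> x _; exact: pG.
- apply/continuous_subspaceT; exact: (is_primitive_continuous (g := g)).
- by rewrite mulr_ge0 ?subr_ge0// g0.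
Qed.

Lemma le_oint g h a b : continuous g -> continuous h -> a <= b ->
  (forall x, a <= x <= b -> g x <= h x) -> oint g a b <= oint h a b.
Proof.
move=> cg ch ab gh; rewrite -subr_ge0 -ointN// -ointD//; last first.
  by move=> x; apply: continuousN; exact: cg.
apply: oint_ge0 => //; first by move=> x; apply: continuousB; [exact: ch|exact: cg].
by move=> x xab; rewrite subr_ge0 gh.
Qed.

Lemma oint_norm_le g a b M : continuous g -> a <= b ->
  (forall x, a <= x <= b -> `|g x| <= M) -> `|oint g a b| <= M * (b - a).
Proof.
move=> cg ab gM; rewrite ler_norml -mulNr -!oint_cst.
by apply/andP; split; apply: le_oint => //; try exact: cst_continuous;
   move=> x /gM; rewrite ler_norml => /andP[].
Qed.

Lemma oint_sub u u' g a b : (forall x, is_derive x 1 u (u' x)) ->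
  continuous g -> oint (fun x => g (u x) * u' x) a b = oint g (u a) (u b).
Proof.
move=> du /primitive_exists[G pG].
rewrite (oint_primitive (u a) (u b) pG) (@oint_primitive (G \o u))//.
by move=> x; exact: is_derive1_comp.
Qed.

Lemma oint_shift c g a b : continuous g ->
  oint (fun x => g (x + c)) a b = oint g (a + c) (b + c).
Proof.
move=> cg; have du x : is_derive x 1 (fun y => y + c) 1.
  exact: is_derive_shift.
rewrite -(oint_sub a b du cg).
by congr oint; apply/funext => x; rewrite mulr1.
Qed.

Lemma oint_periodic p c g : continuous g -> (forall x, g (x + p) = g x) ->
  oint g c (c + p) = oint g 0 p.
Proof.
move=> cg gp; rewrite -(oint_chasles g c 0) -(oint_chasles g 0 p (c + p)).
have -> : oint g p (c + p) = oint g 0 c.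
  rewrite -[X in oint g X _](add0r p) -oint_shift//.
  by congr oint; apply/funext => x.
by rewrite (oint_sym g 0 c); lra.
Qed.

Lemma Rintegral_oint g a b : continuous g -> a < b ->
  \int[mu]_(x in `[a, b]) g x = oint g a b.
Proof.
move=> cg ab; have [G pG] := primitive_exists cg.
rewrite (oint_primitive a b pG) /Rintegral (@continuous_FTC2 R g G)//.
- exact: continuous_subspaceT.
- have cG := is_primitive_continuous pG.
  split=> [x _||].
  + exact: is_primitive_derivable pG.
  + exact/cvg_at_right_filter/cG.
  + exact/cvg_at_left_filter/cG.
- by move=> x _; rewrite derive1E; case: (pG x).
Qed.

End OrientedIntegral.

(** * Complex modulus and exponential *)

Section ComplexModulus.
Variable R : realType.
Implicit Types (z w : R[i]) (x y : R).

Lemma normr_normc z : `|z| = (normc z)%:C.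
Proof. by rewrite normc_def; case: z. Qed.

Lemma normc_ge0 z : 0 <= normc z.
Proof. by case: z => a b; exact: sqrtr_ge0. Qed.

Lemma normcD z w : normc (z + w) <= normc z + normc w.
Proof. exact: le_normcD. Qed.

Lemma normcM z w : normc (z * w) = normc z * normc w.
Proof. exact: ComplexField.Normc.normcM. Qed.

Lemma normcV z : normc z^-1 = (normc z)^-1.
Proof. exact: ComplexField.Normc.normcV. Qed.

Lemma normc0 : normc (0 : R[i]) = 0.
Proof. exact: ComplexField.Normc.normc0. Qed.

Lemma normc1 : normc (1 : R[i]) = 1.
Proof. exact: ComplexField.Normc.normc1. Qed.

Lemma normcB z w : normc (z - w) <= normc z + normc w.
Proof. by rewrite -[normc w]normcN; exact: normcD. Qed.

Lemma normc_distC z w : normc (z - w) = normc (w - z).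
Proof. by rewrite -normcN opprB. Qed.

Lemma normc_eq0 z : (normc z == 0) = (z == 0).
Proof.
apply/eqP/eqP => [/ComplexField.Normc.eq0_normc//|->]; exact: normc0.
Qed.

Lemma normc_gt0 z : (0 < normc z) = (z != 0).
Proof. by rewrite lt_def normc_ge0 andbT normc_eq0. Qed.

Lemma normcX z n : normc (z ^+ n) = normc z ^+ n.
Proof. by elim: n => [|n IH]; rewrite ?expr0 ?normc1// !exprS normcM IH. Qed.

Lemma normcR x : normc x%:C = `|x|.
Proof. by rewrite /= expr0n/= addr0 sqrtr_sqr. Qed.

Lemma normc_nat n : normc (n%:R : R[i]) = n%:R.
Proof.
by rewrite -(rmorph_nat (real_complex R)) normcR ger0_norm.
Qed.

Lemma normc_sqr z : normc z ^+ 2 = Re z ^+ 2 + Im z ^+ 2.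
Proof. by case: z => a b; rewrite sqr_sqrtr// addr_ge0// sqr_ge0. Qed.

Lemma normRe_le z : `|Re z| <= normc z.
Proof. by rewrite -lecR -normr_normc normc_ge_Re. Qed.

Lemma normIm_le z : `|Im z| <= normc z.
Proof.
rewrite -(ler_pXn2r (n := 2))// ?nnegrE ?normc_ge0// normc_sqr real_normK ?num_real//.
by rewrite lerDr sqr_ge0.
Qed.

Lemma complex_ReIm z : z = (Re z) +i* (Im z).
Proof. by case: z. Qed.

Lemma normc_le_ReIm z : normc z <= `|Re z| + `|Im z|.
Proof.
rewrite -(ler_pXn2r (n := 2))// ?nnegrE ?normc_ge0 ?addr_ge0//.
rewrite normc_sqr sqrrD !real_normK ?num_real// -addrA lerD2l.
by rewrite lerDr mulrn_wge0// mulr_ge0.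
Qed.

Lemma normc_sum (I : Type) (r : seq I) (P : pred I) (F : I -> R[i]) :
  normc (\sum_(i <- r | P i) F i) <= \sum_(i <- r | P i) normc (F i).
Proof.
elim/big_rec2: _ => [|i y x _ yx]; first by rewrite normc0.
by rewrite (le_trans (normcD _ _))// lerD2l.
Qed.

Lemma normc_prod (I : Type) (r : seq I) (P : pred I) (F : I -> R[i]) :
  normc (\prod_(i <- r | P i) F i) = \prod_(i <- r | P i) normc (F i).
Proof.
elim/big_rec2: _ => [|i y x _ <-]; [exact: normc1|exact: normcM].
Qed.

Lemma normc_ge_sub z w : normc z - normc w <= normc (z - w).
Proof. by rewrite lerBlDr (le_trans _ (normcD _ _))// subrK. Qed.

End ComplexModulus.

(** * The unit circle and the exponential *)

Section Cis.
Variable R : realType.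
Implicit Types (s t x : R) (z w : R[i]).

Definition cis t : R[i] := cos t +i* sin t.

Lemma normc_cis t : normc (cis t) = 1.
Proof. by rewrite /= cos2Dsin2 sqrtr1. Qed.

Lemma cisD s t : cis (s + t) = cis s * cis t.
Proof. by rewrite /cis cosD sinD; simpc; congr (_ +i* _); ring. Qed.

Lemma cis0 : cis 0 = 1.
Proof. by rewrite /cis cos0 sin0. Qed.

Lemma cis_neq0 t : cis t != 0.
Proof. by rewrite -normc_gt0 normc_cis. Qed.

Lemma cis_2pi : cis (2 * pi) = 1.
Proof. by rewrite mulr_natl /cis cos2pi sin2pi. Qed.

Lemma cisX n t : cis t ^+ n = cis (n%:R * t).
Proof.
elim: n => [|n IH]; first by rewrite expr0 mul0r cis0.
by rewrite exprS IH -cisD -natr1 mulrDl mul1r addrC.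
Qed.

Lemma cis_surj z : normc z = 1 -> exists t, 0 <= t <= 2 * pi /\ z = cis t.
Proof.
move=> z1; have zz : Re z ^+ 2 + Im z ^+ 2 = 1 by rewrite -normc_sqr z1 expr1n.
have Rz : -1 <= Re z <= 1 by rewrite -ler_norml -z1 normRe_le.
have sa : sin (acos (Re z)) = `|Im z|.
  rewrite sin_acos//; have -> : 1 - Re z ^+ 2 = Im z ^+ 2 by lra.
  by rewrite sqrtr_sqr.
have a0 := acos_ge0 Rz; have api := acos_lepi Rz.
have [I0|I0] := leP 0 (Im z).
  exists (acos (Re z)); split; first by apply/andP; split=> //; lra.
  by rewrite /cis acosK// sa ger0_norm// -complex_ReIm.
exists (2 * pi - acos (Re z)); split; first by apply/andP; split; lra.
rewrite cisD cis_2pi mul1r /cis cosN sinN acosK// sa ltr0_norm// opprK.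
exact: complex_ReIm.
Qed.

Lemma polar z : exists t, 0 <= t <= 2 * pi /\ z = (normc z)%:C * cis t.
Proof.
have [->|z0] := eqVneq z 0.
  by exists 0; rewrite normc0 mul0r lexx mulr_ge0// pi_ge0.
have nz : normc z != 0 by rewrite normc_eq0.
have [|t [t2 E]] := @cis_surj (z / (normc z)%:C).
  by rewrite normcM normcV normcR ger0_norm ?normc_ge0// divff.
exists t; split=> //; rewrite -E mulrC divfK//.
by rewrite eq_complex/= eqxx andbT.
Qed.


(** The exponential of s + i t, kept as a function of two real variables to suit integration over
    rectangles. *)
Definition cexp s t : R[i] := (expR s)%:C * cis t.

Lemma cexpD s t s' t' : cexp (s + s') (t + t') = cexp s t * cexp s' t'.
Proof. by rewrite /cexp expRD cisD rmorphM/= mulrACA. Qed.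

Lemma normc_cexp s t : normc (cexp s t) = expR s.
Proof. by rewrite normcM normc_cis mulr1 normcR ger0_norm// expR_ge0. Qed.

Lemma cexp_neq0 s t : cexp s t != 0.
Proof. by rewrite -normc_gt0 normc_cexp expR_gt0. Qed.

Lemma cexp_2pi s t : cexp s (t + 2 * pi) = cexp s t.
Proof. by rewrite /cexp cisD cis_2pi mulr1. Qed.

Lemma is_derive_littleo (F : R -> R) (x d : R) : is_derive x 1 F d ->
  forall e : R, 0 < e -> exists2 del : R, 0 < del &
    forall h, `|h| < del -> `|F (x + h) - F x - d * h| <= e * `|h|.
Proof.
move=> [dF dE] e e0.
have : (fun h : R => h^-1 *: (F (h *: (1 : R) + x) - F x)) @ 0^' --> d.
  by rewrite -dE; exact: dF.
move=> /cvgrPdist_le /(_ _ e0) /=; rewrite near_withinE => -[del /= del0 H].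
exists del => // h hd; have [->|h0] := eqVneq h 0.
  by rewrite addr0 mulr0 !subrr normr0 mulr0.
have := H h; rewrite /= sub0r normrN => /(_ hd h0).
rewrite -[X in _ -> _ <= X]/(e * `|h|) [h *: _]mulr1 => Hh.
have -> : F (x + h) - F x - d * h = - (d - h^-1 * (F (h + x) - F x)) * h.
  by rewrite (addrC x h); field.
by rewrite normrM normrN ler_wpM2r.
Qed.

Lemma cexp_littleo e : 0 < e -> exists2 del, 0 < del & forall s t,
  `|s| < del -> `|t| < del ->
  normc (cexp s t - 1 - (s +i* t)) <= e * (`|s| + `|t|).
Proof.
move=> e0; have e4 : 0 < e / 8 by rewrite divr_gt0.
have [d1 d10 H1] := is_derive_littleo (is_derive_expR (0:R)) e4.
have [d2 d20 H2] := is_derive_littleo (is_derive_cos (0:R)) e4.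
have [d3 d30 H3] := is_derive_littleo (is_derive_sin (0:R)) e4.
exists (Num.min (Num.min d1 d2) (Num.min d3 (Num.min 1 (e / 8)))) => [|s t].
  by rewrite !lt_min d10 d20 d30 ltr01 e4.
rewrite !lt_min => /andP[/andP[s1 _] /andP[_ /andP[s4 s5]]].
move=> /andP[/andP[_ t2] /andP[t3 /andP[_ t5]]].
have := H1 _ s1; rewrite add0r expR0 mul1r => {H1} H1.
have := H2 _ t2; rewrite add0r cos0 sin0 oppr0 mul0r subr0 => {H2} H2.
have := H3 _ t3; rewrite add0r sin0 cos0 subr0 mul1r => {H3} H3.
(* Separates the error of e^s, the errors of cos and sin, and the cross term i s t; the last is
   small because |s| < e / 8. *)
have -> : cexp s t - 1 - (s +i* t) = (expR s - 1 - s)%:C * cis t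
    + (1 + s)%:C * ((cos t - 1) +i* (sin t - t)) + (0 +i* (s * t)).
  by rewrite /cexp /cis; simpc; congr (_ +i* _); ring.
have B1 : normc ((expR s - 1 - s)%:C * cis t) <= e / 8 * `|s|.
  by rewrite normcM normc_cis mulr1 normcR.
have B2 : normc ((1 + s)%:C * ((cos t - 1) +i* (sin t - t))) <= 2 * (e / 8 * `|t| + e / 8 * `|t|).
  rewrite normcM ler_pM ?normc_ge0//.
    by rewrite normcR (le_trans (ler_normD _ _))// normr1; lra.
  by rewrite (le_trans (normc_le_ReIm _))// lerD.
have B3 : normc (0 +i* (s * t)) <= e / 8 * `|t|.
  by rewrite (le_trans (normc_le_ReIm _))//= normr0 add0r normrM ler_wpM2r// ltW.
rewrite (le_trans (normcD _ _))// (le_trans (lerD (normcD _ _) B3))//.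
have := normr_ge0 s; have := normr_ge0 t.
move: B1 B2; set A := normc _; set B := normc _ => B1 B2 ? ?.
have es : 0 <= e * `|s| by rewrite mulr_ge0// ltW.
have et : 0 <= e * `|t| by rewrite mulr_ge0// ltW.
lra.
Qed.

End Cis.

(** * Goursat's theorem *)

Section ComplexIntegral.
Variable R : realType.
Implicit Types (g h : R -> R[i]) (a b c x y : R).

Definition ccontinuous g :=
  continuous (fun x => Re (g x)) /\ continuous (fun x => Im (g x)).

Definition cint g a b : R[i] :=
  oint (fun x => Re (g x)) a b +i* oint (fun x => Im (g x)) a b.

Lemma cint_chasles g a b c : cint g a b + cint g b c = cint g a c.
Proof. by rewrite /cint; simpc; rewrite !oint_chasles. Qed.

Lemma eq_cint g h a b : g =1 h -> cint g a b = cint h a b.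
Proof. by move=> /funext ->. Qed.

Lemma continuousZl (k : R) (g : R -> R) : continuous g -> continuous (fun x => k * g x).
Proof. by move=> cg x; apply: continuousM; [exact: cst_continuous|exact: cg]. Qed.

Lemma ccontinuousD g h : ccontinuous g -> ccontinuous h ->
  ccontinuous (fun x => g x + h x).
Proof.
move=> [g1 g2] [h1 h2]; split => x.
- have -> : (fun x => Re (g x + h x)) = (fun x => Re (g x) + Re (h x)).
    by apply/funext => y; case: (g y) => ? ?; case: (h y).
  by apply: continuousD; [exact: g1|exact: h1].
- have -> : (fun x => Im (g x + h x)) = (fun x => Im (g x) + Im (h x)).
    by apply/funext => y; case: (g y) => ? ?; case: (h y).
  by apply: continuousD; [exact: g2|exact: h2].
Qed.

Lemma ccontinuous_cst k : ccontinuous (fun=> k).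
Proof. by split; exact: cst_continuous. Qed.

Lemma ccontinuousZ (k : R[i]) g : ccontinuous g -> ccontinuous (fun x => k * g x).
Proof.
move=> [g1 g2]; split => x.
- have -> : (fun x => Re (k * g x)) = (fun x => Re k * Re (g x) - Im k * Im (g x)).
    by apply/funext => y; case: k => ? ?; case: (g y).
  exact: (cvgB (@continuousZl (Re k) _ g1 x) (@continuousZl (Im k) _ g2 x)).
- have -> : (fun x => Im (k * g x)) = (fun x => Re k * Im (g x) + Im k * Re (g x)).
    by apply/funext => y; case: k => ? ?; case: (g y).
  exact: (cvgD (@continuousZl (Re k) _ g2 x) (@continuousZl (Im k) _ g1 x)).
Qed.

Lemma cintD g h a b : ccontinuous g -> ccontinuous h ->
  cint (fun x => g x + h x) a b = cint g a b + cint h a b.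
Proof.
move=> [g1 g2] [h1 h2]; rewrite /cint; simpc; rewrite -!ointD//.
by congr (oint _ _ _ +i* oint _ _ _); apply/funext => y;
  case: (g y) => ? ?; case: (h y).
Qed.

Lemma cintZ k g a b : ccontinuous g ->
  cint (fun x => k * g x) a b = k * cint g a b.
Proof.
move=> [g1 g2]; rewrite /cint; case: k => k1 k2; simpc.
rewrite -!ointZ// -ointN; last exact: continuousZl.
have cN (f : R -> R) : continuous f -> continuous (fun x => - f x).
  by move=> cf x; apply: continuousN; exact: cf.
rewrite -!ointD//; try exact: continuousZl; last first.
  by apply: cN; exact: continuousZl.
by congr (oint _ _ _ +i* oint _ _ _); apply/funext => y; case: (g y).
Qed.

Lemma cintB g h a b : ccontinuous g -> ccontinuous h ->
  cint (fun x => g x - h x) a b = cint g a b - cint h a b.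
Proof.
move=> cg ch; rewrite -mulN1r -cintZ// -cintD//; last exact: ccontinuousZ.
by apply: eq_cint => x; rewrite mulN1r.
Qed.

Lemma cint_cst k a b : cint (fun=> k) a b = k * (b - a)%:C.
Proof. by rewrite /cint !oint_cst; case: k => ? ?; simpc. Qed.

Lemma cint_sum n (F : 'I_n -> R -> R[i]) a b : (forall i, ccontinuous (F i)) ->
  ccontinuous (fun x => \sum_(i < n) F i x) /\
  cint (fun x => \sum_(i < n) F i x) a b = \sum_(i < n) cint (F i) a b.
Proof.
elim: n F => [|n IH] F cF.
  have E : (fun x : R => \sum_(i < 0) F i x) = fun=> 0.
    by apply/funext => x; rewrite big_ord0.
  rewrite E; split; first exact: ccontinuous_cst.
  by rewrite cint_cst mul0r big_ord0.
have E : (fun x : R => \sum_(i < n.+1) F i x) = fun x =>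
    \sum_(i < n) F (widen_ord (leqnSn n) i) x + F ord_max x.
  by apply/funext => x; rewrite big_ord_recr.
have [C1 C2] := IH (fun i => F (widen_ord (leqnSn n) i)) (fun i => cF _).
rewrite E; split; first exact: ccontinuousD.
by rewrite cintD// C2 big_ord_recr.
Qed.

Lemma normc_cint_le g a b M : ccontinuous g -> a <= b ->
  (forall x, a <= x <= b -> normc (g x) <= M) ->
  normc (cint g a b) <= 2 * M * (b - a).
Proof.
move=> [g1 g2] ab gM; rewrite (le_trans (normc_le_ReIm _))//=.
rewrite mulr2n !mulrDl !mul1r.
by apply: lerD; apply: oint_norm_le => // x /gM; apply: le_trans;
  [exact: normRe_le|exact: normIm_le].
Qed.

Lemma oint_affine (p q a b : R) :
  oint (fun x => p * x + q) a b = p * (b ^+ 2 - a ^+ 2) / 2 + q * (b - a).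
Proof.
rewrite (@oint_primitive _ (fun x => p / 2 * (x * x) + q * x)).
  by rewrite !expr2; field.
move=> x; apply: is_derive_eq (is_deriveD (is_deriveZ (p / 2) (is_deriveM
  (is_derive_id x 1) (is_derive_id x 1))) (is_deriveZ q (is_derive_id x 1))) _.
by rewrite /GRing.scale/=; field.
Qed.

End ComplexIntegral.

(** * Integrals of holomorphic functions around rectangles *)

Section Goursat.
Variable R : realType.
Variable h : R -> R -> R[i].
Implicit Types (s t : R).

Definition jointly_continuous := forall s0 t0 e, 0 < e ->
  exists2 del : R, 0 < del & forall s t, `|s - s0| < del -> `|t - t0| < del ->
    normc (h s t - h s0 t0) <= e.

Definition holomorphic_at s0 t0 := exists B : R[i], forall e, 0 < e ->
  exists2 del : R, 0 < del & forall s t, `|s - s0| < del -> `|t - t0| < del ->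
    normc (h s t - h s0 t0 - B * ((s - s0) +i* (t - t0)))
      <= e * (`|s - s0| + `|t - t0|).

(* The integral of h dw, w = s + i t, along the boundary of a rectangle. *)
Definition rect_int (k : R -> R -> R[i]) s1 s2 t1 t2 : R[i] :=
  cint (k^~ t1) s1 s2 - cint (k^~ t2) s1 s2 +
  (0 +i* 1) * (cint (k s2) t1 t2 - cint (k s1) t1 t2).

Lemma rect_int_adds k s1 s2 s3 t1 t2 :
  rect_int k s1 s3 t1 t2 = rect_int k s1 s2 t1 t2 + rect_int k s2 s3 t1 t2.
Proof.
rewrite /rect_int -(cint_chasles (k^~ t1) s1 s2 s3) -(cint_chasles (k^~ t2) s1 s2 s3).
ring.
Qed.

Lemma rect_int_addt k s1 s2 t1 t2 t3 :
  rect_int k s1 s2 t1 t3 = rect_int k s1 s2 t1 t2 + rect_int k s1 s2 t2 t3.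
Proof.
rewrite /rect_int -(cint_chasles (k s1) t1 t2 t3) -(cint_chasles (k s2) t1 t2 t3).
ring.
Qed.

Hypothesis hc : jointly_continuous.

Lemma jointly_continuous_s t : ccontinuous (h^~ t).
Proof.
split=> s; apply/cvgrPdist_le => /= e e0; have [del del0 H] := hc s t e0.
- exists del => //= s' d.
  rewrite -raddfB (le_trans (normRe_le _))// normc_distC.
  by apply: H; rewrite ?subrr ?normr0// distrC.
- exists del => //= s' d.
  rewrite -raddfB (le_trans (normIm_le _))// normc_distC.
  by apply: H; rewrite ?subrr ?normr0// distrC.
Qed.

Lemma jointly_continuous_t s : ccontinuous (h s).
Proof.
split=> t; apply/cvgrPdist_le => /= e e0; have [del del0 H] := hc s t e0.
- exists del => //= t' d.
  rewrite -raddfB (le_trans (normRe_le _))// normc_distC.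
  by apply: H; rewrite ?subrr ?normr0// distrC.
- exists del => //= t' d.
  rewrite -raddfB (le_trans (normIm_le _))// normc_distC.
  by apply: H; rewrite ?subrr ?normr0// distrC.
Qed.

Let affine (A B : R[i]) s t : R[i] := A + B * (s +i* t).

Let affineE (A B : R[i]) s t : affine A B s t =
  (Re B * s + (Re A - Im B * t)) +i* (Im B * s + (Im A + Re B * t)).
Proof. by rewrite /affine; case: A => ? ?; case: B => ? ?; rewrite /=; simpc; congr (_ +i* _); ring. Qed.

Let affineE' (A B : R[i]) s t : affine A B s t =
  (- Im B * t + (Re A + Re B * s)) +i* (Re B * t + (Im A + Im B * s)).
Proof. by rewrite affineE; congr (_ +i* _); ring. Qed.

Let linear_continuous (p q : R) : continuous (fun x => p * x + q).
Proof.
move=> x; apply: continuousD; last exact: cst_continuous.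
by apply: continuousM; [exact: cst_continuous|exact: id].
Qed.

Let affine_cs A B t : ccontinuous (affine A B ^~ t).
Proof.
by split; under eq_fun do rewrite affineE; exact: linear_continuous.
Qed.

Let affine_ct A B s : ccontinuous (affine A B s).
Proof.
by split; under eq_fun do rewrite affineE'; exact: linear_continuous.
Qed.

Let rect_int_affine A B s1 s2 t1 t2 : rect_int (affine A B) s1 s2 t1 t2 = 0.
Proof.
have Es t : cint (affine A B ^~ t) s1 s2 =
    (Re B * (s2 ^+ 2 - s1 ^+ 2) / 2 + (Re A - Im B * t) * (s2 - s1)) +i*
    (Im B * (s2 ^+ 2 - s1 ^+ 2) / 2 + (Im A + Re B * t) * (s2 - s1)).
  rewrite -!oint_affine; congr (_ +i* _); congr oint; apply/funext => s;
  by rewrite affineE.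
have Et s : cint (affine A B s) t1 t2 =
    (- Im B * (t2 ^+ 2 - t1 ^+ 2) / 2 + (Re A + Re B * s) * (t2 - t1)) +i*
    (Re B * (t2 ^+ 2 - t1 ^+ 2) / 2 + (Im A + Im B * s) * (t2 - t1)).
  rewrite -!oint_affine; congr (_ +i* _); congr oint; apply/funext => t;
  by rewrite affineE'.
by rewrite /rect_int !Es !Et; simpc; rewrite -[0]/(0 +i* 0); congr (_ +i* _); field.
Qed.

(** An affine function of w integrates to 0 around a rectangle, so it may be subtracted from [h]
    first. The 4 is 2 for a pair of opposite sides times the 2 of [normc_cint_le]. *)
Lemma normc_rect_int_le A B s1 s2 t1 t2 M : s1 <= s2 -> t1 <= t2 ->
  (forall s t, s1 <= s <= s2 -> t1 <= t <= t2 ->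
    normc (h s t - (A + B * (s +i* t))) <= M) ->
  normc (rect_int h s1 s2 t1 t2) <= 4 * M * ((s2 - s1) + (t2 - t1)).
Proof.
move=> s12 t12 H; have ch := jointly_continuous_s; have ch' := jointly_continuous_t.
have cs t : ccontinuous (fun s => h s t - affine A B s t).
  by under eq_fun do rewrite -mulN1r; apply: ccontinuousD => //; apply: ccontinuousZ.
have ct s : ccontinuous (fun t => h s t - affine A B s t).
  by under eq_fun do rewrite -mulN1r; apply: ccontinuousD => //; apply: ccontinuousZ.
have -> : rect_int h s1 s2 t1 t2 =
    rect_int (fun s t => h s t - affine A B s t) s1 s2 t1 t2.
  have -> : rect_int h s1 s2 t1 t2 =
     rect_int h s1 s2 t1 t2 - rect_int (affine A B) s1 s2 t1 t2.
    by rewrite rect_int_affine subr0.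
  rewrite /rect_int !cintB//; ring.
have Bs t : t1 <= t <= t2 ->
    normc (cint (fun s => h s t - affine A B s t) s1 s2) <= 2 * M * (s2 - s1).
  by move=> tt; apply: normc_cint_le => // x xx; exact: H.
have Bt s : s1 <= s <= s2 ->
    normc (cint (fun t => h s t - affine A B s t) t1 t2) <= 2 * M * (t2 - t1).
  by move=> ss; apply: normc_cint_le => // x xx; exact: H.
have nI : normc (0 +i* 1 : R[i]) = 1 by rewrite /= expr0n expr1n add0r sqrtr1.
rewrite (le_trans (normcD _ _))// normcM nI mul1r.
rewrite (le_trans (lerD (normcB _ _) (normcB _ _)))//.
have := Bs t1; have := Bs t2; have := Bt s1; have := Bt s2.
rewrite !lexx s12 t12 => /(_ isT) b1 /(_ isT) b2 /(_ isT) b3 /(_ isT) b4.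
rewrite (le_trans (lerD (lerD b4 b3) (lerD b1 b2)))//; lra.
Qed.

Let nested (d : R) (u : nat -> R) : 0 <= d ->
  (forall n, u n <= u n.+1 <= u n + d / 2 ^+ n.+1) ->
  exists x, forall n, u n <= x <= u n + d / 2 ^+ n.
Proof.
move=> d0 H.
have half n : d / 2 ^+ n.+1 + d / 2 ^+ n.+1 = d / 2 ^+ n.
  by rewrite exprS; field; rewrite expf_neq0.
have up n m : u n <= u (n + m)%N.
  elim: m => [|m IH]; first by rewrite addn0.
  by rewrite addnS (le_trans IH)//; case/andP: (H (n + m)%N).
have dn n m : u (n + m)%N + d / 2 ^+ (n + m)%N <= u n + d / 2 ^+ n.
  elim: m => [|m IH]; first by rewrite addn0.
  rewrite addnS (le_trans _ IH)// -[in leRHS]half addrA lerD2r.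
  by case/andP: (H (n + m)%N).
have d2 n : 0 <= d / 2 ^+ n by rewrite divr_ge0// exprn_ge0.
have ub m n : u m <= u n + d / 2 ^+ n.
  have [mn|nm] := leqP m n.
    by rewrite -(subnKC mn) (le_trans (up m (n - m)%N))// lerDl.
  by rewrite -(subnKC (ltnW nm)) (le_trans _ (dn n (m - n)%N))// lerDl.
exists (sup (range u)) => n; apply/andP; split.
  apply: ub_le_sup; last by exists n.
  by exists (u 0%N + d / 2 ^+ 0) => _ [m _ <-].
by apply: ge_sup; [exists (u 0%N), 0%N|move=> _ [m _ <-]].
Qed.

Lemma goursat s1 s2 t1 t2 : s1 <= s2 -> t1 <= t2 ->
  (forall s t, s1 <= s <= s2 -> t1 <= t <= t2 -> holomorphic_at s t) ->
  rect_int h s1 s2 t1 t2 = 0.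
Proof.
move=> s12 t12 hol; apply/eqP; rewrite -normc_eq0 eq_le normc_ge0 andbT.
rewrite leNgt; apply/negP => c0; set c := normc _ in c0.
pose l := s2 - s1; pose m := t2 - t1.
have l0 : 0 <= l by rewrite subr_ge0.
have m0 : 0 <= m by rewrite subr_ge0.
pose I n (p : R * R) := rect_int h p.1 (p.1 + l / 2 ^+ n) p.2 (p.2 + m / 2 ^+ n).
pose bad n p := c / 4 ^+ n <= normc (I n p).
pose quarters n (p : R * R) : seq (R * R) := [:: p; (p.1 + l / 2 ^+ n.+1, p.2);
   (p.1, p.2 + m / 2 ^+ n.+1); (p.1 + l / 2 ^+ n.+1, p.2 + m / 2 ^+ n.+1)].
(* The default [p] is never reached from a bad rectangle: by [hasbad] one of its quarters is bad. A
   rectangle is given by its lower left corner, its level fixing the side lengths. *)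
pose step n p := head p [seq q <- quarters n p | bad n.+1 q].
pose u := fix u n := if n is n'.+1 then step n' (u n') else (s1, t1).
have half d n : d / 2 ^+ n = d / 2 ^+ n.+1 + d / 2 ^+ n.+1 :> R.
  by rewrite exprS; field; rewrite expf_neq0.
have Isum n p : I n p = \sum_(q <- quarters n p) I n.+1 q.
  rewrite /I /quarters !big_cons big_nil /= (half l n) (half m n) (addrA p.1) (addrA p.2).
  rewrite (rect_int_adds _ _ (p.1 + l / 2 ^+ n.+1)).
  rewrite (rect_int_addt _ p.1 _ _ (p.2 + m / 2 ^+ n.+1)).
  rewrite (rect_int_addt _ (p.1 + l / 2 ^+ n.+1) _ _ (p.2 + m / 2 ^+ n.+1)).
  move: (rect_int h p.1 _ p.2 _) (rect_int h p.1 _ (p.2 + _) _).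
  move: (rect_int h (p.1 + _) _ p.2 _) (rect_int h (p.1 + _) _ (p.2 + _) _).
  by move=> *; ring.
have hasbad n p : bad n p -> has (bad n.+1) (quarters n p).
  rewrite /bad Isum => bp; apply/negPn/negP; rewrite -all_predC => /allP al.
  move: bp; apply/negP; rewrite -ltNge (le_lt_trans (normc_sum _ _ _))//.
  have lt q : q \in quarters n p -> normc (I n.+1 q) < c / 4 ^+ n.+1.
    by move=> /al /=; rewrite -ltNge.
  have -> : c / 4 ^+ n = c / 4 ^+ n.+1 + c / 4 ^+ n.+1 + c / 4 ^+ n.+1 + c / 4 ^+ n.+1.
    by rewrite exprS; field; rewrite expf_neq0.
  have lt' i : (i < 4)%N -> normc (I n.+1 (nth p (quarters n p) i)) < c / 4 ^+ n.+1.
    by move=> i4; apply/lt/mem_nth.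
  have := lt' 0%N isT; have := lt' 1%N isT; have := lt' 2%N isT; have := lt' 3%N isT.
  rewrite /quarters !big_cons big_nil addr0 /=; lra.
have stepP n p : bad n p -> bad n.+1 (step n p) /\ step n p \in quarters n p.
  move=> /hasbad; rewrite has_filter /step.
  case E : (seq.filter _ _) => [//|q r] _ /=.
  have : q \in [seq q <- quarters n p | bad n.+1 q] by rewrite E mem_head.
  by rewrite mem_filter => /andP[].
have badu n : bad n (u n).
  elim: n => [|n IH]; last by case: (stepP _ _ IH).
  by rewrite /bad /I /= !expr0 !divr1 !subrKC.
have d2 d n : 0 <= d -> 0 <= d / 2 ^+ n :> R by move=> ?; rewrite divr_ge0// exprn_ge0.
have mon n : (u n).1 <= (u n.+1).1 <= (u n).1 + l / 2 ^+ n.+1 /\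
             (u n).2 <= (u n.+1).2 <= (u n).2 + m / 2 ^+ n.+1.
  have [_] := stepP _ _ (badu n); rewrite -[step n (u n)]/(u n.+1).
  rewrite !inE => /or4P[] /eqP ->; rewrite /= !lexx ?lerDl !d2//.
have [x xP] := nested l0 (fun n => (mon n).1).
have [y yP] := nested m0 (fun n => (mon n).2).
have [||B HB] := hol x y.
- by have := xP 0%N; rewrite /= expr0 divr1 subrKC.
- by have := yP 0%N; rewrite /= expr0 divr1 subrKC.
(* The 1 keeps [L] positive for a degenerate rectangle and makes the final inequality strict. *)
pose L := l + m + 1.
have L0 : 0 < L by rewrite ltr_wpDl// addr_ge0.
(* With this accuracy the integral at level n is at most c / 4^n times (l + m) / (2 L), and this
   factor is below 1, against badness. *)
have [|del del0 H] := HB (c / (8 * L ^+ 2)).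
  by rewrite divr_gt0// mulr_gt0// exprn_gt0.
pose n := (Num.bound (L / del)).
have Ln : L / 2 ^+ n < del.
  rewrite ltr_pdivrMr ?exprn_gt0// mulrC -ltr_pdivrMr//.
  have := archi_boundP (ltW (divr_gt0 L0 del0)) => /lt_le_trans; apply.
  by rewrite -natrX ler_nat ltnW// ltn_expl.
have := badu n; apply/negP; rewrite -ltNge /I.
have Ll : l / 2 ^+ n <= L / 2 ^+ n by rewrite ler_wpM2r ?invr_ge0 ?exprn_ge0// /L; lra.
have Lm : m / 2 ^+ n <= L / 2 ^+ n by rewrite ler_wpM2r ?invr_ge0 ?exprn_ge0// /L; lra.
apply: le_lt_trans (_ : 4 * (c / (8 * L ^+ 2) * (L / 2 ^+ n)) *
   (l / 2 ^+ n + m / 2 ^+ n) < _).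
  have -> : l / 2 ^+ n + m / 2 ^+ n = ((u n).1 + l / 2 ^+ n - (u n).1) +
    ((u n).2 + m / 2 ^+ n - (u n).2) by ring.
  apply: (@normc_rect_int_le (h x y - B * (x +i* y)) B); rewrite ?lerDl ?d2//.
  move=> s t ss tt; have xn := xP n; have yn := yP n.
  have sx : `|s - x| <= l / 2 ^+ n by rewrite ler_norml; lra.
  have ty : `|t - y| <= m / 2 ^+ n by rewrite ler_norml; lra.
  have -> : h s t - (h x y - B * (x +i* y) + B * (s +i* t)) =
     h s t - h x y - B * ((s - x) +i* (t - y)).
    have -> : (s - x) +i* (t - y) = (s +i* t) - (x +i* y) by simpc.
    ring.
  rewrite (le_trans (H _ _ _ _))//.
  - exact: le_lt_trans (le_trans sx Ll) Ln.
  - exact: le_lt_trans (le_trans ty Lm) Ln.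
  - apply: ler_wpM2l; first by rewrite ltW// divr_gt0// mulr_gt0// exprn_gt0.
    rewrite (le_trans (lerD sx ty))// -mulrDl ler_wpM2r// ?invr_ge0 ?exprn_ge0//.
    by rewrite /L lerDl.
have -> : 4 ^+ n = (2 ^+ n) ^+ 2 :> R by rewrite -exprM mulnC exprM expr2 -natrM.
have -> : 4 * (c / (8 * L ^+ 2) * (L / 2 ^+ n)) * (l / 2 ^+ n + m / 2 ^+ n) =
   c / (2 ^+ n) ^+ 2 * ((l + m) / (2 * L)).
  by field; rewrite expf_neq0//= gt_eqF.
rewrite gtr_pMr ?divr_gt0 ?exprn_gt0// ltr_pdivrMr ?mulr_gt0// /L; lra.
Qed.

(** Meant for difference quotients, which are only known to be continuous at their centre. Goursat
    removes everything except a small square around that point, and boundedness makes its integral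
    tend to 0. *)
Lemma goursat_except s0 t0 s1 s2 t1 t2 : s1 < s0 < s2 -> t1 < t0 < t2 ->
  (forall s t, s1 <= s <= s2 -> t1 <= t <= t2 -> (s, t) != (s0, t0) ->
    holomorphic_at s t) ->
  rect_int h s1 s2 t1 t2 = 0.
Proof.
move=> s012 t012 hol; apply/eqP; rewrite -normc_eq0 eq_le normc_ge0 andbT.
have [del del0 H] := hc s0 t0 ltr01.
pose M := normc (h s0 t0) + 1.
have M0 : 0 < M by rewrite ltr_wpDl// normc_ge0.
apply/ler_addgt0Pl => e e0; rewrite addr0.
(* The square of half side [d] contributes at most 4 M (2 d + 2 d) = 16 M d. *)
pose d := Num.min (Num.min (s0 - s1) (s2 - s0)) (Num.min (Num.min (t0 - t1) (t2 - t0))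
  (Num.min (del / 2) (e / (16 * M)))).
have d0 : 0 < d.
  rewrite !lt_min !subr_gt0 !divr_gt0 ?mulr_gt0//.
  by case/andP: s012 => -> ->; case/andP: t012 => -> ->.
have : d <= d by [].
rewrite {2}/d !le_min => /andP[/andP[d1 d2] /andP[/andP[d3 d4] /andP[d5 d6]]].
rewrite (rect_int_adds _ s1 (s0 - d)) (rect_int_adds _ (s0 - d) (s0 + d)).
rewrite (@goursat s1 (s0 - d)) ?(@goursat (s0 + d) s2); try lra; first last.
- move=> s t ss tt; apply: hol => //; first by lra.
  by apply/eqP => -[]; lra.
- move=> s t ss tt; apply: hol => //; first by lra.
  by apply/eqP => -[]; lra.
rewrite add0r addr0.
rewrite (rect_int_addt _ _ _ t1 (t0 - d)) (rect_int_addt _ _ _ (t0 - d) (t0 + d)).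
rewrite (@goursat _ _ t1 (t0 - d)) ?(@goursat _ _ (t0 + d) t2); try lra; first last.
- move=> s t ss tt; apply: hol => //; [lra|lra|].
  by apply/eqP => -[]; lra.
- move=> s t ss tt; apply: hol => //; [lra|lra|].
  by apply/eqP => -[]; lra.
rewrite add0r addr0.
have -> : e = 16 * M * (e / (16 * M)) by field; rewrite gt_eqF.
apply: (@le_trans _ _ (4 * M * ((s0 + d - (s0 - d)) + (t0 + d - (t0 - d))))).
  apply: (@normc_rect_int_le 0 0); [lra|lra|].
  move=> s t ss tt; rewrite mul0r addr0 subr0.
  rewrite -[h s t](subrK (h s0 t0)) (le_trans (normcD _ _))// addrC lerD2l.
  by apply: H; rewrite ltr_norml; lra.
have -> : 4 * M * ((s0 + d - (s0 - d)) + (t0 + d - (t0 - d))) = 16 * M * d by ring.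
by rewrite ler_wpM2l// mulr_ge0// ltW.
Qed.

End Goursat.

(** * Circle integrals and Taylor expansion *)

Section ComplexDifferentiability.
Variable R : realType.
Implicit Types (k f : R[i] -> R[i]) (z w a : R[i]).

Definition ccts_at k z := forall e : R, 0 < e -> exists2 del : R, 0 < del &
  forall w, normc w < del -> normc (k (z + w) - k z) <= e.

Definition cdiff_at k z := exists B : R[i], forall e : R, 0 < e ->
  exists2 del : R, 0 < del &
  forall w, normc w < del -> normc (k (z + w) - k z - B * w) <= e * normc w.

Lemma ltcR_normc (x : R) z : (`|z| < x%:C) = (normc z < x).
Proof. by rewrite normr_normc ltcR. Qed.

Lemma lecR_normc (x : R) z : (`|z| <= x%:C) = (normc z <= x).
Proof. by rewrite normr_normc lecR. Qed.

Lemma gt0_complexR z : 0 < z -> exists2 x : R, 0 < x & z = x%:C.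
Proof.
case: z => x y; rewrite ltcE/= => /andP[/eqP -> x0]; by exists x.
Qed.

Lemma derivable_cdiff k z : derivable (k : R[i]^o -> R[i]^o) z 1 -> cdiff_at k z.
Proof.
move=> /cvg_ex[/= B] /cvgrPdist_le /= H; exists B => e e0.
have eC : 0 < e%:C by rewrite ltcR.
move: (H _ eC); rewrite near_withinE => -[/= d /gt0_complexR[del del0 ->] Hd].
exists del => // w wd; have [->|w0] := eqVneq w 0.
  by rewrite addr0 mulr0 !subrr normc0 mulr0.
have := Hd w; rewrite /= sub0r normrN ltcR_normc => /(_ wd w0).
rewrite lecR_normc [w *: _]mulr1 => Hw.
have -> : k (z + w) - k z - B * w = - (B - w^-1 *: (k (w + z) - k z)) * w.
  by rewrite /GRing.scale/= (addrC w z); field.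
by rewrite normcM normcN ler_wpM2r// normc_ge0.
Qed.

Lemma cdiff_ccts k z : cdiff_at k z -> ccts_at k z.
Proof.
move=> [B HB] e e0; have [del del0 H] := HB 1 ltr01.
have B0 := normc_ge0 B.
exists (Num.min del (e / (1 + normc B))) => [|w].
  by rewrite lt_min del0 divr_gt0// ltr_pwDl.
rewrite lt_min => /andP[/H wd we].
have -> : k (z + w) - k z = (k (z + w) - k z - B * w) + B * w by ring.
rewrite (le_trans (normcD _ _))// (le_trans (lerD wd (lexx _)))// normcM -mulrDl.
by rewrite mulrC -ler_pdivlMr ?ltr_pwDl// ltW.
Qed.

Lemma eq_cdiff_at k k' z (d : R) : 0 < d ->
  (forall w, normc w < d -> k (z + w) = k' (z + w)) -> cdiff_at k z -> cdiff_at k' z.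
Proof.
move=> d0 E [B HB]; exists B => e /HB[del del0 H].
exists (Num.min del d) => [|w]; first by rewrite lt_min del0.
rewrite lt_min => /andP[w1 w2]; rewrite -(E _ w2) -[z in k' z]addr0.
by rewrite -(E 0) ?normc0// addr0 H.
Qed.

Lemma cdiff_cst a z : cdiff_at (fun=> a) z.
Proof.
exists 0 => e e0; exists 1 => // w _.
by rewrite subrr mul0r subr0 normc0 mulr_ge0 ?normc_ge0// ltW.
Qed.

Lemma cdiff_id z : cdiff_at id z.
Proof.
exists 1 => e e0; exists 1 => // w _.
by rewrite mul1r (addrC z) addrK subrr normc0 mulr_ge0 ?normc_ge0// ltW.
Qed.

Lemma cdiffB k k' z : cdiff_at k z -> cdiff_at k' z ->
  cdiff_at (fun z => k z - k' z) z.
Proof.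
move=> [B HB] [B' HB']; exists (B - B') => e e0.
have e2 : 0 < e / 2 by rewrite divr_gt0.
have [d d0 H] := HB _ e2; have [d' d'0 H'] := HB' _ e2.
exists (Num.min d d') => [|w]; first by rewrite lt_min d0.
rewrite lt_min => /andP[/H w1 /H' w2].
have -> : k (z + w) - k' (z + w) - (k z - k' z) - (B - B') * w =
  (k (z + w) - k z - B * w) - (k' (z + w) - k' z - B' * w) by ring.
by rewrite (le_trans (normcB _ _))// (le_trans (lerD w1 w2))// -mulrDl -splitr.
Qed.

Lemma cdiffM k k' z : cdiff_at k z -> cdiff_at k' z ->
  cdiff_at (fun z => k z * k' z) z.
Proof.
move=> [B HB] dk'; have [B' HB'] := dk'.
exists (B * k' z + k z * B') => e e0.
have K0 (x : R[i]) : 0 < 1 + normc x by rewrite ltr_pwDl// normc_ge0.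
have e3 (x : R[i]) : 0 < e / (3 * (1 + normc x)) by rewrite divr_gt0// mulr_gt0.
have [d2 d20 H2] := HB' _ (e3 (k z)).
have [d3 d30 H3] := cdiff_ccts dk' (e3 B).
have [d5 d50 H5] := cdiff_ccts dk' ltr01.
have e3' : 0 < e / (3 * (2 + normc (k' z))).
  by rewrite divr_gt0// mulr_gt0// ltr_pwDl// normc_ge0.
have [d6 d60 H6] := HB _ e3'.
exists (Num.min (Num.min d6 d2) (Num.min d3 d5)) => [|w].
  by rewrite !lt_min d60 d20 d30.
rewrite !lt_min => /andP[/andP[/H6 w1 /H2 w2] /andP[/H3 w3 /H5 w5]].
have -> : k (z + w) * k' (z + w) - k z * k' z - (B * k' z + k z * B') * w =
  (k (z + w) - k z - B * w) * (k' (z + w) - k' z + k' z) +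
  B * (k' (z + w) - k' z) * w + k z * (k' (z + w) - k' z - B' * w) by ring.
have W0 := normc_ge0 w.
have a1 : normc ((k (z + w) - k z - B * w) * (k' (z + w) - k' z + k' z)) <= e / 3 * normc w.
  rewrite normcM; apply: (@le_trans _ _ (e / (3 * (2 + normc (k' z))) * normc w * (2 + normc (k' z)))).
    apply: ler_pM; rewrite ?normc_ge0//.
    by rewrite (le_trans (normcD _ _))// lerD2r (le_trans w5)// ler1n.
  rewrite le_eqVlt; apply/orP; left; apply/eqP; field.
  by rewrite gt_eqF// ltr_pwDl// normc_ge0.
have a2 : normc (B * (k' (z + w) - k' z) * w) <= e / 3 * normc w.
  rewrite !normcM; apply: ler_wpM2r => //.
  apply: (@le_trans _ _ ((1 + normc B) * (e / (3 * (1 + normc B))))).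
    by apply: ler_pM; rewrite ?normc_ge0// lerDr.
  by rewrite le_eqVlt; apply/orP; left; apply/eqP; field; rewrite gt_eqF.
have a3 : normc (k z * (k' (z + w) - k' z - B' * w)) <= e / 3 * normc w.
  rewrite !normcM.
  apply: (@le_trans _ _ ((1 + normc (k z)) * (e / (3 * (1 + normc (k z))) * normc w))).
    by apply: ler_pM; rewrite ?normc_ge0// lerDr.
  by rewrite le_eqVlt; apply/orP; left; apply/eqP; field; rewrite gt_eqF.
rewrite (le_trans (normcD _ _))// (le_trans (lerD (normcD _ _) a3))//.
rewrite (le_trans (lerD (lerD a1 a2) (lexx _)))//.
by rewrite le_eqVlt; apply/orP; left; apply/eqP; field.
Qed.

Lemma cdiff_inv_sub a z : z != a -> cdiff_at (fun z => (z - a)^-1) z.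
Proof.
rewrite -subr_eq0 => za; have d0 : 0 < normc (z - a) by rewrite normc_gt0.
exists (- (z - a) ^- 2) => e e0.
set d := normc _ in d0.
(* The error is w^2 / ((z - a)^2 (z + w - a)), and |w| < d / 2 keeps the last factor at least d / 2
   in modulus. *)
exists (Num.min (d / 2) (e * d ^+ 3 / 2)) => [|w].
  by rewrite lt_min !divr_gt0// mulr_gt0// exprn_gt0.
rewrite lt_min => /andP[w1 w2].
have dw : d / 2 <= normc (z + w - a).
  have := normc_ge_sub (z - a) (- w); rewrite normcN -/d.
  have -> : z - a - - w = z + w - a by ring.
  lra.
have dw0 : 0 < normc (z + w - a) by rewrite (lt_le_trans _ dw)// divr_gt0.
have n0 : z + w - a != 0 by rewrite -normc_gt0.
have -> : (z + w - a)^-1 - (z - a)^-1 - - (z - a) ^- 2 * w =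
   w ^+ 2 / ((z - a) ^+ 2 * (z + w - a)).
  by field; rewrite za n0.
rewrite normcM normcV normcM !normcX -/d ler_pdivrMr ?mulr_gt0 ?exprn_gt0//.
have wn := normc_ge0 w.
apply: (@le_trans _ _ (normc w * (e * d ^+ 3 / 2))).
  by rewrite expr2 ler_wpM2l// ltW.
rewrite (mulrC e (normc w)) -[leRHS]mulrA ler_wpM2l//.
have -> : e * d ^+ 3 / 2 = e * (d ^+ 2 * (d / 2)) by ring.
by rewrite !ler_wpM2l ?exprn_ge0// ltW.
Qed.

Lemma cdiff_inv_pow n z : z != 0 -> cdiff_at (fun z => (z ^+ n)^-1) z.
Proof.
move=> z0; elim: n => [|n IH].
  by under eq_fun do rewrite expr0 invr1; exact: cdiff_cst.
have -> : (fun z : R[i] => (z ^+ n.+1)^-1) = fun z => (z - 0)^-1 * (z ^+ n)^-1.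
  by apply/funext => x; rewrite subr0 exprS invfM.
by apply: cdiffM => //; exact: cdiff_inv_sub.
Qed.

Lemma cdiff_mulid k z : cdiff_at k z -> cdiff_at (fun z => k z * z) z.
Proof. by move=> kd; apply: cdiffM => //; exact: cdiff_id. Qed.

Lemma ccts_mulid k z : ccts_at k z -> ccts_at (fun z => k z * z) z.
Proof.
move=> kc e e0.
have z0 := normc_ge0 z; have kz0 := normc_ge0 (k z).
have e2 : 0 < e / (2 * (1 + normc z)) by rewrite divr_gt0// mulr_gt0// ltr_pwDl.
have [d1 d10 H1] := kc _ e2.
have [d2 d20 H2] := kc 1 ltr01.
pose d3 := e / (2 * (1 + normc (k z))).
have d30 : 0 < d3 by rewrite divr_gt0// mulr_gt0// ltr_pwDl.
exists (Num.min (Num.min d1 d2) d3) => [|w]; first by rewrite !lt_min d10 d20.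
rewrite !lt_min => /andP[/andP[/H1 w1 /H2 w2] w3].
have -> : k (z + w) * (z + w) - k z * z =
  (k (z + w) - k z) * z + (k (z + w) - k z + k z) * w by ring.
rewrite (le_trans (normcD _ _))// !normcM.
have a1 : normc (k (z + w) - k z) * normc z <= e / 2.
  apply: (@le_trans _ _ (e / (2 * (1 + normc z)) * (1 + normc z))).
    by apply: ler_pM; rewrite ?normc_ge0// lerDr.
  rewrite le_eqVlt; apply/orP; left; apply/eqP; field; rewrite gt_eqF// ltr_pwDl//.
have a2 : normc (k (z + w) - k z + k z) * normc w <= e / 2.
  apply: (@le_trans _ _ ((1 + normc (k z)) * d3)).
    apply: ler_pM; rewrite ?normc_ge0//; last exact: ltW.
    by rewrite (le_trans (normcD _ _))// lerD2r.
  rewrite le_eqVlt; apply/orP; left; apply/eqP; rewrite /d3; field; rewrite gt_eqF// ltr_pwDl//.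
by apply: (le_trans (lerD a1 a2)); rewrite -splitr.
Qed.

Lemma cexp_sub s t (s0 t0 : R) : cexp s t - cexp s0 t0 =
  cexp s0 t0 * (cexp (s - s0) (t - t0) - 1).
Proof. by rewrite mulrBr mulr1 -cexpD !subrKC. Qed.

Lemma cexp_near (s0 t0 del : R) : 0 < del -> exists2 d : R, 0 < d & forall s t,
  `|s - s0| < d -> `|t - t0| < d ->
  normc (cexp s t - cexp s0 t0) < del /\
  normc (cexp s t - cexp s0 t0) <= 2 * normc (cexp s0 t0) * (`|s - s0| + `|t - t0|).
Proof.
move=> del0; have [d d0 H] := cexp_littleo (ltr01 : 0 < 1 :> R).
set z0 := cexp s0 t0.
have z00 : 0 < normc z0 by rewrite normc_gt0 cexp_neq0.
exists (Num.min d (del / (4 * normc z0))) => [|s t].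
  by rewrite lt_min d0 divr_gt0// mulr_gt0.
rewrite !lt_min => /andP[s1 s2] /andP[t1 t2].
have B : normc (cexp s t - z0) <= 2 * normc z0 * (`|s - s0| + `|t - t0|).
  have -> : 2 * normc z0 * (`|s - s0| + `|t - t0|) =
    normc z0 * ((`|s - s0| + `|t - t0|) * 2) by ring.
  rewrite cexp_sub -/z0 normcM ler_wpM2l ?normc_ge0//.
  have := H _ _ s1 t1; set E := cexp _ _ - 1 => HE.
  rewrite -[E](subrK ((s - s0) +i* (t - t0))) (le_trans (normcD _ _))//.
  rewrite mulr_natr mulr2n; apply: lerD; first by rewrite -[leRHS]mul1r.
  exact: normc_le_ReIm.
split=> //; apply: (le_lt_trans B).
rewrite mulrC -ltr_pdivlMr ?mulr_gt0//.
have -> : del / (2 * normc z0) = del / (4 * normc z0) + del / (4 * normc z0).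
  by field; rewrite gt_eqF.
exact: ltrD.
Qed.

Lemma ccts_jointly k : (forall z, z != 0 -> ccts_at k z) ->
  jointly_continuous (fun s t : R => k (cexp s t)).
Proof.
move=> kc s0 t0 e e0; have [del del0 H] := kc _ (cexp_neq0 s0 t0) e e0.
have [d d0 Hd] := cexp_near s0 t0 del0.
exists d => // s t /Hd{}Hd /Hd[wd _].
by have := H _ wd; rewrite subrKC.
Qed.

(** Chain rule: since d(exp w) = exp(w) dw, the derivative of k(exp w) is B z0. *)
Lemma cdiff_holomorphic k (s0 t0 : R) : cdiff_at k (cexp s0 t0) ->
  holomorphic_at (fun s t => k (cexp s t)) s0 t0.
Proof.
set z0 := cexp s0 t0; move=> [B HB]; exists (B * z0) => e e0.
have z00 : 0 < normc z0 by rewrite normc_gt0 cexp_neq0.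
have B0 := normc_ge0 B.
have BZ0 : 0 < 1 + normc B * normc z0 by rewrite ltr_pwDl// mulr_ge0// ltW.
have [|del del0 H] := HB (e / (4 * normc z0)).
  by rewrite divr_gt0// mulr_gt0.
have [d d0 Hd] := cexp_near s0 t0 del0.
have [|d' d'0 Hd'] := @cexp_littleo R (e / (2 * (1 + normc B * normc z0))).
  by rewrite divr_gt0// mulr_gt0.
exists (Num.min d d') => [|s t]; first by rewrite lt_min d0.
rewrite !lt_min => /andP[s1 s2] /andP[t1 t2].
have [wd wz] := Hd _ _ s1 t1.
have := H _ wd; rewrite subrKC => H1.
have := Hd' _ _ s2 t2.
set r := `|s - s0| + `|t - t0| in wz *; set om := _ +i* _ => H2.
have r0 : 0 <= r by rewrite addr_ge0.
have -> : k (cexp s t) - k z0 - B * z0 * om =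
  (k (cexp s t) - k z0 - B * (cexp s t - z0)) + B * z0 * (cexp (s - s0) (t - t0) - 1 - om).
  by rewrite cexp_sub -/z0; ring.
rewrite (le_trans (normcD _ _))//.
have a1 : normc (k (cexp s t) - k z0 - B * (cexp s t - z0)) <= e / 2 * r.
  apply: (le_trans H1); apply: (@le_trans _ _ (e / (4 * normc z0) * (2 * normc z0 * r))).
    by rewrite ler_wpM2l// divr_ge0// ?mulr_ge0// ltW.
  by rewrite le_eqVlt; apply/orP; left; apply/eqP; field; rewrite gt_eqF.
have a2 : normc (B * z0 * (cexp (s - s0) (t - t0) - 1 - om)) <= e / 2 * r.
  rewrite 2!normcM.
  apply: (@le_trans _ _ ((1 + normc B * normc z0) * (e / (2 * (1 + normc B * normc z0)) * r))).
    by apply: ler_pM; rewrite ?normc_ge0 ?mulr_ge0 ?normc_ge0// lerDr.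
  by rewrite le_eqVlt; apply/orP; left; apply/eqP; field; rewrite gt_eqF.
by apply: (le_trans (lerD a1 a2)); rewrite -mulrDl -splitr.
Qed.

End ComplexDifferentiability.

(** * Independence of the radius for circle integrals *)

Section CircleIntegral.
Variable R : realType.
Implicit Types (k f : R[i] -> R[i]) (z w a : R[i]) (r : R).

(** The contour integral of k(z) dz over |z| = r divided by i, because dz = i z dt. *)
Definition circ k r : R[i] :=
  cint (fun t => k (r%:C * cis t) * (r%:C * cis t)) 0 (2 * pi).

Lemma rcis_neq0 r t : 0 < r -> r%:C * cis t != 0.
Proof.
by move=> r0; rewrite mulf_neq0 ?cis_neq0// eq_complex/= eqxx andbT gt_eqF.
Qed.

Lemma normc_rcis r t : 0 <= r -> normc (r%:C * cis t) = r.
Proof. by move=> r0; rewrite normcM normc_cis mulr1 normcR ger0_norm. Qed.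

Lemma circ_ccontinuous k r : (forall z, z != 0 -> ccts_at k z) -> 0 < r ->
  ccontinuous (fun t => k (r%:C * cis t) * (r%:C * cis t)).
Proof.
move=> kc r0.
have kc' z : z != 0 -> ccts_at (fun z => k z * z) z by move=> /kc; exact: ccts_mulid.
have := @jointly_continuous_t _ _ (ccts_jointly kc') (ln r).
by rewrite /cexp lnK.
Qed.

Lemma cint_periodic (g : R -> R[i]) c p : ccontinuous g -> (forall t, g (t + p) = g t) ->
  cint g c (c + p) = cint g 0 p.
Proof.
move=> [g1 g2] gp; rewrite /cint !oint_periodic// => x; by rewrite gp.
Qed.

(** In the logarithmic coordinate the annulus is a rectangle of height 2 pi. Its horizontal sides
    cancel by periodicity, and its vertical sides are the two circle integrals. *)
Lemma circ_step k a (s1 s2 : R) : s1 < s2 ->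
  (forall z, z != 0 -> ccts_at k z) ->
  (forall z, z != 0 -> z != a -> cdiff_at k z) ->
  a = 0 \/ expR s1 < normc a < expR s2 ->
  circ k (expR s1) = circ k (expR s2).
Proof.
move=> s12 kc kd ha.
pose h := fun s t : R => k (cexp s t) * cexp s t.
have hc : jointly_continuous h.
  apply: (@ccts_jointly _ (fun z => k z * z)) => z /kc; exact: ccts_mulid.
have hper s c : cint (h s) c (c + 2 * pi) = circ k (expR s).
  rewrite cint_periodic//; first exact: jointly_continuous_t.
  by move=> t; rewrite /h cexp_2pi.
have pi0 := pi_gt0 R.
have main c : rect_int h s1 s2 c (c + 2 * pi) = 0 ->
    circ k (expR s1) = circ k (expR s2).
  rewrite /rect_int.
  have -> : h^~ (c + 2 * pi) = h^~ c by apply/funext => s; rewrite /h cexp_2pi.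
  rewrite subrr add0r => /eqP; rewrite mulf_eq0 => /orP[|].
    by rewrite eq_complex/= oner_eq0 andbF.
  by rewrite subr_eq0 !hper => /eqP.
case: ha => [a0|/andP[a1 a2]].
  apply: (main 0); apply: goursat => //; [exact: ltW|by rewrite add0r mulr_ge0// ltW|].
  move=> s t _ _; apply: (cdiff_holomorphic (k := fun z => k z * z)).
  by apply/cdiff_mulid/kd; rewrite ?a0 cexp_neq0.
have a0 : 0 < normc a by rewrite (lt_trans _ a1)// expR_gt0.
have [t0 [_ aE]] := polar a.
have {}aE : a = cexp (ln (normc a)) t0 by rewrite /cexp lnK.
(* A window of length 2 pi centred at the argument of [a] meets the logarithms of [a] exactly once,
   in its interior. *)
apply: (main (t0 - pi)); apply: (@goursat_except _ _ hc (ln (normc a)) t0).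
- by rewrite -[s1]expRK -[s2]expRK !ltr_ln ?posrE ?expR_gt0// a1.
- by apply/andP; split; lra.
move=> s t ss tt st; apply: (cdiff_holomorphic (k := fun z => k z * z)).
apply/cdiff_mulid/kd; first exact: cexp_neq0.
apply: contraNneq st => E.
have sE : s = ln (normc a) by rewrite -[s]expRK -(normc_cexp s t) E.
have : cis (t - t0) = 1.
  have x0 : (expR s)%:C != 0 by rewrite eq_complex/= eqxx andbT gt_eqF// expR_gt0.
  by move: E; rewrite aE -sE => /(mulfI x0) E; rewrite cisD E -cisD subrr cis0.
move=> [cos1 _]; have : cos `|t - t0| = cos 0 
    by rewrite cos0; have [_|_] := ger0P (t - t0); rewrite ?cosN.
have tpi : `|t - t0| <= pi by rewrite ler_norml; lra.
move/cos_inj; rewrite !in_itv/= lexx normr_ge0 tpi ltW//= => /(_ isT isT) /normr0_eq0 /eqP.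
by rewrite subr_eq0 sE => /eqP ->.
Qed.

Lemma circ_const k r1 r2 : (forall z, z != 0 -> cdiff_at k z) ->
  0 < r1 -> 0 < r2 -> circ k r1 = circ k r2.
Proof.
move=> kd; wlog r12 : r1 r2 / r1 < r2 => [hw r10 r20|].
  by case: (ltgtP r1 r2) => [/hw->|/hw->|->].
move=> r10 r20; rewrite -(lnK r10) -(lnK r20).
apply: (@circ_step _ 0); rewrite ?ltr_ln//; last by left.
- by move=> z z0; apply/cdiff_ccts/kd.
- by move=> z z0 _; exact: kd.
Qed.

(** The integral keeps its value when the radius shrinks, even across |a|, and tends to 0 with the
    radius because [k] is bounded near 0. *)
Lemma circ_zero k a r : (forall z, ccts_at k z) ->
  (forall z, z != 0 -> z != a -> cdiff_at k z) -> normc a < r -> circ k r = 0.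
Proof.
move=> kc kd ar; have r0 : 0 < r := le_lt_trans (normc_ge0 a) ar.
apply/eqP; rewrite -normc_eq0 eq_le normc_ge0 andbT.
have [del del0 H] := kc 0 1 ltr01.
pose M := normc (k 0) + 1.
have M0 : 0 < M by rewrite ltr_wpDl// normc_ge0.
have pi0 := pi_gt0 R.
apply/ler_addgt0Pl => e e0; rewrite addr0.
(* Keeps the small radius below |a| when [a] is not 0, since [circ_step] wants |a| strictly between
   the two radii. *)
pose q := if a == 0 then r else normc a.
have q0 : 0 < q by rewrite /q; case: ifPn => // a0; rewrite normc_gt0.
pose d := Num.min (Num.min (del / 2) (r / 2)) (Num.min (q / 2) (e / (4 * pi * M))).
have d0 : 0 < d by rewrite !lt_min !divr_gt0// !mulr_gt0.
have : d <= d by [].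
rewrite {2}/d !le_min => /andP[/andP[d1 d2] /andP[d3 d4]].
have -> : circ k r = circ k d.
  rewrite -(lnK r0) -(lnK d0); symmetry; apply: (@circ_step _ a) => //.
    by rewrite ltr_ln//; lra.
  rewrite !lnK//; have [->|a0] := eqVneq a 0; [by left|right].
  by rewrite ar andbT; move: d3 q0; rewrite /q (negPf a0); lra.
apply: (@le_trans _ _ (2 * (M * d) * (2 * pi - 0))).
  apply: normc_cint_le.
  - by apply: circ_ccontinuous.
  - by rewrite mulr_ge0// ltW.
  move=> t _; rewrite normcM normc_rcis ?(ltW d0)// ler_wpM2r ?(ltW d0)//.
  rewrite -[k _](subrK (k 0)) (le_trans (normcD _ _))// addrC lerD2l.
  by have := H (d%:C * cis t); rewrite add0r normc_rcis ?(ltW d0)//; apply; lra.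
rewrite subr0; have -> : e = 4 * pi * M * (e / (4 * pi * M)).
  by rewrite mulrC divfK// gt_eqF// !mulr_gt0.
have -> : 2 * (M * d) * (2 * pi) = 4 * pi * M * d by ring.
by rewrite ler_wpM2l// !mulr_ge0// ltW.
Qed.

End CircleIntegral.

(** * Taylor coefficients, Cauchy's estimates and the remainder *)

Section Taylor.
Variable R : realType.
Variable f : R[i] -> R[i].
Hypothesis entire_f : entire f.
Implicit Types (z w a : R[i]) (r M : R).

Let df z : cdiff_at f z.
Proof. by apply: derivable_cdiff; apply: entire_f. Qed.

Let coef_cdiff n z : z != 0 -> cdiff_at (fun z => f z * (z ^+ n)^-1) z.
Proof.
by move=> z0; apply: cdiffM => //; exact: cdiff_inv_pow.
Qed.

Definition taylor_coef n : R[i] :=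
  ((2 * pi)^-1)%:C * circ (fun z => f z * (z ^+ n.+1)^-1) 1.

Let circ_coef n r : 0 < r ->
  circ (fun z => f z * (z ^+ n.+1)^-1) r = (2 * pi)%:C * taylor_coef n.
Proof.
move=> r0; rewrite /taylor_coef mulrA -rmorphM/= divff ?mul1r; last first.
  by rewrite mulf_neq0 ?pnatr_eq0//= gt_eqF// pi_gt0.
by apply: circ_const => // z z0; exact: coef_cdiff.
Qed.

Lemma taylor_coef_le n r M : 0 < r ->
  (forall z, normc z <= r -> normc (f z) <= M) ->
  normc (taylor_coef n) * r ^+ n <= 2 * M.
Proof.
move=> r0 fM; have pi0 := pi_gt0 R.
have : normc ((2 * pi)%:C * taylor_coef n) <= 2 * (M / r ^+ n) * (2 * pi - 0).
  rewrite -(circ_coef n r0); apply: normc_cint_le.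
  - apply: (@circ_ccontinuous _ (fun z => f z * (z ^+ n.+1)^-1)) => // z z0.
    exact/cdiff_ccts/coef_cdiff.
  - by rewrite mulr_ge0// ltW.
  move=> t _; have n0 := rcis_neq0 t r0.
  have -> : f (r%:C * cis t) * ((r%:C * cis t) ^+ n.+1)^-1 * (r%:C * cis t) =
     f (r%:C * cis t) * ((r%:C * cis t) ^+ n)^-1.
    by move: n0; set z := _ * cis t => n0; rewrite exprS; field; rewrite n0 expf_neq0.
  rewrite normcM normcV normcX normc_rcis ?(ltW r0)// ler_wpM2r//.
    by rewrite invr_ge0 exprn_ge0// ltW.
  by apply: fM; rewrite normc_rcis ?(ltW r0).
rewrite subr0 normcM normcR ger0_norm ?mulr_ge0 ?(ltW pi0)//.
have -> : 2 * (M / r ^+ n) * (2 * pi) = 2 * pi * (2 * M / r ^+ n) by ring.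
by rewrite ler_pM2l ?mulr_gt0// ler_pdivlMr// exprn_gt0.
Qed.

(** On radius s the integral is s^-n times the one on radius 1, yet it does not depend on the
    radius; comparing radii 1 and 2 forces it to vanish for n > 0. *)
Let circ_pow n r : 0 < r ->
  circ (fun z : R[i] => (z ^+ n.+1)^-1) r = if n is 0%N then (2 * pi)%:C else 0.
Proof.
move=> r0; have E (s : R) : 0 < s ->
    circ (fun z : R[i] => (z ^+ n.+1)^-1) s = ((s ^+ n)^-1)%:C * circ (fun z : R[i] => (z ^+ n.+1)^-1) 1.
  move=> s0; rewrite /circ -cintZ; last first.
    apply: (@circ_ccontinuous _ (fun z => (z ^+ n.+1)^-1)) => // z z0.
    exact/cdiff_ccts/cdiff_inv_pow.
  apply: eq_cint => t; rewrite mul1r rmorphV/=; last by rewrite unitfE expf_neq0// gt_eqF.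
  rewrite rmorphXn/= !exprMn !exprS.
  have s0' : s%:C != 0 by rewrite eq_complex/= eqxx andbT gt_eqF.
  move: (cis_neq0 t) s0'; move: (cis t) (s%:C) => u v u0 v0.
  by field; rewrite u0 v0 !expf_neq0.
case: n E => [|n] E.
  have -> : circ (fun z : R[i] => (z ^+ 1)^-1) r = cint (fun=> 1) 0 (2 * pi).
    by apply: eq_cint => t; rewrite expr1 mulVf// rcis_neq0.
  by rewrite cint_cst subr0 mul1r.
have : circ (fun z : R[i] => (z ^+ n.+2)^-1) 1 = circ (fun z : R[i] => (z ^+ n.+2)^-1) 2.
  apply: circ_const => // z z0; exact/cdiff_inv_pow.
rewrite (E 2)// (E r r0) => /eqP; rewrite -subr_eq0 -[X in X - _]mul1r -mulrBl mulf_eq0.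
case/orP => [|/eqP ->]; last by rewrite mulr0.
rewrite -[1]/(1%:C) -rmorphB eq_complex/= eqxx andbT subr_eq0 => /eqP.
move/(congr1 (fun x => x * 2 ^+ n.+1)); rewrite mul1r mulVf ?expf_neq0// => /eqP.
rewrite gt_eqF//; apply: exprn_egt1 => //; exact: ltr1n.
Qed.

(** Cauchy's formula and the geometric series for 1 / (z - a) are used at once: the integrand left
    over is (f z - f a) (a / z)^N z / (z - a), where |a / z| <= 1/2 and |z / (z - a)| <= 2. *)
Lemma taylor_remainder N r M a : 0 < r ->
  (forall z, normc z <= r -> normc (f z) <= M) -> normc a <= r / 2 ->
  normc (f a - \sum_(k < N) taylor_coef k * a ^+ k) <= 8 * M / 2 ^+ N.
Proof.
move=> r0 fM ar; have pi0 := pi_gt0 R; have ar' : normc a < r by lra.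
have M0 : 0 <= M by rewrite (le_trans (normc_ge0 (f a)))// fM// ltW.
case: N => [|N].
  rewrite big_ord0 subr0 expr0 divr1 (le_trans (fM a (ltW ar')))//; lra.
have [B HB] := df a.
pose q z := (f z - f a) / (z - a).
(* Division by 0 gives [q a = 0], so this is the continuous extension of the difference quotient,
   with value [B] at [a]. *)
pose K z := q z + (if z == a then B else 0).
have Kq z : z != a -> K z = q z by rewrite /K => /negPf ->; rewrite addr0.
have Kd z : z != a -> cdiff_at K z.
  move=> za; apply: (@eq_cdiff_at _ q K z (normc (z - a))).
  - by rewrite normc_gt0 subr_eq0.
  - move=> w wz; rewrite Kq//; apply: contraTneq wz => zw.
    by rewrite -zw -leNgt opprD addrA subrr sub0r normcN.
  apply: cdiffM; last exact: cdiff_inv_sub.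
  by apply: cdiffB; [exact: df|exact: cdiff_cst].
have Kc z : ccts_at K z.
  have [->|/Kd/cdiff_ccts//] := eqVneq z a.
  move=> e e0; have [del del0 H] := HB e e0; exists del => // w wd.
  have [->|w0] := eqVneq w 0; first by rewrite addr0 subrr normc0 ltW.
  rewrite Kq; last by rewrite -subr_eq0 addrC addKr.
  have wE : a + w - a = w by rewrite (addrC a) addrK.
  rewrite /K /q eqxx wE subrr mul0r add0r.
  have -> : (f (a + w) - f a) / w - B = (f (a + w) - f a - B * w) / w by field.
  by rewrite normcM normcV ler_pdivrMr ?normc_gt0// H.
(* Terms of the expansion of (f z - f a) / (z - a) in powers of a / z. The part with f a integrates
   to 0 except at k = 0, where it produces the f a of the statement. *)
pose T k z := (f z - f a) * a ^+ k * (z ^+ k.+1)^-1.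
have Tc k z : z != 0 -> ccts_at (T k) z.
  move=> z0; apply: cdiff_ccts; apply: cdiffM; last exact: cdiff_inv_pow.
  apply: cdiffM; last exact: cdiff_cst.
  by apply: cdiffB; [exact: df|exact: cdiff_cst].
have cc k kc := @circ_ccontinuous R k r kc r0.
have cT k : ccontinuous (fun t => T k (r%:C * cis t) * (r%:C * cis t)).
  by apply: (cc (T k)); exact: Tc.
have cK : ccontinuous (fun t => K (r%:C * cis t) * (r%:C * cis t)).
  by apply: (cc K) => z _; exact: Kc.
have [cS ES] := @cint_sum R N.+1 (fun k t => T k (r%:C * cis t) * (r%:C * cis t))
  0 (2 * pi) (fun k => cT k).
have ET k : circ (T k) r = (2 * pi)%:C * (taylor_coef k * a ^+ k - (if k is 0%N then f a else 0)).
  have -> : circ (T k) r = a ^+ k * circ (fun z => f z * (z ^+ k.+1)^-1) r -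
     f a * a ^+ k * circ (fun z => (z ^+ k.+1)^-1) r.
    rewrite /circ -!cintZ -?cintB.
    - by apply: eq_cint => t; rewrite /T; ring.
    - by apply/ccontinuousZ/(cc (fun z => f z * (z ^+ k.+1)^-1)) => z z0; exact/cdiff_ccts/coef_cdiff.
    - by apply/ccontinuousZ/(cc (fun z => (z ^+ k.+1)^-1)) => z z0; exact/cdiff_ccts/cdiff_inv_pow.
    - by apply/(cc (fun z => (z ^+ k.+1)^-1)) => z z0; exact/cdiff_ccts/cdiff_inv_pow.
    - by apply/(cc (fun z => f z * (z ^+ k.+1)^-1)) => z z0; exact/cdiff_ccts/coef_cdiff.
  rewrite circ_coef// circ_pow//; case: k => [|k]; first by rewrite expr0; ring.
  by rewrite mulr0; ring.
have E : cint (fun t => K (r%:C * cis t) * (r%:C * cis t) -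
    \sum_(k < N.+1) T k (r%:C * cis t) * (r%:C * cis t)) 0 (2 * pi) =
    (2 * pi)%:C * (f a - \sum_(k < N.+1) taylor_coef k * a ^+ k).
  rewrite cintB// ES -/(circ K r) (@circ_zero _ K a r)//; last by move=> z _; exact: Kd.
  under eq_bigr => k _ do rewrite -/(circ (T k) r) ET.
  rewrite -mulr_sumr sumrB sub0r -mulrN opprB.
  by rewrite [X in X - _]big_ord_recl/= big1 ?addr0.
have : normc ((2 * pi)%:C * (f a - \sum_(k < N.+1) taylor_coef k * a ^+ k)) <=
    2 * (4 * M / 2 ^+ N.+1) * (2 * pi - 0).
  rewrite -E; apply: normc_cint_le.
  - under eq_fun do rewrite -mulN1r.
    by apply: ccontinuousD => //; exact: ccontinuousZ.
  - by rewrite mulr_ge0// ltW.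
  move=> t _; set z := r%:C * cis t; have z0 : z != 0 := rcis_neq0 t r0.
  have zr : normc z = r by rewrite normc_rcis// ltW.
  have za : z != a by apply: contraTneq ar' => <-; rewrite zr ltxx.
  clearbody z.
  have -> : K z * z - \sum_(k < N.+1) T k z * z =
      (f z - f a) * (a / z) ^+ N.+1 * (z / (z - a)).
    have -> : \sum_(k < N.+1) T k z * z = (f z - f a) * \sum_(k < N.+1) (a / z) ^+ k.
      rewrite mulr_sumr; apply: eq_bigr => k _; rewrite /T expr_div_n exprS.
      by field; rewrite z0 expf_neq0.
    have az1 : a / z != 1 by apply: contra_neq za => /(congr1 ( *%R^~ z)); rewrite divfK// mul1r.
    have := subrX1 (a / z) N.+1; set S := \sum_(_ < _) _ => HS.
    rewrite Kq// /q.
    have -> : S = (1 - (a / z) ^+ N.+1) * (z / (z - a)).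
      apply: (@mulfI _ (a / z - 1)); first by rewrite subr_eq0.
      rewrite -HS; have zs : z - a != 0 by rewrite subr_eq0.
      move: (_ ^+ _) => Q.
      have -> : a / z - 1 = - ((z - a) / z) by field.
      by field; rewrite ?zs ?z0.
    by ring.
  rewrite !normcM normcX normcM normcV zr.
  have -> : 4 * M / 2 ^+ N.+1 = (M + M) * (2^-1) ^+ N.+1 * 2 by rewrite exprVn; ring.
  have zar : r / 2 <= normc (z - a).
    by have := normc_ge_sub z a; rewrite zr; lra.
  apply: ler_pM; rewrite ?mulr_ge0 ?normc_ge0 ?exprn_ge0 ?divr_ge0 ?normc_ge0 ?(ltW r0)//.
    apply: ler_pM; rewrite ?normc_ge0 ?exprn_ge0 ?divr_ge0 ?normc_ge0 ?(ltW r0)//.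
      by rewrite (le_trans (normcB _ _))// lerD// fM// ?zr// ltW.
    rewrite lerXn2r// ?nnegrE ?divr_ge0 ?normc_ge0 ?(ltW r0)//.
    by rewrite ler_pdivrMr// mulrC.
  rewrite normcV ler_pdivrMr; last by rewrite (lt_le_trans _ zar)// divr_gt0.
  lra.
rewrite subr0 normcM normcR ger0_norm ?mulr_ge0 ?(ltW pi0)//.
have -> : 2 * (4 * M / 2 ^+ N.+1) * (2 * pi) = 2 * pi * (8 * M / 2 ^+ N.+1) by ring.
by rewrite ler_pM2l ?mulr_gt0.
Qed.

Lemma entire_continuous_at z : ccts_at f z.
Proof. exact/cdiff_ccts/df. Qed.

End Taylor.

(** * The sub-mean value property of [log^+ |f|] *)

Section LogPlus.
Variable R : realType.
Implicit Types (x y : R).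

Lemma log_plus_ge0 x : 0 <= log_plus x.
Proof. by rewrite ln_ge0// le_max lexx. Qed.

Lemma ler_log_plus x y : x <= y -> log_plus x <= log_plus y.
Proof.
move=> xy; rewrite ler_ln ?posrE ?lt_max ?ltr01//.
by rewrite ge_max !le_max lexx xy orbT.
Qed.

(** The logarithm has slope at most 1 on [1, +oo). This lets mean values pass to uniform limits with
    no care for zeros. *)
Lemma log_plus_lipschitz x y : `|log_plus x - log_plus y| <= `|x - y|.
Proof.
wlog xy : x y / y <= x => [hw|].
  by case: (leP y x) => [/hw//|/ltW/hw]; rewrite distrC (distrC x).
rewrite !ger0_norm ?subr_ge0 ?ler_log_plus//.
have X1 (t : R) : 1 <= Num.max 1 t by rewrite le_max lexx.
have X0 (t : R) : 0 < Num.max 1 t by rewrite (lt_le_trans _ (X1 t)).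
apply: (@le_trans _ _ (Num.max 1 x - Num.max 1 y)); last first.
  have [y1|y1] := leP 1 y; have [x1|x1] := leP 1 x; lra.
have := expR_ge1Dx (log_plus x - log_plus y).
rewrite expRD expRN !lnK ?posrE// -ler_pdivrMr//; last by rewrite invr_gt0.
rewrite invrK => H.
have d0 : 0 <= log_plus x - log_plus y by rewrite subr_ge0 ler_log_plus.
have : log_plus x - log_plus y <= (log_plus x - log_plus y) * Num.max 1 y.
  by rewrite ler_peMr.
have := X1 y; lra.
Qed.

Lemma ln_le_log_plus x : 0 < x -> ln x <= log_plus x.
Proof. by move=> x0; rewrite ler_ln ?posrE ?lt_max ?x0 ?ltr01 ?orbT// le_max lexx orbT. Qed.

Lemma log_plus_le1 x : x <= 1 -> log_plus x = 0.
Proof. by move=> x1; rewrite /log_plus max_l// ln1. Qed.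

Lemma continuous_log_plus_comp (f : R[i] -> R[i]) (g : R -> R[i]) :
  (forall z, ccts_at f z) -> ccontinuous g ->
  continuous (fun t => log_plus (normc (f (g t)))).
Proof.
move=> fc [g1 g2] t; apply/cvgrPdist_le => /= e e0.
have [d d0 H] := fc (g t) e e0.
have d2 : 0 < d / 2 by rewrite divr_gt0.
have := g1 t => /cvgrPdist_lt /(_ _ d2) G1.
have := g2 t => /cvgrPdist_lt /(_ _ d2) G2.
near=> t'.
rewrite (le_trans (log_plus_lipschitz _ _))//.
have gd : normc (g t' - g t) < d.
  rewrite (le_lt_trans (normc_le_ReIm _))// (splitr d) ltrD//.
    by rewrite raddfB/= distrC; near: t'.
  by rewrite raddfB/= distrC; near: t'.
have := H _ gd; rewrite subrKC => {}H.
have A1 := normc_ge_sub (f (g t)) (f (g t')).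
have A2 := normc_ge_sub (f (g t')) (f (g t)).
move: A1; rewrite normc_distC => A1.
rewrite ler_norml; lra.
Unshelve. all: by end_near. Qed.

End LogPlus.

(** * Products over the roots of unity *)

Section UnityProduct.
Variable R : realType.

Lemma cis_eq1 (x : R) : 0 < x < 2 * pi -> cis x != 1.
Proof.
move=> x02; apply/eqP => -[cx _].
have s0 : 0 < sin (x / 2).
  by apply: sin_gt0_pi; lra.
have := cosD (x / 2) (x / 2); rewrite -splitr cx => E.
have := cos2Dsin2 (x / 2); rewrite !expr2 => E2.
have : 0 < sin (x / 2) * sin (x / 2) by rewrite mulr_gt0.
lra.
Qed.

Lemma cis_primitive_root N : (0 < N)%N -> N.-primitive_root (cis (2 * pi / N%:R) : R[i]).
Proof.
move=> N0; apply/andP; split=> //; apply/forallP => i /=.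
have NR : 0 < N%:R :> R by rewrite ltr0n.
have pi0 := pi_gt0 R.
rewrite unity_rootE cisX; apply/eqP.
have [iN|iN] := eqVneq i.+1 N.
  by rewrite iN mulrCA mulfV ?mulr1 ?cis_2pi ?eqxx// gt_eqF.
apply/negbTE/cis_eq1.
have iN' : i.+1%:R < N%:R :> R by rewrite ltr_nat ltn_neqAle iN ltn_ord.
rewrite mulr_gt0 ?divr_gt0 ?mulr_gt0 ?ltr0n//=.
by rewrite mulrA ltr_pdivrMr// mulrC ltr_pM2l ?mulr_gt0.
Qed.

Lemma prod_sub_unity (F : fieldType) N (w x : F) : N.-primitive_root w ->
  \prod_(j < N) (x - w ^+ j) = x ^+ N - 1.
Proof.
move=> /factor_Xn_sub_1 /(congr1 (horner^~ x)).
rewrite hornerD hornerN hornerXn hornerC => <-; rewrite big_mkord horner_prod.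
by apply: eq_bigr => j _; rewrite !hornerE.
Qed.

Lemma prod_add_unity_root (F : fieldType) N (w v x : F) : (0 < N)%N -> N.-primitive_root w ->
  \prod_(j < N) (x + v * w ^+ j) = x ^+ N - (- v) ^+ N.
Proof.
move=> N0 /prod_sub_unity H.
have [->|v0] := eqVneq v 0.
  under eq_bigr do rewrite mul0r addr0.
  by rewrite prodr_const card_ord oppr0 expr0n (gtn_eqF N0) subr0.
have xE : - v * (- x / v) = x by field.
have := congr1 (fun y => (- v) ^+ N * y) (H (- x / v)).
rewrite mulrBr -exprMn xE mulr1 => <-.
have -> : (- v) ^+ N = \prod_(j < N) (- v) by rewrite prodr_const card_ord.
by rewrite -big_split/=; apply: eq_bigr => j _; field.
Qed.

Lemma prod_add_unity N (al be u : R[i]) : (0 < N)%N ->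
  \prod_(j < N) (be + al * (u * cis (2 * pi / N%:R *+ j))) = be ^+ N - (- (al * u)) ^+ N.
Proof.
move=> N0; rewrite -(prod_add_unity_root _ _ N0 (cis_primitive_root N0)).
by apply: eq_bigr => j _; rewrite mulrA cisX [j%:R * _]mulr_natl.
Qed.

End UnityProduct.

(** * From linear factors to entire functions, and the characteristic *)

Section SubMeanValue.
Variable R : realType.
Implicit Types (r t e d : R) (z w a b c : R[i]) (s : seq R[i]).

(* [moebius t] is [(2 x + 1) / (2 + x)] at [x = cis t]. *)
Definition moebius t : R[i] :=
  ((4 + 5 * cos t) / (5 + 4 * cos t)) +i* (3 * sin t / (5 + 4 * cos t)).

Let den_gt0 t : 0 < 5 + 4 * cos t.
Proof. by have := cos_geN1 t; lra. Qed.

Lemma moebiusE t : (2 + cis t) * moebius t = 2 * cis t + 1.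
Proof.
have d0 := gt_eqF (den_gt0 t); have cs := cos2Dsin2 t.
have E : sin t ^+ 2 = 1 - cos t ^+ 2 by lra.
have C1 : (1 : R[i]) = 1 +i* 0 by [].
have C2 : (2 : R[i]) = 2 +i* 0 by rewrite mulr2n C1; simpc.
rewrite C2 C1 /moebius /cis; simpc.
congr (_ +i* _); last by field; rewrite d0.
transitivity (((2 + cos t) * (4 + 5 * cos t) - 3 * sin t ^+ 2) / (5 + 4 * cos t)).
  by field; rewrite d0.
by rewrite E; field; rewrite d0.
Qed.

Lemma moebius_den_neq0 t : 2 + cis t != 0.
Proof.
rewrite -normc_gt0 -[cis t]opprK.
have := normc_ge_sub 2 (- cis t); rewrite normcN normc_cis normc_nat; lra.
Qed.

Lemma normc_moebius t : normc (moebius t) = 1.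
Proof.
have d0 := gt_eqF (den_gt0 t); have cs := cos2Dsin2 t.
have E : sin t ^+ 2 = 1 - cos t ^+ 2 by lra.
apply/eqP; rewrite -(@eqrXn2 _ 2)// ?normc_ge0// expr1n normc_sqr /=; apply/eqP.
transitivity (((4 + 5 * cos t) ^+ 2 + 9 * sin t ^+ 2) / (5 + 4 * cos t) ^+ 2).
  by field; rewrite d0.
by rewrite E; field; rewrite d0.
Qed.

Lemma moebius_periodic t : moebius (t + 2 * pi) = moebius t.
Proof.
by rewrite (_ : 2 * pi = pi *+ 2) ?mulr_natl// /moebius cosD2pi sinD2pi.
Qed.

Lemma moebius_ccontinuous c : ccontinuous (fun t => c * moebius t).
Proof.
apply: ccontinuousZ; split => t /=.
- apply: (@continuousM _ _ (fun t => 4 + 5 * cos t) (fun t => (5 + 4 * cos t)^-1)).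
    apply: cvgD; first exact: cvg_cst.
    apply: cvgM; [exact: cvg_cst|exact: continuous_cos].
  apply: cvgV; first by rewrite gt_eqF// den_gt0.
  apply: cvgD; first exact: cvg_cst.
  apply: cvgM; [exact: cvg_cst|exact: continuous_cos].
- apply: (@continuousM _ _ (fun t => 3 * sin t) (fun t => (5 + 4 * cos t)^-1)).
    apply: cvgM; [exact: cvg_cst|exact: continuous_sin].
  apply: cvgV; first by rewrite gt_eqF// den_gt0.
  apply: cvgD; first exact: cvg_cst.
  apply: cvgM; [exact: cvg_cst|exact: continuous_cos].
Qed.

Lemma expr_le_half r : 0 <= r < 1 -> exists N0, forall N, (N0 <= N)%N -> r ^+ N <= 2^-1.
Proof.
move=> /andP[r0 r1].
have /cvgrPdist_le/(_ 2^-1) : (fun n => r ^+ n) @ \oo --> (0 : R).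
  by apply: cvg_expr; rewrite ger0_norm.
rewrite invr_gt0 ltr0n => /(_ isT)[N0 _ H]; exists N0 => N /H /=.
by rewrite sub0r normrN ger0_norm ?exprn_ge0.
Qed.

Lemma expr_gap (x y : R) : 0 <= x -> 0 <= y -> x != y ->
  exists N0, forall N, (N0 <= N)%N -> x ^+ N / 2 <= `|x ^+ N - y ^+ N|.
Proof.
move=> x0 y0; rewrite neq_lt => /orP[] xy.
- have y00 : 0 < y by rewrite (le_lt_trans x0).
  have [|N0 H] := @expr_le_half (x / y); first by rewrite divr_ge0//= ltr_pdivrMr// mul1r.
  exists N0 => N /H; rewrite expr_div_n ler_pdivrMr ?exprn_gt0// => h.
  have := exprn_ge0 N x0; rewrite distrC ler_normr => ?; apply/orP; left; lra.
- have x00 : 0 < x by rewrite (le_lt_trans y0).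
  have [|N0 H] := @expr_le_half (y / x); first by rewrite divr_ge0//= ltr_pdivrMr// mul1r.
  exists N0 => N /H; rewrite expr_div_n ler_pdivrMr ?exprn_gt0// => h.
  have := exprn_ge0 N y0; rewrite ler_normr => ?; apply/orP; left; lra.
Qed.

Let rootfun c s z := c * \prod_(b <- s) (z - b).

Lemma rootfun_cdiff c s z : cdiff_at (rootfun c s) z.
Proof.
rewrite /rootfun; apply: cdiffM; first exact: cdiff_cst.
elim: s => [|b s IH].
  by under eq_fun do rewrite big_nil; exact: cdiff_cst.
under eq_fun do rewrite big_cons.
by apply: cdiffM => //; apply: cdiffB; [exact: cdiff_id|exact: cdiff_cst].
Qed.

(** |c - 2 b| and |2 c - b| differ exactly when |b| and |c| do. So for large N the numerator is at
    least |c - 2 b|^N / 2, while the denominator is at most 2 times 2^N. *)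
Let factor_ge c b : normc b != normc c -> exists N0, forall N u, (0 < N)%N -> (N0 <= N)%N ->
  normc u = 1 ->
  (normc (c / 2 - b)) ^+ N / 4 <=
  normc ((c - 2 * b) ^+ N - (- ((2 * c - b) * u)) ^+ N) / normc (2 ^+ N - (- u) ^+ N).
Proof.
move=> bc.
have [|N0 HN] := @expr_gap (normc (c - 2 * b)) (normc (2 * c - b)) (normc_ge0 _) (normc_ge0 _).
  apply: contra_neq bc => E; apply/eqP; rewrite -(@eqrXn2 _ 2) ?normc_ge0//; apply/eqP.
  move/(congr1 (fun x => x ^+ 2)): E; rewrite !normc_sqr.
  case: c => c1 c2; case: b => b1 b2; rewrite /= => E; lra.
exists N0 => N u N0' /HN {}HN u1.
have nu : normc ((- u) ^+ N) = 1 by rewrite normcX normcN u1 expr1n.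
have n2 : normc ((2 : R[i]) ^+ N) = 2 ^+ N by rewrite normcX normc_nat.
have p2 : 1 < 2 ^+ N :> R by rewrite exprn_egt1 ?ltr1n// -lt0n.
have dle : normc (2 ^+ N - (- u) ^+ N) <= 2 * 2 ^+ N.
  by rewrite (le_trans (normcB _ _))// nu n2; lra.
have dgt : 0 < normc (2 ^+ N - (- u) ^+ N).
  by rewrite (lt_le_trans _ (normc_ge_sub _ _))// nu n2; lra.
rewrite (ler_pdivlMr _ _ dgt).
have -> : normc (c / 2 - b) = normc (c - 2 * b) / 2.
  have -> : c / 2 - b = (c - 2 * b) / 2 by field.
  by rewrite normcM normcV normc_nat.
apply: (@le_trans _ _ (normc (c - 2 * b) ^+ N / 2)).
  rewrite expr_div_n.
  apply: (@le_trans _ _ (normc (c - 2 * b) ^+ N / 2 ^+ N / 4 * (2 * 2 ^+ N))).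
    by apply: ler_wpM2l => //; rewrite !divr_ge0 ?exprn_ge0 ?normc_ge0.
  by rewrite le_eqVlt; apply/orP; left; apply/eqP; field; rewrite expf_neq0.
apply: (le_trans HN); rewrite ler_norml.
have nA : normc ((c - 2 * b) ^+ N) = normc (c - 2 * b) ^+ N by rewrite normcX.
have nB : normc ((- ((2 * c - b) * u)) ^+ N) = normc (2 * c - b) ^+ N.
  by rewrite normcX normcN normcM u1 mulr1.
have g1 := normc_ge_sub ((c - 2 * b) ^+ N) ((- ((2 * c - b) * u)) ^+ N).
have g2 := normc_ge_sub ((- ((2 * c - b) * u)) ^+ N) ((c - 2 * b) ^+ N).
rewrite nA nB in g1; rewrite nA nB normc_distC in g2; move: g1 g2.
move: (normc (_ ^+ N - _)) (normc (c - 2 * b) ^+ N) (normc (2 * c - b) ^+ N).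
by move=> X x y g1 g2; apply/andP; split; lra.
Qed.

Let prod_factor c b N t : (0 < N)%N ->
  \prod_(j < N) (c * moebius (t + 2 * pi / N%:R *+ j) - b) =
  ((c - 2 * b) ^+ N - (- ((2 * c - b) * cis t)) ^+ N) / (2 ^+ N - (- cis t) ^+ N).
Proof.
move=> N0; have := @prod_add_unity R N 1 2 (cis t) N0; rewrite mul1r => <-.
rewrite -prod_add_unity// -prodf_div; apply: eq_bigr => j _.
rewrite mul1r -cisD; set x := _ + _ *+ j.
have d0 := moebius_den_neq0 x.
have -> : moebius x = (2 * cis x + 1) / (2 + cis x) by rewrite -moebiusE mulrC mulKf.
by field.
Qed.

(** Each root costs a factor 4 whatever N is, so [C] disappears in the limit of N-th roots. The
    point c / 2 appears because (2 x + 1) / (2 + x) is 1/2 at the centre x = 0. *)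
Lemma rootfun_prod_ge c0 s c : (forall b, b \in s -> normc b != normc c) ->
  exists2 C : R, 0 < C & exists N0, forall N t, (0 < N)%N -> (N0 <= N)%N ->
  (normc (rootfun c0 s (c / 2))) ^+ N / C <=
  \prod_(j < N) normc (rootfun c0 s (c * moebius (t + 2 * pi / N%:R *+ j))).
Proof.
elim: s => [|b s IH] hs.
  exists 1 => //; exists 0%N => N t _ _.
  under eq_bigr do rewrite /rootfun big_nil mulr1.
  by rewrite prodr_const card_ord /rootfun big_nil mulr1 divr1.
have [|C C0 [N1 H1]] := IH; first by move=> x xs; apply: hs; rewrite inE xs orbT.
have [N2 H2] := factor_ge (hs b (mem_head _ _)).
exists (4 * C); first by rewrite mulr_gt0.
exists (maxn N1 N2) => N t N0; rewrite geq_max => /andP[/(H1 _ t N0){}H1 /(H2 _ (cis t) N0) {}H2].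
have rE z : rootfun c0 (b :: s) z = (z - b) * rootfun c0 s z.
  by rewrite /rootfun big_cons; ring.
under eq_bigr do rewrite rE normcM.
rewrite rE normcM exprMn big_split/= -normc_prod prod_factor// normcM normcV.
have -> : normc (c / 2 - b) ^+ N * normc (rootfun c0 s (c / 2)) ^+ N / (4 * C) =
  normc (c / 2 - b) ^+ N / 4 * (normc (rootfun c0 s (c / 2)) ^+ N / C).
  by field; rewrite gt_eqF.
apply: ler_pM => //; rewrite ?divr_ge0 ?exprn_ge0 ?normc_ge0// ?(ltW C0)//.
by apply: H2; exact: normc_cis.
Qed.

Let meanfun (f : R[i] -> R[i]) c t := log_plus (normc (f (c * moebius t))).

Let meanfun_continuous f c : (forall z, ccts_at f z) -> continuous (meanfun f c).
Proof.
by move=> fc; apply: continuous_log_plus_comp => //; exact: moebius_ccontinuous.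
Qed.

Let meanfun_periodic f c t : meanfun f c (t + 2 * pi) = meanfun f c t.
Proof. by rewrite /meanfun moebius_periodic. Qed.

Lemma oint_sum n (F : 'I_n -> R -> R) x y : (forall i, continuous (F i)) ->
  continuous (fun t => \sum_(i < n) F i t) /\
  oint (fun t => \sum_(i < n) F i t) x y = \sum_(i < n) oint (F i) x y.
Proof.
elim: n F => [|n IH] F cF.
  have E : (fun t => \sum_(i < 0) F i t) = fun=> 0.
    by apply/funext => t; rewrite big_ord0.
  by rewrite E; split; [exact: cst_continuous|rewrite oint_cst mul0r big_ord0].
have E : (fun t => \sum_(i < n.+1) F i t) = fun t =>
    \sum_(i < n) F (widen_ord (leqnSn n) i) t + F ord_max t.
  by apply/funext => t; rewrite big_ord_recr.
have [C1 C2] := IH (fun i => F (widen_ord (leqnSn n) i)) (fun i => cF _).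
rewrite E; split; first by move=> t; exact: (cvgD (C1 t) (cF ord_max t)).
by rewrite ointD// C2 big_ord_recr.
Qed.

Let log_plus_prod n (q : 'I_n -> R) :
  0 < \prod_(j < n) Num.max 1 (q j) /\
  ln (\prod_(j < n) Num.max 1 (q j)) = \sum_(j < n) log_plus (q j).
Proof.
elim/big_rec2: _ => [|j x y _ [x0 E]]; first by rewrite ltr01 ln1.
have m0 : 0 < Num.max 1 (q j) by rewrite lt_max ltr01.
by split; [rewrite mulr_gt0|rewrite lnM ?posrE// E].
Qed.

(** Integrating the product inequality over the rotation [t] avoids any limit of Riemann sums: by
    periodicity the N translates of [G] have the same integral. Dividing by N then removes ln C. *)
Let submean_rootfun c0 s c : (forall b, b \in s -> normc b != normc c) ->
  log_plus (normc (rootfun c0 s (c / 2))) * (2 * pi) <=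
  oint (meanfun (rootfun c0 s) c) 0 (2 * pi).
Proof.
move=> hs; set A := normc _; set G := meanfun _ _; have pi0 := pi_gt0 R.
have cG : continuous G.
  by apply: meanfun_continuous => z; exact/cdiff_ccts/rootfun_cdiff.
have J0 : 0 <= oint G 0 (2 * pi).
  apply: oint_ge0 => //; first by rewrite mulr_ge0// ltW.
  by move=> t _; exact: log_plus_ge0.
have [A1|A1] := leP A 1; first by rewrite log_plus_le1// mul0r.
have A0 : 0 < A by rewrite (lt_trans _ A1).
have -> : log_plus A = ln A by rewrite /log_plus max_r// ltW.
have [C C0 [N0 HN]] := rootfun_prod_ge c0 hs.
have key N : (0 < N)%N -> (N0 <= N)%N ->
    N%:R * (ln A * (2 * pi) - oint G 0 (2 * pi)) <= ln C * (2 * pi).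
  move=> N1 N2.
  have P t : N%:R * ln A - ln C <= \sum_(j < N) G (t + 2 * pi / N%:R *+ j).
    have := HN N t N1 N2; rewrite -/A => H.
    have [p0 pE] := log_plus_prod (fun j : 'I_N => normc (rootfun c0 s (c * moebius (t + 2 * pi / N%:R *+ j)))).
    have -> : N%:R * ln A - ln C = ln (A ^+ N / C).
      by rewrite ln_div ?posrE ?exprn_gt0// lnXn// mulr_natl.
    rewrite -[leRHS]pE ler_ln ?posrE ?divr_gt0 ?exprn_gt0//.
    apply: (le_trans H); apply: ler_prod => j _.
    by rewrite normc_ge0 le_max lexx orbT.
  have cGs (j : 'I_N) : continuous (fun t => G (t + 2 * pi / N%:R *+ j)).
    move=> t; apply: (@continuous_comp _ _ _ (fun t => t + 2 * pi / N%:R *+ j) G); last exact: cG.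
    by apply: cvgD; [exact: cvg_id|exact: cvg_cst].
  have [cS ES] := oint_sum 0 (2 * pi) cGs.
  have : oint (fun=> N%:R * ln A - ln C) 0 (2 * pi) <=
      oint (fun t => \sum_(j < N) G (t + 2 * pi / N%:R *+ j)) 0 (2 * pi).
    apply: le_oint; [exact: cst_continuous|exact: cS| |by move=> t _; exact: P].
    by rewrite mulr_ge0// ltW.
  rewrite ES oint_cst subr0.
  have -> : \sum_(j < N) oint (fun t => G (t + 2 * pi / N%:R *+ j)) 0 (2 * pi) =
     N%:R * oint G 0 (2 * pi).
    under eq_bigr => j _.
      rewrite oint_shift// add0r (addrC (2 * pi)) oint_periodic//; last exact: meanfun_periodic.
      over.
    by rewrite /= sumr_const card_ord [RHS]mulr_natl.
  have alg (a b C' J p : R) : (a * b - C') * p <= a * J -> a * (b * p - J) <= C' * p.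
    by move=> ?; lra.
  exact: alg.
rewrite leNgt; apply/negP; rewrite -subr_gt0; set D := _ - _ in key * => D0.
pose N := maxn N0 (Num.bound (`|ln C * (2 * pi)| / D)).+1.
have := key N; rewrite leq_max ltnS leq0n orbT leq_max leqnn => /(_ isT isT).
apply/negP; rewrite -ltNge -ltr_pdivrMr//.
have bnd := archi_boundP (divr_ge0 (normr_ge0 (ln C * (2 * pi))) (ltW D0)).
apply: (le_lt_trans (y := `|ln C * (2 * pi)| / D)).
  by rewrite ler_wpM2r ?invr_ge0 ?(ltW D0)// ler_norm.
by apply: (lt_le_trans bnd); rewrite ler_nat leq_max leqnSn orbT.
Qed.

Lemma entire_bounded f r : (forall z, ccts_at f z) ->
  exists2 M : R, 0 <= M & forall z, normc z <= r -> normc (f z) <= M.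
Proof.
move=> fc.
pose g (p : R * R) := normc (f (p.1 +i* p.2)).
have cg : continuous g.
  move=> p; apply/cvgrPdist_le => /= e e0.
  have [d d0 H] := fc (p.1 +i* p.2) e e0.
  have d2 : 0 < d / 2 by rewrite divr_gt0.
  have /cvgrPdist_lt/(_ _ d2) G1 : (fun q : R * R => q.1) q @[q --> p] --> p.1 by exact: cvg_fst.
  have /cvgrPdist_lt/(_ _ d2) G2 : (fun q : R * R => q.2) q @[q --> p] --> p.2 by exact: cvg_snd.
  near=> q.
  have E : (q.1 +i* q.2) = (p.1 +i* p.2) + ((q.1 - p.1) +i* (q.2 - p.2)).
    by simpc; rewrite !subrKC.
  have gd : normc ((q.1 - p.1) +i* (q.2 - p.2)) < d.
    rewrite (le_lt_trans (normc_le_ReIm _))//= (splitr d) ltrD//.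
      by rewrite distrC; near: q.
    by rewrite distrC; near: q.
  have := H _ gd; rewrite -E -/(g p) => {}H.
  have A1 := normc_ge_sub (f (p.1 +i* p.2)) (f (q.1 +i* q.2)).
  have A2 := normc_ge_sub (f (q.1 +i* q.2)) (f (p.1 +i* p.2)).
  move: A1; rewrite normc_distC => A1.
  by rewrite ler_norml /g; apply/andP; split; lra.
have cK : compact (`[- r, r]%classic `*` `[- r, r]%classic : set (R * R)).
  by apply: compact_setX; exact: segment_compact.
have : compact (g @` (`[- r, r]%classic `*` `[- r, r]%classic)).
  by apply: continuous_compact => //; exact: continuous_subspaceT.
move/compact_bounded => [M0 [_ HM]]; pose M := Num.max 0 (M0 + 1).
exists M; first by rewrite le_max lexx.
move=> z zr; have MM : M0 < M by rewrite lt_max ltrDl ltr01 orbT.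
have := HM _ MM (normc (f z)); rewrite /= ger0_norm ?normc_ge0//; apply.
exists (Re z, Im z); last by rewrite /g/= -complex_ReIm.
have := normRe_le z; have := normIm_le z.
by rewrite !ler_norml /= !in_itv/= => *; split; lra.
Unshelve. all: by end_near. Qed.

Lemma poly_lipschitz (p : {poly R[i]}) r : 0 <= r -> exists2 L : R, 0 <= L &
  (forall z, normc z <= r -> normc p.[z] <= L) /\
  forall z w, normc z <= r -> normc w <= r -> normc (p.[z] - p.[w]) <= L * normc (z - w).
Proof.
move=> r0; elim/poly_ind: p => [|p c [L L0 [H1 H2]]].
  exists 0 => //; split=> [z _|z w _ _]; rewrite !hornerC ?subrr normc0 ?mul0r//.
exists (L * r + L + normc c); first by rewrite !addr_ge0 ?mulr_ge0 ?normc_ge0.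
have cn := normc_ge0 c; have Lr : 0 <= L * r by rewrite mulr_ge0.
split=> [z zr|z w zr wr]; rewrite !hornerMXaddC.
  rewrite (le_trans (normcD _ _))// normcM lerD2r.
  apply: (@le_trans _ _ (L * r)); last by rewrite lerDl.
  by apply: ler_pM; rewrite ?normc_ge0// H1.
have -> : p.[z] * z + c - (p.[w] * w + c) = (p.[z] - p.[w]) * z + p.[w] * (z - w) by ring.
rewrite (le_trans (normcD _ _))// !normcM.
have zw := normc_ge0 (z - w).
apply: (@le_trans _ _ (L * normc (z - w) * r + L * normc (z - w))).
  apply: lerD; first by apply: ler_pM; rewrite ?normc_ge0// H2.
  by apply: ler_wpM2r => //; exact: H1.
have := mulr_ge0 cn zw; lra.
Qed.

Lemma exists_avoid (l : seq R) (x y : R) : x < y -> exists2 rho, x < rho < y & rho \notin l.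
Proof.
elim: l x y => [|a l IH] x y xy; first by exists ((x + y) / 2) => //; lra.
have [ax|ax] := leP a ((x + y) / 2).
  have [|rho rxy rl] := IH ((x + y) / 2) y; first lra.
  exists rho; first lra.
  by rewrite inE negb_or rl andbT gt_eqF//; lra.
have [|rho rxy rl] := IH x ((x + y) / 2); first lra.
exists rho; first lra.
by rewrite inE negb_or rl andbT lt_eqF//; lra.
Qed.

(** A Taylor polynomial p may have zeros on |z| = |c|; replacing it by p(rho z), with rho slightly
    below 1, moves them off the circle at a cost controlled by the Lipschitz constant. *)
Let approx_rootfun f c e : entire f -> c != 0 -> 0 < e -> exists c0 s,
  (forall b, b \in s -> normc b != normc c) /\
  forall z, normc z <= normc c -> normc (f z - rootfun c0 s z) <= e.
Proof.
move=> ef c0 e0; set r := normc c.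
have r0 : 0 < r by rewrite normc_gt0.
have [M M0 fM] := entire_bounded (2 * r) (entire_continuous_at ef).
have [N HN] : exists N, 8 * M / 2 ^+ N <= e / 2.
  exists (Num.bound (16 * M / e)).
  rewrite ler_pdivrMr ?exprn_gt0//.
  have M16 : 0 <= 16 * M / e by rewrite divr_ge0 ?mulr_ge0// ltW.
  have := archi_boundP M16; rewrite ltr_pdivrMr// => H.
  have : (Num.bound (16 * M / e))%:R <= 2 ^+ (Num.bound (16 * M / e)) :> R.
    by rewrite -natrX ler_nat ltnW// ltn_expl.
  move=> /(ler_wpM2r (ltW e0)); lra.
pose p := \poly_(k < N) taylor_coef f k.
have [s pE] := closed_field_poly_normal p.
have pz z : p.[z] = rootfun (lead_coef p) s z.
  rewrite {1}pE hornerZ horner_prod; congr (_ * _).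
  by apply: eq_bigr => b _; rewrite !hornerE.
have [L L0 [_ HL]] := poly_lipschitz p (ltW r0).
have x1 : Num.max 0 (1 - e / (2 * (1 + L * r))) < 1.
  rewrite gt_max ltr01 ltrBlDr ltrDl divr_gt0// mulr_gt0// ltr_pwDl// mulr_ge0//.
  exact: ltW.
(* The zeros of p(rho z) are the b / rho, of modulus r exactly when rho = |b| / r. *)
have [rho] := exists_avoid [seq normc b / r | b <- s] x1.
rewrite gt_max => /andP[/andP[rho0 rho1] rho2] rhos.
have rhoC : rho%:C != 0 by rewrite eq_complex/= eqxx andbT gt_eqF.
have cE z : rootfun (lead_coef p) s (rho%:C * z) =
   rootfun (lead_coef p * rho%:C ^+ size s) [seq b / rho%:C | b <- s] z.
  rewrite /rootfun big_map -mulrA; congr (_ * _).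
  elim: (s) => [|b s' IH]; first by rewrite !big_nil expr0 mulr1.
  by rewrite !big_cons IH /= exprS; field.
exists (lead_coef p * rho%:C ^+ size s), [seq b / rho%:C | b <- s]; split.
  move=> _ /mapP[b bs ->]; apply: contraNneq rhos => E.
  apply/mapP; exists b => //; rewrite -/r -E normcM normcV normcR (gtr0_norm rho0).
  rewrite invf_div mulrCA mulfV ?mulr1//.
  apply: contraTneq r0; rewrite -/r -E normcM => ->; by rewrite mul0r ltxx.
move=> z zr; rewrite -cE -pz.
have -> : f z - p.[rho%:C * z] = (f z - p.[z]) + (p.[z] - p.[rho%:C * z]) by ring.
rewrite (le_trans (normcD _ _))// (splitr e) lerD//.
  apply: (le_trans _ HN).
  have -> : p.[z] = \sum_(k < N) taylor_coef f k * z ^+ k by rewrite horner_poly.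
  apply: (@taylor_remainder _ f ef N (2 * r)) => //; first by rewrite mulr_gt0.
  by rewrite mulrAC divff ?mul1r.
have rz : normc (rho%:C * z) <= r.
  rewrite normcM normcR (gtr0_norm rho0) (le_trans _ zr)//.
  by rewrite ler_piMl ?normc_ge0// ltW.
apply: (le_trans (HL _ _ zr rz)).
have -> : z - rho%:C * z = (1 - rho)%:C * z by rewrite rmorphB/= rmorph1; ring.
have rho3 : 0 <= 1 - rho by rewrite subr_ge0 ltW.
rewrite normcM normcR ger0_norm//.
have Lr : 0 <= L * r by rewrite mulr_ge0// ltW.
apply: (@le_trans _ _ (L * ((1 - rho) * r))).
  by rewrite !ler_wpM2l.
have -> : e / 2 = (1 + L * r) * (e / (2 * (1 + L * r))).
  by field; rewrite gt_eqF// ltr_pwDl.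
rewrite mulrCA mulrC; apply: ler_pM => //; [by rewrite lerDr|].
by rewrite lerBlDl -lerBlDr ltW.
Qed.

Lemma submean_entire f c : entire f -> c != 0 ->
  log_plus (normc (f (c / 2))) * (2 * pi) <=
  oint (fun t => log_plus (normc (f (c * moebius t)))) 0 (2 * pi).
Proof.
move=> ef c0; have pi0 := pi_gt0 R.
apply/ler_addgt0Pl => e e0.
have d0 : 0 < e / (4 * pi) by rewrite divr_gt0// mulr_gt0.
have [a [s [hs H]]] := approx_rootfun ef c0 d0.
have S := submean_rootfun a hs.
have cl z : normc z <= normc c ->
    `|log_plus (normc (f z)) - log_plus (normc (rootfun a s z))| <= e / (4 * pi).
  move=> zc; apply: (le_trans (log_plus_lipschitz _ _)); apply: (le_trans _ (H _ zc)).
  have A1 := normc_ge_sub (f z) (rootfun a s z).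
  have A2 := normc_ge_sub (rootfun a s z) (f z).
  move: A2; rewrite normc_distC => A2.
  by rewrite ler_norml; apply/andP; split; lra.
have cf : continuous (meanfun f c) by apply: meanfun_continuous; exact: entire_continuous_at.
have cr : continuous (meanfun (rootfun a s) c).
  by apply: meanfun_continuous => z; exact/cdiff_ccts/rootfun_cdiff.
have c2 : normc (c / 2) <= normc c.
  rewrite normcM normcV normc_nat; have := normc_ge0 c; lra.
have I1 : oint (meanfun (rootfun a s) c) 0 (2 * pi) <=
    oint (fun t => meanfun f c t + e / (4 * pi)) 0 (2 * pi).
  apply: le_oint => //.
  - by move=> t; exact: (cvgD (cf t) (cvg_cst _)).
  - by rewrite mulr_ge0// ltW.
  move=> t _; have := cl (c * moebius t); rewrite normcM normc_moebius mulr1 lexx => /(_ isT).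
  by rewrite ler_norml /meanfun; lra.
rewrite ointD// in I1; last exact: cst_continuous.
rewrite oint_cst subr0 in I1.
have := cl _ c2; rewrite ler_norml => /andP[_ C1].
have C2 : log_plus (normc (f (c / 2))) * (2 * pi) <=
   (log_plus (normc (rootfun a s (c / 2))) + e / (4 * pi)) * (2 * pi).
  by apply: ler_wpM2r; [rewrite mulr_ge0// ltW|lra].
have eE : e / (4 * pi) * (2 * pi) = e / 2.
  by move: (pi : R) pi0 => p p0; field; rewrite gt_eqF.
rewrite [X in _ <= X]mulrDl eE in C2; rewrite eE in I1.
rewrite /meanfun in I1 S *; lra.
Qed.

(* The angle at which [moebius] takes the value [cis t]. *)
Let angle t := t + 2 * atan (sin t / (2 - cos t)).

Let cos2_gt0 t : 0 < 2 - cos t.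
Proof. by have := cos_le1 t; lra. Qed.

Let cos5_ge1 t : 1 <= 5 - 4 * cos t.
Proof. by have := cos_le1 t; lra. Qed.

(** This derivative is the Poisson kernel of the unit disc at 1/2. Its maximum 3, at t = 0, is the
    constant of [log_plus_le_nevanlinna]. *)
Let angle_derive t : is_derive t 1 angle (3 / (5 - 4 * cos t)).
Proof.
have c2 := cos2_gt0 t; have c5 := cos5_ge1 t.
have E : sin t ^+ 2 = 1 - cos t ^+ 2 by have := cos2Dsin2 t; lra.
have dcos : is_derive t 1 (fun t => 2 - cos t) (sin t).
  by have := is_deriveB (is_derive_cst (2 : R) t (1 : R)) (is_derive_cos t); rewrite sub0r opprK.
have dinv := @is_deriveV R (fun t => 2 - cos t) t (sin t) 1 (lt0r_neq0 c2) dcos.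
have dq := is_deriveM (is_derive_sin t) dinv.
have dat := @is_derive1_comp R atan (fun t => sin t / (2 - cos t)) t _ _
  (is_derive1_atan (sin t / (2 - cos t))) dq.
apply: is_derive_eq (is_deriveD (is_derive_id t 1) (is_deriveZ 2 dat)) _.
have y2 : 1 + (sin t / (2 - cos t)) ^+ 2 = (5 - 4 * cos t) / (2 - cos t) ^+ 2.
  by rewrite expr_div_n E; field; rewrite gt_eqF.
rewrite y2 /GRing.scale/= -exprVn.
transitivity (1 + 2 * ((2 - cos t) ^+ 2 / (5 - 4 * cos t)) * (cos t / (2 - cos t) - sin t ^+ 2 / (2 - cos t) ^+ 2)).
  by field; rewrite !gt_eqF//; lra.
by rewrite E; field; rewrite !gt_eqF//; lra.
Qed.

(** The inverse Moebius map sends u on the unit circle to (2 u - 1) / (2 - u) = u (2 - u') / (2 -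
    u), with u' the conjugate of u; its argument is that of u plus twice that of 2 - u'. *)
Let moebius_angle t : moebius (angle t) = cis t.
Proof.
have c2 := cos2_gt0 t; have c5 := cos5_ge1 t.
have E : sin t ^+ 2 = 1 - cos t ^+ 2 by have := cos2Dsin2 t; lra.
set y := sin t / (2 - cos t).
have y2 : 1 + y ^+ 2 = (5 - 4 * cos t) / (2 - cos t) ^+ 2.
  by rewrite expr_div_n E; field; rewrite gt_eqF.
pose C := cos (atan y).
have Cy : sin (atan y) = y * C.
  have Cn : C != 0 by rewrite /C cos_atan invr_neq0// gt_eqF// sqrtr_gt0 ltr_pwDl// sqr_ge0.
  apply: (mulIf (invr_neq0 Cn)); rewrite mulfK//; exact: atanK.
have C2 : C ^+ 2 = (2 - cos t) ^+ 2 / (5 - 4 * cos t).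
  have := cos2Dsin2 (atan y); rewrite Cy exprMn -/C.
  rewrite -[X in X + _]mul1r -mulrDl y2 => /(congr1 (fun x => (2 - cos t) ^+ 2 / (5 - 4 * cos t) * x)).
  rewrite mulr1 => <-; field; rewrite !gt_eqF//; lra.
have D : cis (angle t) * (cis t - 2) = 1 - 2 * cis t.
  have -> : cis (angle t) = cis t * cis (atan y) ^+ 2 by rewrite /angle cisD cisX.
  have C1' : (1 : R[i]) = 1 +i* 0 by [].
  have C2' : (2 : R[i]) = 2 +i* 0 by rewrite mulr2n C1'; simpc.
  rewrite expr2 C2' C1' /cis Cy -/C; simpc.
  have n5 : 5 - 4 * cos t != 0 by rewrite gt_eqF//; lra.
  have n2 : 2 - cos t != 0 by rewrite gt_eqF.
  pose X := (3 - 4 * cos t + 2 * cos t ^+ 2) / (5 - 4 * cos t).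
  pose Y := 2 * (2 - cos t) / (5 - 4 * cos t).
  have -> : C * C - y * C * (y * C) = X.
    transitivity (C ^+ 2 * (1 - y ^+ 2)); first by ring.
    by rewrite C2 expr_div_n E /X; field; rewrite n5 n2.
  have -> : C * (y * C) + y * C * C = sin t * Y.
    transitivity (C ^+ 2 * (2 * y)); first by ring.
    by rewrite C2 /y /Y; field; rewrite n5 n2.
  congr (_ +i* _).
    transitivity ((cos t * X - sin t ^+ 2 * Y) * (cos t - 2) - sin t ^+ 2 * (cos t * Y + X)).
      by ring.
    by rewrite E /X /Y; field.
  transitivity (sin t * ((cos t * X - sin t ^+ 2 * Y) + (cos t * Y + X) * (cos t - 2))).
    by ring.
  by rewrite E /X /Y; field.
apply: (mulfI (moebius_den_neq0 (angle t))); rewrite moebiusE.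
have -> : 2 * cis (angle t) + 1 = (2 * cis t + cis (angle t) * cis t) + (1 - 2 * cis t - cis (angle t) * (cis t - 2)) by ring.
by rewrite D subrr addr0; ring.
Qed.

(** The sub-mean value inequality at c = 2 z, after the substitution [angle], is a Poisson mean over
    the circle of radius 2 |z|. Bounding the kernel by 3 and rotating by the argument of z gives the
    characteristic. *)
Lemma log_plus_le_nevanlinna f z : entire f -> z != 0 ->
  log_plus (normc (f z)) <= 3 * nevanlinna_char f (2 * normc z).
Proof.
move=> ef z0; have pi0 := pi_gt0 R.
have [al [al2 zE]] := polar z; set r := normc z in zE *.
have c0 : 2 * z != 0 by rewrite mulf_neq0// pnatr_eq0.
have := submean_entire ef c0; rewrite mulrAC divff ?pnatr_eq0// mul1r => S.
pose G t := log_plus (normc (f (2 * z * cis t))).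
pose H t := log_plus (normc (f ((2 * r)%:C * cis t))).
have fc := entire_continuous_at ef.
have cis_cc c : ccontinuous (fun t => c * cis t).
  by apply: ccontinuousZ; split; [exact: continuous_cos|exact: continuous_sin].
have cG : continuous G by exact: continuous_log_plus_comp.
have cH : continuous H by exact: continuous_log_plus_comp.
have cM : continuous (meanfun f (2 * z)) by exact: meanfun_continuous.
have c0' : angle 0 = 0 by rewrite /angle sin0 mul0r atan0 mulr0 addr0.
have c2pi : angle (2 * pi) = 2 * pi by rewrite /angle [2 * pi]mulr_natl sin2pi mul0r atan0 mulr0 addr0.
have I1 : oint (meanfun f (2 * z)) 0 (2 * pi) <= 3 * oint G 0 (2 * pi).
  rewrite -{1}c0' -{1}c2pi -(oint_sub _ _ angle_derive cM) -ointZ//.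
  apply: le_oint => //.
  - move=> t; apply: cvgM.
      apply: (@continuous_comp _ _ _ angle (meanfun f (2 * z))); last exact: cM.
      apply/differentiable_continuous/derivable1_diffP; by case: (angle_derive t).
    apply: cvgM; first exact: cvg_cst.
    apply: cvgV; first by rewrite gt_eqF// (lt_le_trans _ (cos5_ge1 t)).
    apply: cvgB; first exact: cvg_cst.
    by apply: cvgM; [exact: cvg_cst|exact: continuous_cos].
  - exact: continuousZl.
  - by rewrite mulr_ge0// ltW.
  move=> t _; rewrite /meanfun moebius_angle -/(G t) mulrC.
  apply: ler_wpM2r; first exact: log_plus_ge0.
  by rewrite ler_pdivrMr ?(lt_le_trans _ (cos5_ge1 t))// ler_peMr.
have GH : oint G 0 (2 * pi) = oint H 0 (2 * pi).
  have -> : G = fun t => H (t + al).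
    apply/funext => t; rewrite /G /H; congr (log_plus (normc (f _))).
    by rewrite zE rmorphM/= rmorph_nat cisD; ring.
  rewrite oint_shift// add0r (addrC (2 * pi)) oint_periodic// => t.
  by rewrite /H cisD cis_2pi mulr1.
have NE : nevanlinna_char f (2 * r) = (2 * pi)^-1 * oint H 0 (2 * pi).
  rewrite /nevanlinna_char -Rintegral_oint ?mulr_gt0//; congr (_ * _).
  apply: eq_Rintegral => t _; rewrite /H normr_normc/=; congr (log_plus (normc (f _))).
  by rewrite /circle_point /cis; simpc.
rewrite NE mulrCA -ler_pdivrMl ?invrK ?invr_gt0 ?mulr_gt0//.
rewrite GH in I1; apply: (le_trans _ I1); rewrite mulrC; exact: S.
Qed.

End SubMeanValue.

(** * The algebraic equation at separated scales *)

Section AlgebraicEquation.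
Variable R : realType.
Implicit Types (z u v w : R[i]).

Lemma coef_size_bound (A : nzRingType) (p : {poly {poly A}}) :
  exists n, forall k, (size (p`_k)%R <= n)%N.
Proof.
exists (\max_(k < size p) size (p`_k)%R)%N => k.
have [kp|kp] := ltnP k (size p); last by rewrite nth_default// size_poly0.
exact: (leq_bigmax (Ordinal kp)).
Qed.

(** A common bound on the three degrees puts the monomials in one finite type, on which maxima can
    be taken. *)
Lemma eval_zuv_sum (Omega : {poly {poly {poly R[i]}}}) : exists n, 
  [/\ forall k, (n <= k)%N -> Omega`_k = 0,
      forall k j, (n <= j)%N -> Omega`_k`_j = 0,
      forall k j i, (n <= i)%N -> Omega`_k`_j`_i = 0 &
  forall z u v, eval_zuv Omega z u v = \sum_(t : 'I_n * 'I_n * 'I_n)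
    Omega`_(t.2)`_(t.1.2)`_(t.1.1) * (z ^+ t.1.1 * u ^+ t.1.2 * v ^+ t.2)].
Proof.
have [n2 H2] := coef_size_bound Omega.
have [n3 H3] : exists n, forall k j, (size (Omega`_k`_j)%R <= n)%N.
  have H k : exists n, forall j, (size (Omega`_k`_j)%R <= n)%N by exact: coef_size_bound.
  have [g Hg] := choice H.
  exists (\max_(k < size Omega) g k)%N => k j.
  have [kp|kp] := ltnP k (size Omega); last by rewrite (nth_default _ kp) coef0 size_poly0.
  exact: (leq_trans (Hg k j) (leq_bigmax (Ordinal kp))).
pose n := (size Omega + n2 + n3)%N.
have nO : (size Omega <= n)%N by rewrite /n -addnA leq_addr.
have n2n k : (size (Omega`_k)%R <= n)%N by rewrite (leq_trans (H2 k))// /n addnAC leq_addl.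
have n3n k j : (size (Omega`_k`_j)%R <= n)%N by rewrite (leq_trans (H3 k j))// /n leq_addl.
exists n; split.
- by move=> k nk; rewrite nth_default// (leq_trans nO).
- by move=> k j nj; rewrite nth_default// (leq_trans (n2n k)).
- by move=> k j i ni; rewrite nth_default// (leq_trans (n3n k j)).
move=> z u v; rewrite /eval_zuv (horner_coef_wide _ nO) !horner_sum.
transitivity (\sum_(k < n) \sum_(j < n) \sum_(i < n) Omega`_k`_j`_i * (z ^+ i * u ^+ j * v ^+ k)).
  apply: eq_bigr => k _; rewrite hornerM horner_exp !hornerE.
  rewrite (horner_coef_wide _ (n2n k)) horner_sum mulr_suml; apply: eq_bigr => j _.
  rewrite hornerM !horner_exp !hornerE (horner_coef_wide _ (n3n k j)) !mulr_suml.
  by apply: eq_bigr => i _; ring.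
transitivity (\sum_(i < n) \sum_(j < n) \sum_(k < n) Omega`_k`_j`_i * (z ^+ i * u ^+ j * v ^+ k)).
  under eq_bigr => k _ do rewrite exchange_big/=.
  by rewrite exchange_big/=; apply: eq_bigr => i _; rewrite exchange_big.
rewrite pair_bigA/= pair_bigA/=.
by apply: eq_bigr => -[[i j] k].
Qed.

(* In the scale |w| << |z| << |u|, distinct triples (d, e, k) give monomials
   u^d z^e w^k of different size, so that a single one dominates. *)
Let dominated (D d e k d' e' k' : nat) (y Z U : R) : 1 <= y -> y ^+ D <= Z -> Z ^+ D <= U ->
  (k < D)%N -> (e < D)%N ->
  [\/ (d < d')%N, d = d' /\ (e < e')%N | [/\ d = d', e = e' & (k < k')%N]] ->
  y * (Z ^+ e * U ^+ d * y ^+ k) <= Z ^+ e' * U ^+ d' * y ^+ k'.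
Proof.
move=> y1 yZ ZU kD eD.
have Z1 : 1 <= Z by rewrite (le_trans _ yZ)// exprn_ege1.
have U1 : 1 <= U by rewrite (le_trans _ ZU)// exprn_ege1.
have ge0 (t : R) : 1 <= t -> 0 <= t by apply: le_trans.
have yk : y * y ^+ k <= Z by rewrite -exprS (le_trans _ yZ)// ler_weXn2l.
have Ze : Z ^+ e * Z <= U by rewrite -exprSr (le_trans _ ZU)// ler_weXn2l.
have p0 (t : R) q : 1 <= t -> 0 <= t ^+ q by move=> /ge0 t0; exact: exprn_ge0.
have p1 (t : R) q : 1 <= t -> 1 <= t ^+ q by move=> t1; exact: exprn_ege1.
have -> : y * (Z ^+ e * U ^+ d * y ^+ k) = U ^+ d * (Z ^+ e * (y * y ^+ k)) by ring.
case=> [dd|[-> ee]|[-> -> kk]].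
- apply: (@le_trans _ _ (U ^+ d')).
    apply: (@le_trans _ _ (U ^+ d * U)); last by rewrite -exprSr ler_weXn2l.
    apply: ler_wpM2l; first exact: p0.
    by apply: le_trans Ze; apply: ler_wpM2l; first exact: p0.
  rewrite mulrAC -[leLHS]mul1r; apply: ler_wpM2r; first exact: p0.
  by rewrite -[1]mul1r ler_pM ?p1.
- apply: (@le_trans _ _ (U ^+ d' * Z ^+ e')).
    apply: ler_wpM2l; first exact: p0.
    apply: (@le_trans _ _ (Z ^+ e * Z)); first by apply: ler_wpM2l; first exact: p0.
    by rewrite -exprSr ler_weXn2l.
  by rewrite mulrC -[leLHS]mulr1; apply: ler_wpM2l; rewrite ?mulr_ge0 ?p0 ?p1.
- rewrite -exprS mulrA (mulrC (U ^+ d')); apply: ler_wpM2l.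
    by rewrite mulr_ge0 ?p0.
  by rewrite ler_weXn2l.
Qed.

(** Put z v = u w and y = |w|. Multiplied by z^n, the monomial z^i u^j v^k becomes z^(i + n - k)
    u^(j + k) w^k, and these exponents determine (i, j, k). If y > 1, the lexicographically largest
    one exceeds each other monomial by a factor y, so the equation bounds y by a ratio of
    coefficients. *)
Lemma eval_zuv_bound (Omega : {poly {poly {poly R[i]}}}) : Omega != 0 ->
  exists D, exists2 L : R, 1 <= L & forall z u v,
    1 <= normc z -> normc z ^+ D <= normc u ->
    (normc z * normc v) ^+ D <= normc z * normc u ^+ D ->
    eval_zuv Omega z u v = 0 -> normc z * normc v <= L * normc u.
Proof.
move=> O0; have [n [n1 n2 n3 HS]] := eval_zuv_sum Omega.
pose T : finType := ('I_n * 'I_n * 'I_n)%type.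
pose C (t : T) : R[i] := Omega`_(t.2)`_(t.1.2)`_(t.1.1).
pose dd (t : T) := (t.1.2 + t.2)%N.
pose ee (t : T) := (t.1.1 + (n - t.2))%N.
pose kk (t : T) : nat := t.2.
have [t0 Ct0] : exists t0, C t0 != 0.
  apply/existsP; rewrite -[X in is_true X]negbK negb_exists; apply: contra O0 => /forallP al.
  have {}al (t : T) : C t = 0 by apply/eqP; rewrite -[_ == _]negbK.
  apply/eqP/polyP => k; rewrite coef0; have [kn|/n1->//] := ltnP k n.
  apply/polyP => j; rewrite coef0; have [jn|/n2->//] := ltnP j n.
  apply/polyP => i; rewrite coef0; have [in_|/n3->//] := ltnP i n.
  exact: (al (Ordinal in_, Ordinal jn, Ordinal kn)).
pose P0 t := C t != 0.
case: (@arg_maxnP T t0 P0 dd Ct0) => t1; rewrite /P0 /geq/= => Ct1 max1.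
pose P1 t := (C t != 0) && (dd t == dd t1).
have P1t1 : P1 t1 by rewrite /P1 Ct1 eqxx.
case: (@arg_maxnP T t1 P1 ee P1t1) => t2 /andP[Ct2 /eqP d2]; rewrite /geq/= => max2.
pose P2 t := [&& C t != 0, dd t == dd t1 & ee t == ee t2].
have P2t2 : P2 t2 by rewrite /P2 Ct2 d2 !eqxx.
case: (@arg_maxnP T t2 P2 kk P2t2) => t3 /and3P[Ct3 /eqP d3 /eqP e3]; rewrite /geq/= => max3.
have lex t : C t != 0 -> t != t3 -> [\/ (dd t < dd t3)%N, dd t = dd t3 /\ (ee t < ee t3)%N |
    [/\ dd t = dd t3, ee t = ee t3 & (kk t < kk t3)%N]].
  move=> Ct tt3; have := max1 t Ct; rewrite leq_eqVlt d3 => /orP[/eqP dt|]; last by constructor 1.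
  have := max2 t; rewrite /P1 Ct dt eqxx => /(_ isT); rewrite leq_eqVlt e3 => /orP[/eqP et|]; last by constructor 2.
  have := max3 t; rewrite /P2 Ct dt et !eqxx => /(_ isT); rewrite leq_eqVlt => /orP[/eqP kt|]; last by constructor 3.
  case/eqP: tt3; move: dt et kt; rewrite -d3 -e3 /dd /ee /kk.
  case: (t) => [[i j] k]; case: (t3) => [[i' j'] k'] /= dt et /val_inj kt.
  subst k'; move/addIn: dt => /val_inj ->; move/addIn: et => /val_inj ->.
  by [].
pose S := \sum_t normc (C t).
have C3 : 0 < normc (C t3) by rewrite normc_gt0.
(* This [D] exceeds all exponents [ee] and [kk], as [dominated] requires. *)
exists (2 * n).+1, (Num.max 1 (S / normc (C t3))); first by rewrite le_max lexx.
move=> z u v Z1 ZU zvu E.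
have U1 : 1 <= normc u by rewrite (le_trans _ ZU)// exprn_ege1.
have U0 : 0 < normc u by rewrite (lt_le_trans ltr01).
have u0 : u != 0 by rewrite -normc_gt0.
have [w zvw] : exists w, z * v = u * w.
  by exists (z * v / u); rewrite [RHS]mulrC divfK.
set y := normc w.
have yE : normc z * normc v = y * normc u by rewrite -normcM zvw normcM mulrC.
rewrite yE ler_pM2r//.
have [y1|y1] := leP y 1; first by rewrite le_max y1.
have yZ : y ^+ (2 * n).+1 <= normc z.
  by move: zvu; rewrite yE exprMn ler_pM2r// exprn_gt0.
rewrite le_max ler_pdivlMr//; apply/orP; right.
pose mono (t : T) : R[i] := z ^+ ee t * u ^+ dd t * w ^+ kk t.
have Emono : \sum_t C t * mono t = 0.
  transitivity (z ^+ n * eval_zuv Omega z u v); last by rewrite E mulr0.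
  rewrite HS mulr_sumr; apply: eq_bigr => t _; rewrite /mono /C.
  have tn : (t.2 <= n)%N by exact: ltnW.
  have -> : z ^+ n = z ^+ (n - t.2) * z ^+ t.2 by rewrite -exprD subnK.
  rewrite /ee /dd /kk !exprD.
  have -> : z ^+ (n - t.2) * z ^+ t.2 * (Omega`_(t.2)`_(t.1.2)`_(t.1.1) * (z ^+ t.1.1 * u ^+ t.1.2 * v ^+ t.2)) =
    Omega`_(t.2)`_(t.1.2)`_(t.1.1) * (z ^+ t.1.1 * z ^+ (n - t.2) * u ^+ t.1.2 * (z * v) ^+ t.2) by rewrite exprMn; ring.
  by rewrite zvw exprMn !mulrA.
have nm t : normc (mono t) = normc z ^+ ee t * normc u ^+ dd t * y ^+ kk t.
  by rewrite !normcM !normcX.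
have m3 : 0 < normc (mono t3).
  by rewrite nm !mulr_gt0 ?exprn_gt0// (lt_le_trans ltr01)// ltW.
have dom t : C t != 0 -> t != t3 -> y * normc (mono t) <= normc (mono t3).
  move=> Ct tt3; rewrite !nm; apply: (@dominated (2 * n).+1) => //; first exact: ltW.
  - by rewrite /kk ltnS (leq_trans (ltnW (ltn_ord _)))// leq_pmull.
  - rewrite /ee ltnS mul2n -addnn leq_add// ?leq_subr//; exact: ltnW.
  - exact: lex.
move: Emono; rewrite (bigD1 t3)//= => /eqP; rewrite addr_eq0 => /eqP E3.
have : normc (C t3) * normc (mono t3) <= \sum_(t | t != t3) normc (C t) * normc (mono t).
  rewrite -normcM E3 normcN (le_trans (normc_sum _ _ _))//.
  by under eq_bigr do rewrite normcM.
move/(ler_wpM2l (le_trans ler01 (ltW y1))) => H.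
rewrite -(ler_pM2r m3) -mulrA; apply: (le_trans H).
have SE : S = normc (C t3) + \sum_(t | t != t3) normc (C t) by rewrite /S (bigD1 t3).
rewrite mulr_sumr SE mulrDl mulr_suml.
apply: (@le_trans _ _ (\sum_(t | t != t3) normc (C t) * normc (mono t3))).
  apply: ler_sum => t tt3; have [->|Ct] := eqVneq (C t) 0; first by rewrite normc0 !mul0r mulr0.
  by rewrite mulrCA ler_wpM2l ?normc_ge0// dom.
by rewrite lerDr mulr_ge0 ?normc_ge0.
Qed.

End AlgebraicEquation.

(** * Growth estimates *)

Section PowerDifferences.
Variable R : realType.
Implicit Types (z s e : R[i]) (r c : R).

(** The factor r on the left stands for the power of r lost by differentiation; it leaves (r + c)^n
    on the right, ready to be paired with the n-th Taylor coefficient. *)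
Lemma normc_powB_le z s r c n : normc z <= r -> normc s <= c ->
  r * normc ((z + s) ^+ n - z ^+ n) <= n%:R * c * (r + c) ^+ n.
Proof.
move=> zr sc; have r0 : 0 <= r := le_trans (normc_ge0 z) zr.
have c0 : 0 <= c := le_trans (normc_ge0 s) sc.
have rc : 0 <= r + c by rewrite addr_ge0.
elim: n => [|n IH]; first by rewrite !expr0 subrr normc0 mulr0 !mul0r.
have -> : (z + s) ^+ n.+1 - z ^+ n.+1 = ((z + s) ^+ n - z ^+ n) * (z + s) + z ^+ n * s.
  by rewrite !exprSr; ring.
apply: (@le_trans _ _ (r * (normc ((z + s) ^+ n - z ^+ n) * (r + c) + r ^+ n * c))).
  apply: ler_wpM2l => //; rewrite (le_trans (normcD _ _))// !normcM normcX lerD//.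
    by rewrite ler_wpM2l ?normc_ge0// (le_trans (normcD _ _))// lerD.
  by apply: ler_pM; rewrite ?exprn_ge0 ?normc_ge0// lerXn2r// ?nnegrE ?normc_ge0.
have h1 : r * normc ((z + s) ^+ n - z ^+ n) * (r + c) <= n%:R * c * (r + c) ^+ n * (r + c).
  by apply: ler_wpM2r.
have h2 : r ^+ n.+1 * c <= (r + c) ^+ n.+1 * c.
  by apply: ler_wpM2r => //; rewrite lerXn2r ?nnegrE// lerDl.
move: h1 h2; rewrite -natr1 !exprSr; lra.
Qed.

(** Second order version. At n = 0 the truncated exponent [n.-1] is harmless, its factor being 0. *)
Lemma normc_powB2_le z s r c n : normc z <= r -> normc s <= c ->
  r ^+ 2 * normc ((z + s) ^+ n - z ^+ n - n%:R * s * z ^+ n.-1) <=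
  n%:R ^+ 2 * c ^+ 2 * (r + c) ^+ n.
Proof.
move=> zr sc; have r0 : 0 <= r := le_trans (normc_ge0 z) zr.
have c0 : 0 <= c := le_trans (normc_ge0 s) sc.
have rc : 0 <= r + c by rewrite addr_ge0.
have r2 : 0 <= r ^+ 2 by rewrite exprn_ge0.
elim: n => [|n IH]; first by rewrite !expr0 !mul0r !subrr normc0 mulr0 expr0n !mul0r.
set D := _ - _ - _ in IH.
have -> : (z + s) ^+ n.+1 - z ^+ n.+1 - n.+1%:R * s * z ^+ n.+1.-1 =
    D * (z + s) + n%:R * (s ^+ 2 * z ^+ n.-1).
  by rewrite /D -natr1; case: (n) => [|m]; rewrite /= ?exprSr ?expr0; ring.
have zn : r ^+ 2 * (n%:R * (c ^+ 2 * normc z ^+ n.-1)) <= n%:R * c ^+ 2 * (r + c) ^+ n.+1.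
  case: (n) => [|m] /=; first by rewrite !mul0r mulr0.
  have -> : r ^+ 2 * (m.+1%:R * (c ^+ 2 * normc z ^+ m)) = m.+1%:R * c ^+ 2 * (r ^+ 2 * normc z ^+ m) by ring.
  apply: ler_wpM2l; first by rewrite mulr_ge0// exprn_ge0.
  apply: (@le_trans _ _ (r ^+ 2 * r ^+ m)).
    by rewrite ler_wpM2l// lerXn2r// ?nnegrE ?normc_ge0.
  by rewrite -exprD add2n lerXn2r// ?nnegrE// lerDl.
apply: (@le_trans _ _ (r ^+ 2 * (normc D * (r + c) + n%:R * (c ^+ 2 * normc z ^+ n.-1)))).
  apply: ler_wpM2l => //; rewrite (le_trans (normcD _ _))// !normcM !normcX normc_nat lerD//.
    by rewrite ler_wpM2l ?normc_ge0// (le_trans (normcD _ _))// lerD.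
  rewrite ler_wpM2l// ler_wpM2r ?exprn_ge0 ?normc_ge0//.
  by rewrite expr2 ler_pM ?normc_ge0.
have h1 : r ^+ 2 * normc D * (r + c) <= n%:R ^+ 2 * c ^+ 2 * (r + c) ^+ n * (r + c).
  by apply: ler_wpM2r.
have h3 : 0 <= (n%:R + 1) * (c ^+ 2 * (r + c) ^+ n.+1).
  by rewrite mulr_ge0 ?addr_ge0// mulr_ge0 ?exprn_ge0.
move: h1 h3 zn; rewrite -natr1 !exprSr => h1 h3 zn; rewrite expr0 in h1 h3 zn *; lra.
Qed.

End PowerDifferences.

(** * Maximum modulus and bounds on differences *)

Section MaximumModulus.
Variable R : realType.
Variable f : R[i] -> R[i].
Hypothesis ef : entire f.
Implicit Types (z s : R[i]) (r x : R).

Let a := taylor_coef f.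

Definition max_modulus r : R := sup [set normc (f z) | z in [set z | normc z <= r]].

Lemma le_max_modulus r z : normc z <= r -> normc (f z) <= max_modulus r.
Proof.
move=> zr; apply: ub_le_sup; last by exists z.
have [M _ HM] := entire_bounded r (entire_continuous_at ef).
by exists M => _ [w wr <-]; exact: HM.
Qed.

Lemma max_modulus_ge0 r : 0 <= r -> 0 <= max_modulus r.
Proof.
by move=> r0; rewrite (le_trans (normc_ge0 (f 0)))// le_max_modulus// normc0.
Qed.

Lemma max_modulus_half r : 0 <= r -> 0 < max_modulus r ->
  exists2 z, normc z <= r & max_modulus r / 2 <= normc (f z).
Proof.
move=> r0 m0; have z0 : normc (0 : R[i]) <= r by rewrite normc0.
have : max_modulus r / 2 < max_modulus r by lra.
move=> /sup_gt[|_ [z zr <-] h]; last by exists z => //; exact: ltW.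
by exists (normc (f 0)); exists 0.
Qed.

Lemma coef_max_modulus n r : 0 < r -> normc (a n) * r ^+ n <= 2 * max_modulus r.
Proof. by move=> r0; apply: taylor_coef_le => // z; exact: le_max_modulus. Qed.

Lemma taylor_cvg z e : 0 < e -> exists N0, forall N, (N0 <= N)%N ->
  normc (f z - \sum_(k < N) a k * z ^+ k) <= e.
Proof.
move=> e0; pose r := 2 * normc z + 2.
have z0 := normc_ge0 z; have r0 : 0 < r by rewrite /r; lra.
have M0 := max_modulus_ge0 (ltW r0).
exists (Num.bound (8 * max_modulus r / e)) => N HN.
have zr : normc z <= r / 2 by rewrite /r; lra.
apply: (le_trans (@taylor_remainder _ f ef N r _ z r0 (@le_max_modulus r) zr)).
rewrite ler_pdivrMr ?exprn_gt0// [leRHS]mulrC -ler_pdivrMr//.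
have B0 : 0 <= 8 * max_modulus r / e by rewrite divr_ge0 ?mulr_ge0// ltW.
apply: (le_trans (ltW (archi_boundP B0))).
by rewrite -natrX ler_nat (leq_trans HN)// ltnW// ltn_expl.
Qed.

Lemma coef_neq0 : ~ (exists p : {poly R[i]}, forall z, f z = p.[z]) ->
  forall N, exists2 n, (N <= n)%N & a n != 0.
Proof.
move=> np N; apply: contrapT => H; apply: np; exists (\poly_(k < N) a k) => z.
have a0 n : (N <= n)%N -> a n = 0.
  by move=> Nn; apply/eqP/negPn/negP => an; apply: H; exists n.
rewrite horner_poly; apply/eqP; rewrite -subr_eq0 -normc_eq0 eq_le normc_ge0 andbT.
apply/ler_addgt0Pl => e e0; rewrite addr0.
have [N0 HN] := taylor_cvg z e0; have := HN (N + N0)%N (leq_addl _ _).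
rewrite big_split_ord/= [X in _ - (_ + X)]big1 ?addr0// => i _.
by rewrite a0 ?leq_addr// mul0r.
Qed.

Lemma max_modulus_superpoly : ~ (exists p : {poly R[i]}, forall z, f z = p.[z]) ->
  forall N, \forall r \near +oo, r ^+ N <= max_modulus r.
Proof.
move=> np N; have [n Nn an] := coef_neq0 np N.+1.
have A0 : 0 < normc (a n) by rewrite normc_gt0.
near=> r.
have r1 : 1 <= r by near: r; apply: nbhs_pinfty_ge; exact: num_real.
have rA : 2 / normc (a n) <= r by near: r; apply: nbhs_pinfty_ge; exact: num_real.
have r0 : 0 < r by rewrite (lt_le_trans _ r1).
have := coef_max_modulus n r0.
have : r ^+ N.+1 <= r ^+ n by rewrite ler_weXn2l.
move/(ler_wpM2l (ltW A0)).
have : 2 * r ^+ N <= normc (a n) * r ^+ N.+1.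
  by rewrite exprS mulrA ler_wpM2r ?exprn_ge0 ?(ltW r0)// mulrC -ler_pdivrMr.
lra.
Unshelve. all: by end_near. Qed.

Let partial_sumD z s N : \sum_(k < N) a k * (z + s) ^+ k - \sum_(k < N) a k * z ^+ k =
  \sum_(k < N) a k * ((z + s) ^+ k - z ^+ k).
Proof. by rewrite -sumrB; apply: eq_bigr => k _; ring. Qed.

(** A weight k would suffice; k^2 lets the same [S] serve [difference_linear]. *)
Lemma difference_le z s r c S : normc z <= r -> normc s <= c ->
  (forall N, \sum_(k < N) k%:R ^+ 2 * normc (a k) * (r + c) ^+ k <= S) ->
  r * normc (f (z + s) - f z) <= c * S.
Proof.
move=> zr sc HS; have r0 : 0 <= r := le_trans (normc_ge0 z) zr.
have c0 : 0 <= c := le_trans (normc_ge0 s) sc.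
apply/ler_addgt0Pr => e e0.
have e2 : 0 < e / (2 * (r + 1)) by rewrite divr_gt0// mulr_gt0// ltr_wpDl.
have [N1 H1] := taylor_cvg z e2; have [N2 H2] := taylor_cvg (z + s) e2.
have := H1 _ (leq_maxl N1 N2); have := H2 _ (leq_maxr N1 N2).
set N := maxn _ _ => {}H2 {}H1.
have E : f (z + s) - f z = \sum_(k < N) a k * ((z + s) ^+ k - z ^+ k) +
   ((f (z + s) - \sum_(k < N) a k * (z + s) ^+ k) - (f z - \sum_(k < N) a k * z ^+ k)).
  by rewrite -partial_sumD; ring.
rewrite E (le_trans (ler_wpM2l r0 (normcD _ _)))// mulrDr lerD//.
  rewrite (le_trans (ler_wpM2l r0 (normc_sum _ _ _)))// mulr_sumr.
  apply: (le_trans _ (ler_wpM2l c0 (HS N))); rewrite mulr_sumr; apply: ler_sum => k _.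
  rewrite normcM mulrCA.
  have := normc_powB_le k zr sc => /(ler_wpM2l (normc_ge0 (a k))) h; apply: (le_trans h).
  have -> : normc (a k) * (k%:R * c * (r + c) ^+ k) = k%:R * (c * (normc (a k) * (r + c) ^+ k)) by ring.
  have -> : c * (k%:R ^+ 2 * normc (a k) * (r + c) ^+ k) = k%:R ^+ 2 * (c * (normc (a k) * (r + c) ^+ k)) by ring.
  apply: ler_wpM2r; first by rewrite !mulr_ge0 ?normc_ge0 ?exprn_ge0 ?addr_ge0.
  by rewrite -natrX ler_nat; case: (nat_of_ord k) => // m; rewrite leq_pmull.
apply: (le_trans (ler_wpM2l r0 (normcB _ _))).
apply: (le_trans (ler_wpM2l r0 (lerD H2 H1))).
have -> : r * (e / (2 * (r + 1)) + e / (2 * (r + 1))) = e * (r / (r + 1)).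
  by field; rewrite gt_eqF// ltr_wpDl.
by rewrite ler_piMr ?(ltW e0)// ler_pdivrMr ?ltr_wpDl// mul1r lerDl.
Qed.

(** The linear parts k s z^(k-1) and (s / eta) k eta z^(k-1) cancel term by term, leaving two second
    order remainders. This transfers information on the direction [eta] to every direction. *)
Lemma difference_linear z s eta r S : eta != 0 -> normc z <= r -> normc s <= normc eta ->
  (forall N, \sum_(k < N) k%:R ^+ 2 * normc (a k) * (r + normc eta) ^+ k <= S) ->
  r ^+ 2 * normc (f (z + s) - f z - s / eta * (f (z + eta) - f z)) <= 2 * normc eta ^+ 2 * S.
Proof.
move=> eta0 zr sc HS; have r0 : 0 <= r := le_trans (normc_ge0 z) zr.
set c := normc eta in sc HS *.
have c0 : 0 < c by rewrite normc_gt0.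
have r2 : 0 <= r ^+ 2 by rewrite exprn_ge0.
have se : normc (s / eta) <= 1 by rewrite normcM normcV ler_pdivrMr// mul1r.
apply/ler_addgt0Pr => e e0.
have e2 : 0 < e / (4 * (r ^+ 2 + 1)) by rewrite divr_gt0// mulr_gt0// ltr_wpDl.
have [N1 H1] := taylor_cvg z e2; have [N2 H2] := taylor_cvg (z + s) e2.
have [N3 H3] := taylor_cvg (z + eta) e2.
pose N := (N1 + N2 + N3)%N.
have {}H1 := H1 N ltac:(by rewrite /N -addnA leq_addr).
have {}H2 := H2 N ltac:(by rewrite /N addnAC leq_addl).
have {}H3 := H3 N ltac:(by rewrite /N leq_addl).
pose p w := \sum_(k < N) a k * w ^+ k.
have E : f (z + s) - f z - s / eta * (f (z + eta) - f z) =
   \sum_(k < N) a k * (((z + s) ^+ k - z ^+ k) - s / eta * ((z + eta) ^+ k - z ^+ k)) +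
   (((f (z + s) - p (z + s)) - (f z - p z)) - s / eta * ((f (z + eta) - p (z + eta)) - (f z - p z))).
  have -> : \sum_(k < N) a k * (((z + s) ^+ k - z ^+ k) - s / eta * ((z + eta) ^+ k - z ^+ k)) =
    (p (z + s) - p z) - s / eta * (p (z + eta) - p z).
    rewrite /p !partial_sumD mulr_sumr -sumrB; apply: eq_bigr => k _; ring.
  by ring.
rewrite E (le_trans (ler_wpM2l r2 (normcD _ _)))// mulrDr lerD//.
  rewrite (le_trans (ler_wpM2l r2 (normc_sum _ _ _)))// mulr_sumr.
  have c20 : 0 <= 2 * c ^+ 2 by rewrite mulr_ge0// exprn_ge0// ltW.
  apply: (le_trans _ (ler_wpM2l c20 (HS N))); rewrite mulr_sumr; apply: ler_sum => k _.
  rewrite normcM mulrCA.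
  have B1 := normc_powB2_le k zr sc.
  have B2 := normc_powB2_le k zr (lexx c).
  have -> : (z + s) ^+ k - z ^+ k - s / eta * ((z + eta) ^+ k - z ^+ k) =
     ((z + s) ^+ k - z ^+ k - k%:R * s * z ^+ k.-1) -
     s / eta * ((z + eta) ^+ k - z ^+ k - k%:R * eta * z ^+ k.-1) by field.
  set D1 := _ - _ * _ * _ in B1 *; set D2 := _ - _ * _ * _ in B2 *.
  have B3 : r ^+ 2 * normc (D1 - s / eta * D2) <= 2 * (k%:R ^+ 2 * c ^+ 2 * (r + c) ^+ k).
    apply: (@le_trans _ _ (r ^+ 2 * (normc D1 + normc D2))).
      apply: ler_wpM2l => //; rewrite (le_trans (normcB _ _))// lerD2l normcM.
      by rewrite ler_piMl ?normc_ge0.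
    by rewrite mulrDr mulr_natl mulr2n lerD.
  apply: (le_trans (ler_wpM2l (normc_ge0 (a k)) B3)).
  by rewrite le_eqVlt; apply/orP; left; apply/eqP; ring.
apply: (@le_trans _ _ (r ^+ 2 * (4 * (e / (4 * (r ^+ 2 + 1)))))).
  apply: ler_wpM2l => //; rewrite (le_trans (normcB _ _))// normcM.
  have h1 := le_trans (normcB (f (z + s) - p (z + s)) (f z - p z)) (lerD H2 H1).
  have h2 := le_trans (normcB (f (z + eta) - p (z + eta)) (f z - p z)) (lerD H3 H1).
  have h3 : normc (s / eta) * normc (f (z + eta) - p (z + eta) - (f z - p z)) <=
     normc (f (z + eta) - p (z + eta) - (f z - p z)) by rewrite ler_piMl ?normc_ge0.
  have := lerD h1 (le_trans h3 h2); move: (e / _) => d; lra.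
have -> : r ^+ 2 * (4 * (e / (4 * (r ^+ 2 + 1)))) = e * (r ^+ 2 / (r ^+ 2 + 1)).
  by field; rewrite gt_eqF// ltr_wpDl.
by rewrite ler_piMr ?(ltW e0)// ler_pdivrMr ?ltr_wpDl// mul1r lerDl.
Qed.

(* Bounding the order by 1 / (2 (K + 1)) leaves room for the constants. *)
Lemma small_order_bound K : ~~ (0 < growth_order f)%E ->
  \forall x \near +oo, forall z, normc z <= 64 * x ^+ K -> normc (f z) <= expR x.
Proof.
rewrite -leNgt => ord0.
pose eps : R := (2 * K.+1%:R)^-1.
have eps0 : 0 < eps by rewrite invr_gt0 mulr_gt0.
have [r0 [r01 Hr]] : exists r0, 1 < r0 /\ forall r, r0 < r ->
    nevanlinna_char f r <= expR (eps * ln r).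
  have : (growth_order f < eps%:E)%E by rewrite (le_lt_trans ord0)// lte_fin.
  move=> /ereal_inf_lt[_ [A [M [Mr HM]] <-]] supA.
  (* The upper limit is an infimum of suprema over neighbourhoods of infinity; [A] contains all r >
     M. The 2 ensures ln r > 0. *)
  exists (Num.max 2 M); split; first by rewrite lt_max ltr1n.
  move=> r; rewrite gt_max => /andP[r2 Mr'].
  have : ((log_plus (nevanlinna_char f r) / ln r)%:E < eps%:E)%E.
    apply: le_lt_trans supA; apply: ereal_sup_ubound.
    by exists r => //; exact: HM.
  have lnr : 0 < ln r by rewrite ln_gt0// (lt_trans _ r2)// ltr1n.
  rewrite lte_fin ltr_pdivrMr// => /ltW h.
  apply: (@le_trans _ _ (expR (log_plus (nevanlinna_char f r)))); last by rewrite ler_expR.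
  by rewrite /log_plus lnK ?le_max ?lexx ?orbT// posrE lt_max ltr01.
have [M M0 HM] := entire_bounded r0 (entire_continuous_at ef).
near=> x => z zx.
have x32 : 128 <= x by near: x; apply: nbhs_pinfty_ge; exact: num_real.
have xM : M <= x by near: x; apply: nbhs_pinfty_ge; exact: num_real.
have x0 : 0 < x by rewrite (lt_le_trans _ x32).
have [zr|zr] := leP (normc z) r0.
  by rewrite (le_trans (HM _ zr))// (le_trans xM)// (le_trans _ (expR_ge1Dx x))// lerDr.
have z0 : 0 < normc z by rewrite (lt_trans _ zr)// (lt_trans _ r01).
have zn0 : z != 0 by rewrite -normc_gt0.
have [fz|fz] := leP (normc (f z)) 1.
  by rewrite (le_trans fz)// (le_trans _ (expR_ge1Dx x))// lerDl ltW.
have fz0 : 0 < normc (f z) by rewrite (lt_trans _ fz).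
rewrite -[leLHS]lnK ?posrE// ler_expR (le_trans (ln_le_log_plus fz0))//.
apply: (le_trans (log_plus_le_nevanlinna ef zn0)).
have z2 : r0 < 2 * normc z by lra.
(* The square root of x. As 2 |z| <= 128 x^K <= x^(K + 1), the exponent eps (K + 1) = 1/2 gives 3
   T(2 |z|) <= 3 q <= q^2 = x. *)
pose q := expR (ln x / 2).
have qq : q * q = x by rewrite -expRD -splitr lnK.
have q3 : 3 <= q.
  rewrite leNgt; apply/negP => q3.
  have : q * q < 9 by rewrite (_ : 9 = 3 * 3) ?ltr_pM ?expR_ge0// -natrM.
  rewrite qq; lra.
apply: (@le_trans _ _ (3 * q)); last by rewrite -qq ler_wpM2r// expR_ge0.
rewrite ler_wpM2l// (le_trans (Hr _ z2))// ler_expR.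
have : ln (2 * normc z) <= K.+1%:R * ln x.
  rewrite [leRHS]mulr_natl -lnXn// ler_ln ?posrE ?mulr_gt0 ?exprn_gt0//.
  apply: (@le_trans _ _ (128 * x ^+ K)); first by lra.
  by rewrite exprS ler_wpM2r// exprn_ge0// ltW.
move/(ler_wpM2l (ltW eps0)) => h; apply: (le_trans h).
rewrite /eps le_eqVlt; apply/orP; left; apply/eqP; move: (ln x) => l.
by field.
Unshelve. all: by end_near. Qed.

Let expR_le4 n : expR n%:R <= 4 ^+ n :> R.
Proof.
rewrite -[n%:R]mulr1 expRM_natl lerXn2r ?nnegrE ?expR_ge0//.
have h : expR (2^-1) <= 2 :> R.
  have := expR_ge1Dx (- 2^-1 : R); rewrite expRN => h.
  have e0 := expR_gt0 (2^-1 : R).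
  have : (1 - 2^-1) * expR 2^-1 <= (expR 2^-1)^-1 * expR 2^-1 :> R.
    by rewrite ler_wpM2r// ltW.
  rewrite mulVf ?gt_eqF//; lra.
have -> : expR 1 = expR 2^-1 * expR 2^-1 :> R by rewrite -expRD; congr expR; lra.
have -> : (4 : R) = 2 * 2 by rewrite -natrM.
by rewrite ler_pM ?expR_ge0.
Qed.

Let sum_bound (u : nat -> R) (B : R) m : 0 <= B ->
  (forall n, (n < m)%N -> u n <= B) -> (forall n, (m <= n)%N -> u n <= 4 / 2 ^+ n) ->
  forall N, \sum_(k < N) u k <= 8 + m%:R * B.
Proof.
move=> B0 h1 h2 N.
(* The exact value of the partial geometric sum makes the induction go through. *)
suff H : \sum_(k < N) u k <= 8 - 8 / 2 ^+ N + (minn N m)%:R * B.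
  apply: (le_trans H); apply: lerD.
    by rewrite lerBlDr lerDl divr_ge0// exprn_ge0.
  by rewrite ler_wpM2r// ler_nat geq_minr.
elim: N => [|N IH]; first by rewrite big_ord0 expr0 min0n divr1 subrr mul0r addr0.
rewrite big_ord_recr/=.
have p2 : 8 / 2 ^+ N = 2 * (8 / 2 ^+ N.+1) :> R by rewrite exprS; field; rewrite expf_neq0.
have p3 : 4 / 2 ^+ N = 8 / 2 ^+ N.+1 :> R by rewrite exprS; field; rewrite expf_neq0.
have p4 : 0 <= 8 / 2 ^+ N.+1 :> R by rewrite divr_ge0// exprn_ge0.
have [Nm|mN] := ltnP N m.
  have := h1 _ Nm; move: IH; rewrite (minn_idPl Nm) (minn_idPl (ltnW Nm)) -natr1; lra.
have := h2 _ mN; move: IH; rewrite (minn_idPr mN) (minn_idPr (leqW mN)); lra.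
Qed.

(** With r = x^K, at most x + 1 indices n <= x each contribute at most a constant times x^2 M(r),
    since (1 + c / r)^n <= 4. For n > x, Cauchy's estimate on radius 64 r and e^x <= 4^n, n^2 <=
    4^n, r + c <= 2 r leave 2 / 2^n; this is where 64 = 2 (2 4 4) comes from. *)
Lemma coef_sum_bound K c : (2 <= K)%N -> 0 <= c ->
  (\forall x \near +oo, forall z, normc z <= 64 * x ^+ K -> normc (f z) <= expR x) ->
  (\forall r \near +oo, 1 <= max_modulus r) ->
  \forall x \near +oo, forall N,
    \sum_(k < N) k%:R ^+ 2 * normc (a k) * (x ^+ K + c) ^+ k <=
    x ^+ 5 * max_modulus (x ^+ K).
Proof.
move=> K2 c0 fx [r1 [_ m1]]; near=> x => N.
have x1 : 100 <= x by near: x; apply: nbhs_pinfty_ge; exact: num_real.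
have xr : r1 < x by near: x; apply: nbhs_pinfty_gt; exact: num_real.
have xc : 2 * c <= x by near: x; apply: nbhs_pinfty_ge; exact: num_real.
have fb : forall z, normc z <= 64 * x ^+ K -> normc (f z) <= expR x by near: x.
have x0 : 0 < x by rewrite (lt_le_trans _ x1).
have x11 : 1 <= x by rewrite (le_trans _ x1)// ler1n.
set r := x ^+ K.
have rx2 : x ^+ 2 <= r by rewrite ler_weXn2l.
have rx : x <= r by rewrite (le_trans _ rx2)// expr2 ler_peMr// ltW.
have r0 : 0 < r by rewrite exprn_gt0.
have mm1 : 1 <= max_modulus r by apply: m1; exact: lt_le_trans xr rx.
pose m := (Num.truncn x).+1.
have xm : x < m%:R by exact: truncnS_gt.
have mx : m%:R <= x + 1 by rewrite -natr1 lerD2r truncn_le// ltW.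
have cr : c <= r by lra.
have B0 : 0 <= 32 * x ^+ 2 * max_modulus r.
  by rewrite !mulr_ge0 ?exprn_ge0 ?(ltW x0)// (le_trans ler01).
have sb := @sum_bound (fun k => k%:R ^+ 2 * normc (a k) * (r + c) ^+ k) _ m B0.
apply: (le_trans (sb _ _ N)).
- move=> n nm; have nx : n%:R <= x.
    by rewrite -(lerD2r 1) (le_trans _ mx)// natr1 ler_nat.
  have h := coef_max_modulus n r0.
  have -> : n%:R ^+ 2 * normc (a n) * (r + c) ^+ n =
     n%:R ^+ 2 * (normc (a n) * r ^+ n) * (1 + c / r) ^+ n.
    have -> : r + c = r * (1 + c / r) by field; rewrite gt_eqF.
    by rewrite exprMn; ring.
  have cr4 : (1 + c / r) ^+ n <= 4.
    have c1 : 1 + c / r <= expR (c / r) by exact: expR_ge1Dx.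
    have c2 : 0 <= c / r by rewrite divr_ge0// ltW.
    apply: (@le_trans _ _ (expR (c / r) ^+ n)).
      by rewrite lerXn2r// ?nnegrE ?expR_ge0// addr_ge0.
    rewrite -expRM_natl; apply: le_trans (_ : expR 1 <= _); last by have := expR_le4 1; rewrite expr1.
    rewrite ler_expR -mulr_natl mulrA ler_pdivrMr// mul1r.
    apply: le_trans rx2; rewrite expr2; apply: ler_pM => //; lra.
  have -> : 32 * x ^+ 2 * max_modulus r = 4 * (x ^+ 2 * (2 * max_modulus r) * 4) by ring.
  apply: (@le_trans _ _ (x ^+ 2 * (2 * max_modulus r) * 4)); last first.
    rewrite ler_peMl ?ler1n// !mulr_ge0 ?exprn_ge0 ?(ltW x0)// (le_trans ler01)//.
  apply: ler_pM => //.
  + by rewrite !mulr_ge0 ?exprn_ge0 ?normc_ge0// ltW.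
  + by rewrite exprn_ge0// addr_ge0// divr_ge0// ltW.
  apply: ler_pM => //; rewrite ?mulr_ge0 ?exprn_ge0 ?normc_ge0 ?(ltW r0)//.
  by rewrite lerXn2r// ?nnegrE// ltW.
- move=> n mn.
  have r64 : 0 < 64 * r by rewrite mulr_gt0.
  have h := taylor_coef_le ef n r64 fb.
  have xn : x <= n%:R by rewrite (le_trans (ltW xm))// ler_nat.
  have ex : expR x <= 4 ^+ n by rewrite (le_trans _ (expR_le4 n))// ler_expR.
  have n2 : n%:R ^+ 2 <= 4 ^+ n :> R.
    have -> : (4 : R) = 2 ^+ 2 by rewrite -natrX.
    rewrite exprAC lerXn2r// ?nnegrE ?exprn_ge0//.
    by rewrite -natrX ler_nat ltnW// ltn_expl.
  have rc : (r + c) ^+ n <= (2 * r) ^+ n.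
    by rewrite lerXn2r// ?nnegrE ?addr_ge0 ?mulr_ge0// ?(ltW r0)//; lra.
  have p32 : (64 * r) ^+ n = 32 ^+ n * (2 * r) ^+ n.
    by rewrite -exprMn; congr (_ ^+ _); ring.
  have h' : normc (a n) * (2 * r) ^+ n <= 2 * 4 ^+ n / 32 ^+ n.
    rewrite ler_pdivlMr ?exprn_gt0// -mulrA (mulrC _ (32 ^+ n)) -p32 (le_trans h)//.
    by rewrite ler_wpM2l.
  apply: (@le_trans _ _ (4 ^+ n * (2 * 4 ^+ n / 32 ^+ n))).
    rewrite -mulrA; apply: ler_pM => //; rewrite ?exprn_ge0//.
      by rewrite mulr_ge0 ?normc_ge0// exprn_ge0// addr_ge0// ltW.
    by apply: (le_trans _ h'); rewrite ler_wpM2l ?normc_ge0.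
  have -> : 32 ^+ n = 2 ^+ n * 4 ^+ n * 4 ^+ n :> R.
    by rewrite -!exprMn; congr (_ ^+ _); rewrite -!natrM.
  apply: (@le_trans _ _ (2 / 2 ^+ n)).
    by rewrite le_eqVlt; apply/orP; left; apply/eqP; field; rewrite !expf_neq0.
  by rewrite ler_wpM2r ?invr_ge0 ?exprn_ge0// ler_nat.
apply: (@le_trans _ _ (8 * max_modulus r + 2 * x * (32 * x ^+ 2 * max_modulus r))).
  apply: lerD; first by rewrite ler_peMr.
  by apply: ler_wpM2r => //; lra.
have -> : 8 * max_modulus r + 2 * x * (32 * x ^+ 2 * max_modulus r) =
   (8 + 64 * x ^+ 3) * max_modulus r by ring.
apply: ler_wpM2r; first by rewrite (le_trans ler01).
have x3 : 1 <= x ^+ 3 by rewrite exprn_ege1.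
apply: (@le_trans _ _ (72 * x ^+ 3)); first lra.
rewrite (exprD x 2 3); apply: ler_wpM2r; first by rewrite (le_trans ler01).
by rewrite expr2; nra.
Unshelve. all: by end_near. Qed.

End MaximumModulus.

(** * A contraction of the maximum modulus forces a polynomial *)

Section PolynomialGrowth.
Variable R : realType.
Variable f : R[i] -> R[i].
Hypothesis ef : entire f.

(** Iteration gives M(r1 / kap^m) <= 4^m M(r1). Cauchy's estimate then bounds |a_n| r1^n by 2 M(r1)
    (4 kap^n)^m, which tends to 0 with m once 4 kap^n <= 1/2. *)
Lemma taylor_coef_eq0_of_contraction (kap : R) K : 0 < kap < 1 -> (0 < K)%N ->
  (\forall x \near +oo, max_modulus f (x ^+ K) <= 4 * max_modulus f (kap * x ^+ K)) ->
  exists N, forall n, (N <= n)%N -> taylor_coef f n = 0.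
Proof.
move=> /andP[kap0 kap1] K0 [x1 [_ Hx]].
pose r1 := (`|x1| + 1) ^+ K.
have b0 : 0 < `|x1| + 1 by rewrite ltr_wpDl.
have r10 : 0 < r1 by rewrite exprn_gt0.
have Hr r : r1 <= r -> max_modulus f r <= 4 * max_modulus f (kap * r).
  move=> rr; have r0 : 0 < r := lt_le_trans r10 rr.
  pose x := expR (ln r / K%:R).
  have xr : x ^+ K = r.
    by rewrite -expRM_natl mulrC divfK ?lnK// pnatr_eq0 -lt0n.
  rewrite -xr; apply: Hx; rewrite ltNge; apply/negP => xx1.
  have xb : x < `|x1| + 1 by rewrite (le_lt_trans xx1)// (le_lt_trans (ler_norm _))// ltrDl.
  have : x ^+ K < r1 by rewrite ltrXn2r// ?nnegrE ?expR_ge0// ?ltW// -lt0n.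
  by rewrite xr ltNge rr.
have Hm m : max_modulus f (r1 / kap ^+ m) <= 4 ^+ m * max_modulus f r1.
  elim: m => [|m IH]; first by rewrite !expr0 divr1 mul1r.
  have km : kap ^+ m.+1 <= 1 by rewrite exprn_ile1// ltW.
  have : r1 <= r1 / kap ^+ m.+1.
    by rewrite ler_pdivlMr ?exprn_gt0// ler_piMr// ltW.
  move=> /Hr h; apply: (le_trans h); rewrite [X in _ <= X * _]exprS -mulrA ler_wpM2l//.
  by rewrite (_ : kap * _ = r1 / kap ^+ m)// exprS; field; rewrite expf_neq0 gt_eqF.
have [|N0 HN] := @expr_le_half R kap; first by rewrite (ltW kap0).
(* kap^N0 <= 1/2, and its cube, at most 1/8, absorbs the 4 and leaves 1/2. *)
exists (3 * N0)%N => n nN; apply/eqP/negPn/negP => an.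
have k8 : 4 * kap ^+ n <= 2^-1.
  apply: (@le_trans _ _ (4 * kap ^+ (3 * N0))).
    by rewrite ler_wpM2l// ler_wiXn2l// ltW.
  have h := HN _ (leqnn N0); have h0 : 0 <= kap ^+ N0 by rewrite exprn_ge0// ltW.
  have h2 : kap ^+ N0 * kap ^+ N0 <= 2^-1 * 2^-1 by rewrite ler_pM.
  have h3 : kap ^+ N0 * kap ^+ N0 * kap ^+ N0 <= 2^-1 * 2^-1 * 2^-1 by rewrite ler_pM// mulr_ge0.
  rewrite (_ : kap ^+ (3 * N0) = kap ^+ N0 * kap ^+ N0 * kap ^+ N0); first by lra.
  by rewrite -!exprD; congr (_ ^+ _); rewrite !mulSn mul0n addn0 addnA.
set A := normc (taylor_coef f n) * r1 ^+ n.
have A0 : 0 < A by rewrite mulr_gt0 ?exprn_gt0// normc_gt0.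
have Am m : A * 2 ^+ m <= 2 * max_modulus f r1.
  have rk : 0 < r1 / kap ^+ m by rewrite divr_gt0// exprn_gt0.
  have h := coef_max_modulus ef n rk.
  have kn : 0 < (kap ^+ n) ^+ m by rewrite !exprn_gt0.
  have E : normc (taylor_coef f n) * (r1 / kap ^+ m) ^+ n = A / (kap ^+ n) ^+ m.
    by rewrite /A expr_div_n -!exprM (mulnC m n) mulrA.
  move: h; rewrite E => /le_trans /(_ (ler_wpM2l (ler0n _ 2) (Hm m))).
  rewrite ler_pdivrMr// => h.
  apply: (@le_trans _ _ (2 * (4 ^+ m * max_modulus f r1) * (kap ^+ n) ^+ m * 2 ^+ m)).
    by rewrite ler_wpM2r// exprn_ge0.
  have -> : 2 * (4 ^+ m * max_modulus f r1) * (kap ^+ n) ^+ m * 2 ^+ m =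
     2 * max_modulus f r1 * (4 * kap ^+ n * 2) ^+ m by rewrite !exprMn; ring.
  rewrite ler_piMr ?mulr_ge0 ?max_modulus_ge0 ?(ltW r10)//.
  apply: exprn_ile1; first by rewrite !mulr_ge0// exprn_ge0// ltW.
  lra.
have := Am (Num.bound (2 * max_modulus f r1 / A)); apply/negP; rewrite -ltNge.
have B0 : 0 <= 2 * max_modulus f r1 / A.
  by rewrite divr_ge0 ?(ltW A0)// mulr_ge0// max_modulus_ge0// ltW.
have := archi_boundP B0; rewrite ltr_pdivrMr// => /lt_le_trans; apply.
by rewrite mulrC ler_wpM2l ?(ltW A0)// -natrX ler_nat ltnW// ltn_expl.
Qed.

End PolynomialGrowth.

(** * The walk inwards from a near-maximum point *)

Section Contraction.
Variable R : realType.
Variables (f : R[i] -> R[i]) (eta : R[i]).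
Hypotheses (ef : entire f) (eta0 : eta != 0).
Variables (D : nat) (L : R).
Hypothesis L1 : 1 <= L.
Hypothesis cL : normc eta <= L.
(** What [eval_zuv_bound] says along the solution: the last premise is |w|^D <= |z|, the conclusion
    |w| <= L. *)
Hypothesis HL : forall z, 1 <= normc z -> normc z ^+ D <= normc (f z) ->
  (normc z * normc (difference eta f z)) ^+ D <= normc z * normc (f z) ^+ D ->
  normc z * normc (difference eta f z) <= L * normc (f z).

Let c := normc eta.

(* Walking from a near-maximum point radially inwards by steps of length
   |eta|: each step costs at most [3 L m / r]. *)
Lemma max_modulus_contraction (x : R) K : (6 * D + 8 <= K)%N -> 4 <= x -> 2 * c ^+ 2 <= x ->
  4 * c <= x -> 24 * L <= x ->
  (x ^+ K) ^+ D.+1 <= max_modulus f (x ^+ K) ->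
  (forall N, \sum_(k < N) k%:R ^+ 2 * normc (taylor_coef f k) * (x ^+ K + c) ^+ k <=
    x ^+ 5 * max_modulus f (x ^+ K)) ->
  max_modulus f (x ^+ K) <= 4 * max_modulus f ((1 - c / (24 * L)) * x ^+ K).
Proof.
move=> KD x4 xc2 xc xL SP HS.
have c0 : 0 < c by rewrite normc_gt0.
have L0 : 0 < L := lt_le_trans ltr01 L1.
have x1 : 1 <= x by lra.
have x0 : 0 < x by lra.
set r := x ^+ K in SP HS *; set m := max_modulus f r in SP HS *.
set kap := 1 - _.
(* Since |w| <= x^6 along the walk and |z| >= r / 2 there, this yields the premise |w|^D <= |z| of
   [HL]. *)
have r6D : 2 * x ^+ (6 * D) <= r.
  apply: (@le_trans _ _ (x * x ^+ (6 * D))).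
    by rewrite ler_wpM2r ?exprn_ge0// ?ltW//; lra.
  by rewrite -exprS ler_weXn2l// (leq_trans _ KD)// -addn1 leq_add2l.
have r6 : x ^+ 6 <= r by rewrite ler_weXn2l// (leq_trans _ KD)// (leq_trans _ (leq_addl _ _)).
have rx : x <= r by rewrite -[leLHS]expr1 ler_weXn2l// (leq_trans _ KD)// (leq_trans _ (leq_addl _ _)).
have r0 : 0 < r := lt_le_trans x0 rx.
have r4 : 4 <= r by lra.
have rD1 : 1 <= r ^+ D by rewrite exprn_ege1//; lra.
have m4 : 4 * r ^+ D <= m.
  by apply: le_trans SP; rewrite exprS ler_wpM2r// (le_trans ler01).
have m0 : 0 < m by lra.
have kapE : kap * r = r - r * c / (24 * L) by rewrite /kap; ring.
have cL24 : r * c / (24 * L) <= r / 24.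
  rewrite ler_pdivrMr ?mulr_gt0//.
  have -> : r / 24 * (24 * L) = r * L by field.
  by rewrite ler_wpM2l// ltW.
have kap0 : 0 <= kap * r by rewrite kapE; lra.
have [z0 z0r z0m] := max_modulus_half (ltW r0) m0.
have [z0k|z0k] := leP (normc z0) (kap * r).
  by have := le_max_modulus ef z0k; rewrite -/m in z0m *; lra.
have nz0 : 0 < normc z0 := le_lt_trans kap0 z0k.
pose z (j : nat) := (1 - j%:R * c / normc z0)%:C * z0.
(* J steps lose at most J (3 L m / r) <= m / 4, so |f| stays above m / 4. They cover at most r / 12,
   so |z| >= r / 2, and at least r c / (12 L) - c >= r c / (24 L), enough to reach the radius
   [kap * r]. *)
pose J := Num.truncn (r / (12 * L)).
have J1 : J%:R <= r / (12 * L) by rewrite truncn_le// divr_ge0// ?mulr_ge0// ltW.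
have J2 : r / (12 * L) < J%:R + 1 by rewrite natr1 truncnS_gt.
have J1' : J%:R * (12 * L) <= r by rewrite -ler_pdivlMr// mulr_gt0.
have jc j : (j <= J)%N -> j%:R * c <= r / 12.
  move=> jJ; apply: (@le_trans _ _ (J%:R * L)).
    by rewrite ler_pM ?ler_nat// ltW.
  lra.
have nz j : (j <= J)%N -> normc (z j) = normc z0 - j%:R * c.
  move=> /jc h; rewrite /z normcM normcR ger0_norm; last first.
    by rewrite subr_ge0 ler_pdivrMr// mul1r; rewrite kapE in z0k; lra.
  by field; rewrite gt_eqF.
have zlo j : (j <= J)%N -> r / 2 <= normc (z j).
  by move=> jJ; rewrite nz//; have := jc _ jJ; rewrite kapE in z0k; lra.
have zhi j : (j <= J)%N -> normc (z j) <= r.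
  move=> jJ; rewrite nz//; have : 0 <= j%:R * c by rewrite mulr_ge0// ltW.
  lra.
(* The lower bound m / 4 makes [HL] applicable: with [m4] it gives |f| >= r^D, and it turns the
   bound x^5 m on differences into x^6 |f|. *)
have step j : (j < J)%N -> m / 4 <= normc (f (z j)) ->
    r * normc (f (z j)) - 3 * L * m <= r * normc (f (z j.+1)).
  move=> jJ; have jJ' := ltnW jJ; set U := normc (f (z j)) => U4.
  have Um : U <= m by apply: le_max_modulus; rewrite ?zhi.
  have U0 : 0 < U by lra.
  set v := difference eta f (z j).
  have rv : r * normc v <= c * (x ^+ 5 * m).
    by rewrite /v /difference; apply: difference_le => //; exact: zhi.
  have rvU : r * normc v <= x ^+ 6 * U.
    apply: (le_trans rv).
    have -> : x ^+ 6 * U = x * (x ^+ 5 * U) by rewrite exprS mulrA.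
    apply: (@le_trans _ _ (4 * c * (x ^+ 5 * U))); last first.
      by rewrite ler_wpM2r// mulr_ge0 ?exprn_ge0// ltW.
    have -> : 4 * c * (x ^+ 5 * U) = c * (x ^+ 5 * (4 * U)) by ring.
    by rewrite !ler_wpM2l ?exprn_ge0// ?(ltW c0) ?(ltW x0)//; lra.
  have zv : normc (z j) * normc v <= L * U.
    apply: HL.
    - by have := zlo _ jJ'; lra.
    - have : normc (z j) ^+ D <= r ^+ D.
        by rewrite lerXn2r ?nnegrE ?normc_ge0 ?(ltW r0)// zhi.
      by rewrite -/U; lra.
    rewrite -/U; apply: (@le_trans _ _ ((x ^+ 6 * U) ^+ D)).
      rewrite lerXn2r ?nnegrE ?mulr_ge0 ?normc_ge0 ?exprn_ge0 ?(ltW x0) ?(ltW U0)//.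
      by apply: le_trans rvU; rewrite ler_wpM2r ?normc_ge0// zhi.
    rewrite exprMn -exprM ler_wpM2r ?exprn_ge0 ?(ltW U0)//.
    by have := zlo _ jJ'; lra.
  have rv2 : r * normc v <= 2 * L * m.
    have h1 : r / 2 * normc v <= normc (z j) * normc v by rewrite ler_wpM2r ?normc_ge0// zlo.
    have h2 : L * U <= L * m by rewrite ler_wpM2l// ltW.
    lra.
  pose s := z j.+1 - z j.
  have sE : s = - ((c / normc z0)%:C * z0).
    have E1 : 1 - j.+1%:R * c / normc z0 = 1 - j%:R * c / normc z0 - c / normc z0.
      by rewrite -natr1; ring.
    rewrite /s /z E1; move: (1 - _) (c / normc z0) => p q.
    by rewrite rmorphB/=; ring.
  have ns : normc s = c.
    by rewrite sE normcN normcM normcR ger0_norm ?divr_ge0 ?normc_ge0// divfK// gt_eqF.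
  have zs : z j.+1 = z j + s by rewrite /s subrKC.
  have ns' : normc s <= normc eta by rewrite ns.
  have := difference_linear ef eta0 (zhi _ jJ') ns' HS.
  rewrite -zs -/c -[f (z j + eta) - f (z j)]/v.
  set E := f (z j.+1) - f (z j) - s / eta * v => rE.
  have rE2 : r * normc E <= L * m.
    rewrite -(ler_pM2l r0) mulrA -expr2 (le_trans rE)//.
    have -> : 2 * c ^+ 2 * (x ^+ 5 * m) = 2 * c ^+ 2 * x ^+ 5 * m by ring.
    rewrite [leRHS]mulrA ler_wpM2r ?(ltW m0)//.
    apply: (@le_trans _ _ (x * x ^+ 5)).
      by rewrite ler_wpM2r ?exprn_ge0// ltW.
    by rewrite -exprS (le_trans r6)// ler_peMr// ltW.
  have sv : normc (s / eta * v) = normc v.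
    by rewrite !normcM normcV ns divff ?mul1r// gt_eqF.
  (* As |s| = |eta|, the linear part has modulus |v|. After multiplication by r it costs 2 L m,
     because |z_j| >= r / 2, and the remainder costs L m. *)
  have UE : U <= normc (f (z j.+1)) + normc v + normc E.
    rewrite /U (_ : f (z j) = f (z j.+1) - s / eta * v - E); last by rewrite /E; ring.
    rewrite (le_trans (normcB _ _))// lerD2r (le_trans (normcB _ _))//.
    by rewrite sv.
  have := ler_wpM2l (ltW r0) UE; rewrite !mulrDr; lra.
have low j : (j <= J)%N -> r * m / 2 - j%:R * (3 * L * m) <= r * normc (f (z j)).
  have Lm : 0 <= 3 * L * m by rewrite !mulr_ge0// ltW.
  elim: j => [_|j IH jJ].
    rewrite mul0r subr0 /z mul0r mul0r subr0 mul1r -mulrA ler_wpM2l// ltW//.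
  have {}IH := IH (ltnW jJ).
  have jr : j%:R * (3 * L * m) <= r * m / 4.
    have : j%:R * (12 * L) <= r.
      by apply: le_trans J1'; rewrite ler_wpM2r ?mulr_ge0 ?ler_nat ?(ltW L0)// ltnW.
    move/(ler_wpM2r (ltW m0)); lra.
  have m4' : m / 4 <= normc (f (z j)).
    rewrite -(ler_pM2l r0); lra.
  by have := step _ jJ m4'; rewrite -natr1; lra.
have mJ : m / 4 <= normc (f (z J)).
  rewrite -(ler_pM2l r0); have := low _ (leqnn J).
  have := ler_wpM2r (ltW m0) J1'; lra.
have zJ : normc (z J) <= kap * r.
  rewrite nz// kapE.
  have h1 : r / (12 * L) * c <= (J%:R + 1) * c by rewrite ler_wpM2r// ltW.
  have h2 : c <= r * c / (24 * L).
    rewrite ler_pdivlMr ?mulr_gt0// mulrC ler_wpM2r ?(ltW c0)//; lra.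
  have h3 : r / (12 * L) * c = r * c / (24 * L) + r * c / (24 * L).
    by field; rewrite gt_eqF.
  lra.
by have := le_max_modulus ef zJ; lra.
Qed.

End Contraction.

(* Refutation of order zero *)
Local Close Scope classical_set_scope.

Theorem theorem7p5 (R : realType) (eta : R[i]) (heta : eta != 0)
  (Omega : {poly {poly {poly R[i]}}}) (hOmega : Omega != 0)
  (f : R[i] -> R[i]) (hf : transcendental_entire f)
  (hsol : forall z : R[i], eval_zuv Omega z (f z) (difference eta f z) = 0) :
  (0 < growth_order f)%E.
Proof.
apply/negPn/negP => ord0; have [ef np] := hf.
have [D [L0 L01 HL0]] := eval_zuv_bound hOmega.
(* L >= |eta| keeps the contraction ratio 1 - c / (24 L) at least 23 / 24 and the length of the walk
   at most r / 12. *)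
pose c := normc eta; pose L := Num.max L0 c.
have L1 : 1 <= L by rewrite le_max L01.
have cL : c <= L by rewrite le_max lexx orbT.
have c0 : 0 < c by rewrite normc_gt0.
have HL z : 1 <= normc z -> normc z ^+ D <= normc (f z) ->
    (normc z * normc (difference eta f z)) ^+ D <= normc z * normc (f z) ^+ D ->
    normc z * normc (difference eta f z) <= L * normc (f z).
  move=> z1 h1 h2; apply: (le_trans (HL0 _ _ _ z1 h1 h2 (hsol z))).
  by rewrite ler_wpM2r ?normc_ge0// le_max lexx.
pose K := (6 * D + 8)%N.
have K2 : (2 <= K)%N by rewrite (leq_trans _ (leq_addl _ _)).
have m1 := max_modulus_superpoly ef np 0.
have SP := max_modulus_superpoly ef np D.+1.
have CS := coef_sum_bound ef K2 (ltW c0) (small_order_bound ef K ord0) m1.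
have [N HN] : exists N, forall n, (N <= n)%N -> taylor_coef f n = 0.
  apply: (@taylor_coef_eq0_of_contraction R f ef (1 - c / (24 * L)) K) => //.
    have cl : c / (24 * L) <= 1 / 24.
      rewrite ler_pdivrMr ?mulr_gt0 ?(lt_le_trans ltr01 L1)//; lra.
    have cl0 : 0 < c / (24 * L) by rewrite divr_gt0// mulr_gt0// (lt_le_trans ltr01 L1).
    by apply/andP; split; lra.
    exact: ltnW.
  case: SP => r1 [_ SP].
  near=> x; apply: (max_modulus_contraction ef heta L1 cL HL).
  - by [].
  - by near: x; apply: nbhs_pinfty_ge; exact: num_real.
  - by near: x; apply: nbhs_pinfty_ge; exact: num_real.
  - by near: x; apply: nbhs_pinfty_ge; exact: num_real.
  - by near: x; apply: nbhs_pinfty_ge; exact: num_real.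
  - apply: SP; have x1 : 1 <= x by near: x; apply: nbhs_pinfty_ge; exact: num_real.
    have xr : r1 < x by near: x; apply: nbhs_pinfty_gt; exact: num_real.
    by apply: (lt_le_trans xr); rewrite -[leLHS]expr1 ler_weXn2l// ltnW.
  - by near: x.
(* A function that is not a polynomial has nonzero Taylor coefficients of arbitrarily large
   index. *)
have [n Nn an] := coef_neq0 ef np N.
by rewrite HN ?eqxx in an.
Unshelve. all: by end_near. Qed.
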